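(* Let $a\in\{2,4,8\}$. For any projective section $w\in\mathbb P(H^0(X^a,\mathcal E^a))^o=\mathbb P\mathcal J_3(\mathbb A)^o$, the zero-set $Z(w)\subset X^a$ of $w$ coincides with the isotropic subvariety $X^a_w\subset X^a$.
   Context: For $a=2,4,8$ let $\mathbb A$ be the complexification of $\mathbf C,\mathbf H,\mathbf O$, and $\mathcal J_3(\mathbb A)$ the complex Jordan algebra of $3\times3$ $\mathbb A$-Hermitian matrices with its cubic form $\det$. $SL_3(\mathbb A)$ is the semisimple group of linear transformations preserving $\det$ (derived group); it is of type $SL_3\times SL_3$, $SL_6$, $E_6$. $\mathbb P\mathcal J_3(\mathbb A)^o=\{[w]:\det w\ne0\}$ (matrices of rank $3$). For $w$ in it, $SO_3(\mathbb A)_w$ is the identity component of the stabilizer of $[w]$ in $SL_3(\mathbb A)$, of type $SL_3$, $Sp_6$, $F_4$ for $a=2,4,8$. Varieties $X^a\subset\mathbb P(V^a)$, bundles $\mathcal E^a$ on $X^a$ (satisfying $H^0(X^a,\mathcal E^a)=\mathcal J_3(\mathbb A)$), and the irreducible $SO_3(\mathbb A)_w$-submodule $V^a_w\subset V^a$: $a=2$: $\mathcal J_3(\mathbb A)=A^*\otimes B^*$ with $\dim A=\dim B=3$; $X^2=G(2,A)\times\mathbb P(B)\simeq\mathbb P^2\times\mathbb P^2$ in $\mathbb P(V^2)$, $V^2=\wedge^2A\otimes B$; $\mathcal E^2=\operatorname{Hom}(T,\mathcal O(1)')$ with $T$ the tautological rank two bundle of $G(2,A)$ and $\mathcal O(1)'$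 the hyperplane bundle of $\mathbb P(B)$. The form $w$ identifies $B\simeq A^*\simeq\wedge^2A$ and $V^2_w=\operatorname{Sym}^2A^*\subset A^*\otimes A^*$. $a=4$: $\mathcal J_3(\mathbb A)=\wedge^2\mathbf C^6$; $X^4=G(3,6)\subset\mathbb P(V^4)$, $V^4=\wedge^3\mathbf C^6$; $\mathcal E^4=\wedge^2Q$ with $Q$ the rank three quotient bundle; $V^4_w$ is the $14$-dimensional irreducible component of $\wedge^3\mathbf C^6$ under $Sp_6=SO_3(\mathbb A)_w$ (highest weight $\omega_3$). $a=8$: $\mathcal J_3(\mathbb A)$ is the $27$-dimensional $E_6$-module with infinitesimal action $d\rho_8$; $V^8=\mathfrak e_6$, $X^8=E_6^{ad}\subset\mathbb P\mathfrak e_6$ the adjoint variety; $\mathcal E^8$ has fiber $\mathcal J_3(\mathbb A)/\operatorname{Ker}d\rho_8(X)$ at $[X]$; $V^8_w=\mathfrak f_{4,w}$, the Lie algebra of $SO_3(\mathbb A)_w$. The isotropic variety $X^a_w$ is the closed $SO_3(\mathbb A)_w$-orbit in $\mathbb P(V^a_w)$; it equals $X^a\cap\mathbb P(V^a_w)$ (a copy of $v_2(\mathbb P^2)$, of the Lagrangian Grassmannian $LG(3,6)$, of the adjoint variety $F_4^{ad}$, respectively). $Z(w)$ is the zero locus of $w$ viewed as a global section of $\mathcal E^a$ (defined up to scalar). *)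

(* Defs.v *)
From mathcomp Require Import all_boot all_order all_fingroup all_algebra.
From mathcomp Require Import boolp classical_sets reals.
From mathcomp Require Import complex.

Set Implicit Arguments.
Unset Strict Implicit.
Unset Printing Implicit Defensive.

Import GRing.Theory.
Local Open Scope classical_set_scope.
Local Open Scope ring_scope.

(* Conventions.  A point [v] of P(V) is represented by a nonzero vector v, and
   a subset of P(V) by the set of all the nonzero vectors representing its
   points.  Closedness and connectedness refer to the Zariski topology. *)

Section Zariski.
Variables (K : fieldType) (V : lmodType K).

(* The algebra of polynomial functions on V. *)
Inductive polyfun : (V -> K) -> Prop :=
| polyfun_cst c : polyfun (fun=> c)
| polyfun_lin (l : {scalar V}) : polyfun l
| polyfun_add f g : polyfun f -> polyfun g -> polyfun (fun v => f v + g v)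
| polyfun_mul f g : polyfun f -> polyfun g -> polyfun (fun v => f v * g v).

Definition zariski_closed (S : set V) : Prop :=
  exists I : set (V -> K), I `<=` polyfun /\
    S = [set v | forall f, I f -> f v = 0].

Definition zariski_connected (S : set V) : Prop :=
  forall F1 F2 : set V, zariski_closed F1 -> zariski_closed F2 ->
    S `<=` F1 `|` F2 -> S `&` (F1 `&` F2) = set0 -> S `<=` F1 \/ S `<=` F2.

(* The connected component of x in S. *)
Definition component (S : set V) (x : V) : set V :=
  [set y | exists C : set V, [/\ C `<=` S, zariski_connected C, C x & C y]].

End Zariski.

Section Orbits.
Variables (K : fieldType) (gT : Type) (V : lmodType K).
Variables (G : set gT) (act : gT -> V -> V).

Definition proj_orbit (v : V) : set V :=
  [set u | exists g c, [/\ G g, c != 0 & u = c *: act g v]].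

(* Y is closed in P(V) iff its affine cone, vertex included, is closed in V. *)
Definition is_closed_orbit (W Y : set V) : Prop :=
  (exists v, [/\ W v, v != 0 & Y = proj_orbit v]) /\
  zariski_closed (Y `|` [set 0]).

(* The closed G-orbit in P(W), for W an irreducible G-module. *)
Definition closed_orbit (W : set V) : set V := xget set0 (is_closed_orbit W).

End Orbits.

Section Irreducible.
Variables (K : fieldType) (gT : Type) (V : vectType K).
Variables (G : set gT) (act : gT -> V -> V).

Definition submodule (U : {vspace V}) : Prop :=
  forall g v, G g -> v \in U -> act g v \in U.

Definition irreducible_submodule (W : {vspace V}) : Prop :=
  [/\ W != 0%VS, submodule W &
      forall U : {vspace V}, (U <= W)%VS -> submodule U -> U = 0%VS \/ U = W].

End Irreducible.

Section ExteriorPower.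
Variables (K : fieldType) (k n : nat).

(* Tensors in (K^n)^{(x) k}, by coordinates indexed by maps 'I_k -> 'I_n. *)
Definition tensor := {ffun {ffun 'I_k -> 'I_n} -> K^o}.

(* In characteristic 0, wedge^k K^n is the space of antisymmetric tensors. *)
Definition ext_power : set tensor :=
  [set t | forall (s : 'S_k) (f : {ffun 'I_k -> 'I_n}),
     t [ffun i => f (s i)] = (-1) ^+ s * t f].

(* The coordinates of the wedge of the rows of M are the k x k minors of M;
   up to scalar this is the Pluecker embedding of the row space of M. *)
Definition wedge (M : 'M[K]_(k, n)) : tensor :=
  [ffun f : {ffun 'I_k -> 'I_n} => \det (colsub f M)].

(* The action induced by x |-> x *m g on row vectors. *)
Definition tensor_act (g : 'M[K]_n) (t : tensor) : tensor :=
  [ffun f : {ffun 'I_k -> 'I_n} =>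
     \sum_(h : {ffun 'I_k -> 'I_n}) t h * \prod_(i < k) g (h i) (f i)].

End ExteriorPower.

Section Case2.
Variable K : fieldType.

(* A = B = K^3 (row vectors).  The element w of J_3(A) = A^* (x) B^* is the
   matrix of the bilinear form (a, b) |-> a *m w *m b^T, and its cubic form is
   \det w.  Intrinsically: complexified C is K x K with the swap, and an
   Hermitian matrix over it is a pair (w, w^T). *)

(* SL(A) x SL(B), a finite cover of the derived group of the group of linear
   transformations of A^* (x) B^* preserving \det. *)
Definition SL2case : set ('M[K]_3 * 'M[K]_3) :=
  [set g | \det g.1 = 1 /\ \det g.2 = 1].

Definition J2_act (g : 'M[K]_3 * 'M[K]_3) (w : 'M[K]_3) : 'M[K]_3 :=
  invmx g.1 *m w *m (invmx g.2)^T.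

Definition SO2case (w : 'M[K]_3) : set ('M[K]_3 * 'M[K]_3) :=
  component
    [set g | SL2case g /\ exists c, c != 0 /\ J2_act g w = c *: w]
    (1%:M, 1%:M).

(* (K^3)^{(x) 2} (x) K^3, which contains V^2 = wedge^2 A (x) B. *)
Definition T2 := {ffun {ffun 'I_2 -> 'I_3} * 'I_3 -> K^o}.

Definition V2 : set T2 :=
  [set t | forall l, ext_power [ffun f => t (f, l)]].

Definition V2_act (g : 'M[K]_3 * 'M[K]_3) (t : T2) : T2 :=
  [ffun p : {ffun 'I_2 -> 'I_3} * 'I_3 =>
     \sum_l tensor_act g.1 [ffun f => t (f, l)] p.1 * g.2 l p.2].

Definition pure2 (M : 'M[K]_(2, 3)) (b : 'rV[K]_3) : T2 :=
  [ffun p : {ffun 'I_2 -> 'I_3} * 'I_3 => wedge M p.1 * b 0 p.2].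

(* det (e_(f 0), e_(f 1), e_i), for the standard volume form on A. *)
Definition vol (f : {ffun 'I_2 -> 'I_3}) (i : 'I_3) : K :=
  \det (col_mx (\matrix_(p < 2, q < 3) (f p == q)%:R)
               (delta_mx (0 : 'I_1) i) : 'M[K]_3).

(* The image of t in A^* (x) A^* under wedge^2 A ~ A^* given by the volume form
   and B ~ A^* given by w: up to the factor 2, (a1 /\ a2) (x) b is sent to
   det(a1, a2, -) (x) w(-, b). *)
Definition form2 (w : 'M[K]_3) (t : T2) : 'M[K]_3 :=
  \matrix_(i, j) \sum_f \sum_l t (f, l) * vol f i * w j l.

Definition V2_w (w : 'M[K]_3) : set T2 :=
  [set t | V2 t /\ (form2 w t)^T = form2 w t].

(* At the point (T, [b]) of G(2, A) x P(B), with T the row space of M, the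
   section w of Hom(T, O(1)') is the map a |-> w(a, -)|_(K b). *)
Definition zero_locus2 (w : 'M[K]_3) : set T2 :=
  [set t | exists (M : 'M[K]_(2, 3)) (b : 'rV[K]_3),
     [/\ row_free M, b != 0, t = pure2 M b & M *m w *m b^T = 0]].

Definition isotropic2 (w : 'M[K]_3) : set T2 :=
  closed_orbit (SO2case w) V2_act (V2_w w).

End Case2.

Section Case4.
Variable K : fieldType.

(* The element w of J_3(A) = wedge^2 K^6 is an antisymmetric matrix, x /\ y being
   x^T *m y - y^T *m x for row vectors x and y; its cubic form is the Pfaffian.
   Intrinsically: complexified H is 'M_2 with the adjugate, and multiplying
   on the right by diag(J, J, J), with J the symplectic 2 x 2 matrix, turns a
   Hermitian 3 x 3 matrix over it into an antisymmetric 6 x 6 matrix. *)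

(* The factor 48 is 2^3 3!. *)
Definition pfaffian6 (w : 'M[K]_6) : K :=
  (\sum_(s : 'S_6) (-1) ^+ s *
     \prod_(i < 3) w (s (inord i.*2)) (s (inord i.*2.+1))) / 48%:R.

(* SL_6, a finite cover of the derived group of the group of linear
   transformations of wedge^2 K^6 preserving the Pfaffian. *)
Definition SL4case : set 'M[K]_6 := [set g | \det g = 1].

Definition J4_act (g w : 'M[K]_6) : 'M[K]_6 := g^T *m w *m g.

Definition SO4case (w : 'M[K]_6) : set 'M[K]_6 :=
  component [set g | SL4case g /\ exists c, c != 0 /\ J4_act g w = c *: w] 1%:M.

Definition V4_act (g : 'M[K]_6) (t : tensor K 3 6) : tensor K 3 6 :=
  tensor_act g t.

(* wedge^3 K^6 has, under Sp_6, a unique irreducible submodule of dimension 14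
   (its highest weight is omega_3). *)
Definition V4_w (w : 'M[K]_6) : {vspace tensor K 3 6} :=
  xget 0%VS [set W : {vspace tensor K 3 6} |
    [/\ forall t, t \in W -> ext_power t,
        irreducible_submodule (SO4case w) V4_act W & \dim W = 14%N]].

(* At the point T of G(3, 6), with T the row space of M, the section w of
   wedge^2 Q is the image of w by the projection K^6 -> K^6 / T, which is
   represented by x |-> x *m cokermx M. *)
Definition zero_locus4 (w : 'M[K]_6) : set (tensor K 3 6) :=
  [set t | exists M : 'M[K]_(3, 6),
     [/\ row_free M, t = wedge M &
         (cokermx M)^T *m w *m cokermx M = 0]].

Definition isotropic4 (w : 'M[K]_6) : set (tensor K 3 6) :=
  closed_orbit (SO4case w) V4_act [set t | t \in V4_w w].

End Case4.

(* Cayley-Dickson doubling of an algebra with product m and conjugation c; three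
   doublings of K give the complexification of R < C < H < O when K is C. *)
Section CayleyDickson.
Variable (T : zmodType).

Definition cd_mul (m : T -> T -> T) (c : T -> T) (x y : T * T) : T * T :=
  (m x.1 y.1 - m (c y.2) x.2, m y.2 x.1 + m x.2 (c y.1)).

Definition cd_conj (c : T -> T) (x : T * T) : T * T := (c x.1, - x.2).

End CayleyDickson.

Section Octonions.
Variable K : fieldType.

Definition Cc := (K^o * K^o)%type.
Definition Hc := (Cc * Cc)%type.
Definition Oc := (Hc * Hc)%type.

Definition Cmul : Cc -> Cc -> Cc := cd_mul (fun x y : K^o => x * y) id.
Definition Cconj : Cc -> Cc := cd_conj (id : K^o -> K^o).
Definition Hmul : Hc -> Hc -> Hc := cd_mul Cmul Cconj.
Definition Hconj : Hc -> Hc := cd_conj Cconj.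
Definition Omul : Oc -> Oc -> Oc := cd_mul Hmul Hconj.
Definition Oconj : Oc -> Oc := cd_conj Hconj.

Definition Ore (x : Oc) : K := x.1.1.1.
Definition Onorm (x : Oc) : K := Ore (Omul x (Oconj x)).

(* ((r1, r2, r3), (x1, x2, x3)) stands for the Hermitian matrix
     (  r1    x3   x2^* )
     ( x3^*   r2    x1  )
     (  x2   x1^*   r3  ).  *)
Definition J8 := ((K^o * K^o * K^o) * (Oc * Oc * Oc))%type.

Definition det8 (w : J8) : K :=
  let: ((r1, r2, r3), (x1, x2, x3)) := w in
  r1 * r2 * r3 - r1 * Onorm x1 - r2 * Onorm x2 - r3 * Onorm x3
  + 2%:R * Ore (Omul (Omul x1 x2) x3).

End Octonions.

Section LinearGroups.
Variables (K : fieldType) (V : vectType K).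

Inductive derived_group (G : set 'End(V)) : set 'End(V) :=
| derived_1 : derived_group G \1%VF
| derived_M a b g : G a -> G b -> derived_group G g ->
    derived_group G (a \o b \o a^-1 \o b^-1 \o g)%VF.

(* The Zariski tangent space at 1: the differential at 1 of every polynomial
   function f vanishing on G vanishes at X, where p`_1 is the derivative at
   t = 0 of p.[t] = f (1 + t X). *)
Definition lie_algebra (G : set 'End(V)) : set 'End(V) :=
  [set X | forall (f : 'End(V) -> K) (p : {poly K}),
     polyfun f -> (forall g, G g -> f g = 0) ->
     (forall t, f (\1%VF + t *: X) = p.[t]) -> p`_1 = 0].

Definition Ad (g X : 'End(V)) : 'End(V) := (g \o X \o g^-1)%VF.

End LinearGroups.

Section Case8.
Variable K : fieldType.

Definition SL8case : set 'End(J8 K) :=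
  derived_group [set g : 'End(J8 K) |
    lker g = 0%VS /\ forall w, det8 (g w) = det8 w].

Definition SO8case (w : J8 K) : set 'End(J8 K) :=
  component [set g | SL8case g /\ exists c, c != 0 /\ g w = c *: w] \1%VF.

Definition e6 : set 'End(J8 K) := lie_algebra SL8case.

Definition E6ad : set 'End(J8 K) := closed_orbit SL8case (@Ad _ _) e6.

Definition f4 (w : J8 K) : set 'End(J8 K) := lie_algebra (SO8case w).

(* The value at [X] of the section w of E^8 is the class of w in J_3(A) / Ker X. *)
Definition zero_locus8 (w : J8 K) : set 'End(J8 K) :=
  [set X | E6ad X /\ w \in lker X].

Definition isotropic8 (w : J8 K) : set 'End(J8 K) :=
  closed_orbit (SO8case w) (@Ad _ _) (f4 w).

End Case8.

(* Main.v *)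
(* Let G be the stabilizer of w and W the G-module V^a_w.  A polynomial path from 1 in the
   group of the transformations fixing w stays in its identity component, and the points of
   Z(w) give such paths 1 + s N with N^2 = 0.  By these paths any two points of Z(w) are
   conjugate, directly or through intermediate points in general position; and as
   s -> infinity, a path chosen for a given nonzero vector of W degenerates it to a point of
   Z(w).  As Z(w) is closed and G-stable, it is then the only closed orbit in P(W).
   - For a = 2, W is the space of symmetric forms, and Z(w) is that of the forms of rank 1.
   - For a = 4, Z(w) consists of the Lagrangian subspaces for the form w, and W of the trivectors
     with no contraction by w.  No nonzero element of W vanishes on 14 explicit Lagrangians,
     each of which is transverse to a common one.
   - For a = 8, Z(w) consists of the extremal elements F of the Lie algebra e_6 that kill w:
     F^2 = 0, and F X F is a multiple of F for all X in e_6.  One has to find, for every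
     nonzero X in the Lie algebra of G (and of E_6, for w = 0), such an F with F X F <> 0, all
     of them linked.  This is done in a weight basis, where det is a signed sum of
     45 monomials, after reducing w to a combination of three weight vectors. *)

Require Import Defs.
From HB Require Import structures.
From mathcomp Require Import all_boot all_order all_fingroup all_algebra.
From mathcomp Require Import boolp classical_sets reals.
From mathcomp Require Import complex ring.

Set Implicit Arguments.
Unset Strict Implicit.
Unset Printing Implicit Defensive.

Import Order.TTheory GRing.Theory Num.Theory.
Local Open Scope classical_set_scope.
Local Open Scope ring_scope.

(** * Polynomial curves and closed orbits *)

Section PolynomialCurves.
Variable K : numClosedFieldType.

Inductive polycurve (V : lmodType K) : (K -> V) -> Prop :=
| polycurve_cst v : polycurve (fun=> v)
| polycurve_add p q : polycurve p -> polycurve q -> polycurve (fun s => p s + q s)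
| polycurve_scale p : polycurve p -> polycurve (fun s => s *: p s).

Lemma polycurve_lin (V W : lmodType K) (f : {linear V -> W}) p :
  polycurve p -> polycurve (fun s => f (p s)).
Proof.
elim=> [v|p1 q _ IHp _ IHq|p1 _ IHp]; first exact: polycurve_cst.
- under eq_fun do rewrite linearD; exact: polycurve_add.
- under eq_fun do rewrite linearZ; exact: polycurve_scale.
Qed.

Lemma polycurve_bilin (U V W : lmodType K) (f : U -> V -> W) p q :
  (forall u, linear (f u)) -> (forall v, linear (f^~ v)) ->
  polycurve p -> polycurve q -> polycurve (fun s => f (p s) (q s)).
Proof.
move=> fr fl.
elim=> [u|p1 p2 _ IH1 _ IH2|p1 _ IH] Hq.
- pose fu : {linear V -> W} := HB.pack (f u) (GRing.isLinear.Build _ _ _ _ _ (fr u)).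
  exact: (polycurve_lin fu Hq).
- have -> : (fun s => f (p1 s + p2 s) (q s)) = (fun s => f (p1 s) (q s) + f (p2 s) (q s)).
    by apply/funext => s; have := fl (q s) 1 (p1 s) (p2 s); rewrite !scale1r.
  by apply: polycurve_add; [exact: IH1|exact: IH2].
- have -> : (fun s => f (s *: p1 s) (q s)) = (fun s => s *: f (p1 s) (q s)).
    apply/funext => s.
    have f0 : f 0 (q s) = 0.
      have := fl (q s) (-1) 0 0; by rewrite scaler0 addr0 scaleN1r addNr.
    by have := fl (q s) s (p1 s) 0; rewrite f0 !addr0.
  by apply: polycurve_scale; exact: IH.
Qed.

Lemma polycurve_scalar (p : K -> K^o) : polycurve p ->
  exists q : {poly K}, forall s, p s = q.[s].
Proof.
elim=> [v|p1 q1 _ [p2 Hp] _ [q2 Hq]|p1 _ [p2 Hp]].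
- by exists v%:P => s; rewrite hornerC.
- by exists (p2 + q2) => s; rewrite hornerD Hp Hq.
- by exists ('X * p2) => s; rewrite hornerM hornerX Hp.
Qed.

Lemma polycurve_polyfun (V : lmodType K) (p : K -> V) (f : V -> K) :
  polycurve p -> polyfun f -> exists q : {poly K}, forall s, f (p s) = q.[s].
Proof.
move=> Hp; elim=> [c|l|f1 f2 _ [p1 H1] _ [p2 H2]|f1 f2 _ [p1 H1] _ [p2 H2]].
- by exists c%:P => s; rewrite hornerC.
- exact/polycurve_scalar/polycurve_lin.
- by exists (p1 + p2) => s; rewrite hornerD H1 H2.
- by exists (p1 * p2) => s; rewrite hornerM H1 H2.
Qed.

Lemma poly_vanish (q : {poly K}) : (forall s, s != 0 -> q.[s] = 0) -> q = 0.
Proof.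
move=> H; apply/eqP; case: (eqVneq q 0) => // q0.
pose rs : seq K := [seq (i.+1)%:R | i <- iota 0 (size q)].
have : (size rs < size q)%N.
  apply: max_poly_roots => //.
  - by apply/allP => x /mapP [i _ ->]; apply/eqP/H; rewrite pnatr_eq0.
  - rewrite map_inj_uniq ?iota_uniq // => i j /eqP; rewrite eqr_nat => /eqP [] //.
by rewrite size_map size_iota ltnn.
Qed.

Lemma polycurve_closed (V : lmodType K) (p : K -> V) (S : set V) :
  polycurve p -> zariski_closed S -> (forall s, s != 0 -> S (p s)) -> forall s, S (p s).
Proof.
move=> Hp [I [HI ->]] HS s f If.
have [q Hq] := polycurve_polyfun Hp (HI _ If).
rewrite Hq (@poly_vanish q) ?horner0 // => t t0.
by rewrite -Hq; exact: HS.
Qed.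

Lemma polycurve_connected (V : lmodType K) (p : K -> V) :
  polycurve p -> zariski_connected (range p).
Proof.
move=> Hp F1 F2 [I1 [H1 ->]] [I2 [H2 ->]] cover _.
have [|nF1] := pselect (range p `<=` [set v | forall f, I1 f -> f v = 0]); first by left.
right => _ [s _ <-] f2 If2.
have [f1 [If1 [s1 f1s]]] : exists f1, I1 f1 /\ exists s, f1 (p s) != 0.
  apply: contra_notP nF1 => no _ [t _ <-] f1 If1.
  by apply/eqP; apply: contra_notT no => ?; exists f1; split => //; exists t.
have [q1 Hq1] := polycurve_polyfun Hp (H1 _ If1).
have [q2 Hq2] := polycurve_polyfun Hp (H2 _ If2).
have : q1 * q2 = 0.
  apply: poly_vanish => t _; rewrite hornerM -Hq1 -Hq2.
  by have [/(_ _ If1)->|/(_ _ If2)->] := cover (p t) (ex_intro2 _ _ t I erefl);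
    rewrite ?mul0r ?mulr0.
move/eqP; rewrite mulf_eq0 => /orP [/eqP q10|/eqP q20].
- by move: f1s; rewrite Hq1 q10 horner0 eqxx.
- by rewrite Hq2 q20 horner0.
Qed.

Lemma component_polycurve (V : lmodType K) (S : set V) (p : K -> V) :
  polycurve p -> (forall s, S (p s)) -> forall s, component S (p 0) (p s).
Proof.
move=> Hp HS s; exists (range p); split.
- by move=> _ [t _ <-]; exact: HS.
- exact: polycurve_connected.
- by exists 0.
- by exists s.
Qed.

Lemma component_sub (V : lmodType K) (S : set V) x : component S x `<=` S.
Proof. by move=> y [C [CS _ _ Cy]]; exact: CS. Qed.

End PolynomialCurves.

Section ClosedOrbit.
Variables (K : numClosedFieldType) (gT : Type) (V : lmodType K).
Variables (G : set gT) (act : gT -> V -> V) (W Z : set V).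

Lemma closed_orbitE :
  zariski_closed (Z `|` [set 0]) ->
  (exists v, W v /\ Z v) ->
  ~ Z 0 ->
  (forall c v, c != 0 -> Z v -> Z (c *: v)) ->
  (forall g v, G g -> Z v -> Z (act g v)) ->
  (forall g v, G g -> W v -> Z (act g v) -> Z v) ->
  (forall u v, Z u -> Z v -> exists g c, [/\ G g, c != 0 & v = c *: act g u]) ->
  (forall v, W v -> v != 0 -> exists p : K -> V,
     [/\ polycurve p, Z (p 0) & forall s, s != 0 -> proj_orbit G act v (p s)]) ->
  closed_orbit G act W = Z.
Proof.
move=> Zcl [v0 [Wv0 Zv0]] Z0 Zsc Zst ZstV Ztr Zdeg.
have ZN c v : c != 0 -> Z (c *: v) -> Z v.
  move=> c0 /(Zsc c^-1 _); rewrite invr_eq0 => /(_ c0).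
  by rewrite scalerA mulVf // scale1r.
have orb v : Z v -> Z = proj_orbit G act v.
  move=> Zv; apply/seteqP; split => u.
  - by move=> Zu; exact: Ztr.
  - by move=> [g [c [Gg c0 ->]]]; apply: Zsc => //; exact: Zst.
have isZ : is_closed_orbit G act W Z.
  split=> //; exists v0; split => //; last exact: orb.
  by apply/eqP => v00; apply: Z0; rewrite -v00.
have uniqZ Y : is_closed_orbit G act W Y -> Y = Z.
  move=> [[v [Wv v0n EY]] Ycl].
  have [p [Hp Zp0 Yp]] := Zdeg _ Wv v0n.
  have : (Y `|` [set 0]) (p 0).
    by apply: (polycurve_closed Hp Ycl) => s s0; left; rewrite EY; exact: Yp.
  case=> [|/= p00]; last by case: Z0; rewrite -p00.
  rewrite EY => -[g [c [Gg c0 E0]]].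
  have Zv : Z v.
    by apply: (ZstV g) => //; apply: (ZN c) => //; rewrite -E0.
  exact/esym/orb.
rewrite /closed_orbit; case: xgetP => [Y _ /uniqZ //|/(_ Z)]; first by [].
Qed.

End ClosedOrbit.

(** * Extremal derivations of a cubic form *)

Section SymmetricTrilinear.
Variables (K : numClosedFieldType) (V : vectType K).

Definition sym_trilinear (T : V -> V -> V -> K) : Prop :=
  [/\ forall y z a x x', T (a *: x + x') y z = a * T x y z + T x' y z,
      forall x y z, T x y z = T y x z & forall x y z, T x y z = T x z y].

Variable T : V -> V -> V -> K.
Hypothesis HT : sym_trilinear T.

Lemma trilinC12 x y z : T x y z = T y x z. Proof. by case: HT. Qed.
Lemma trilinC23 x y z : T x y z = T x z y. Proof. by case: HT. Qed.
Lemma trilinP1 a x x' y z : T (a *: x + x') y z = a * T x y z + T x' y z.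
Proof. by case: HT. Qed.

Lemma trilinD1 x x' y z : T (x + x') y z = T x y z + T x' y z.
Proof. by have := trilinP1 1 x x' y z; rewrite scale1r mul1r. Qed.

Lemma trilin01 y z : T 0 y z = 0.
Proof. by apply: (addrI (T 0 y z)); rewrite -trilinD1 !addr0. Qed.

Lemma trilinZ1 a x y z : T (a *: x) y z = a * T x y z.
Proof. by have := trilinP1 a x 0 y z; rewrite trilin01 !addr0. Qed.

Lemma trilinD2 x y y' z : T x (y + y') z = T x y z + T x y' z.
Proof. by rewrite trilinC12 trilinD1 ![T _ x z]trilinC12. Qed.
Lemma trilinZ2 a x y z : T x (a *: y) z = a * T x y z.
Proof. by rewrite trilinC12 trilinZ1 [T _ x z]trilinC12. Qed.
Lemma trilin02 x z : T x 0 z = 0. Proof. by rewrite trilinC12 trilin01. Qed.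
Lemma trilinD3 x y z z' : T x y (z + z') = T x y z + T x y z'.
Proof. by rewrite trilinC23 trilinD2 ![T x _ y]trilinC23. Qed.
Lemma trilinZ3 a x y z : T x y (a *: z) = a * T x y z.
Proof. by rewrite trilinC23 trilinZ2 [T x _ y]trilinC23. Qed.
Lemma trilin03 x y : T x y 0 = 0. Proof. by rewrite trilinC23 trilin02. Qed.

Definition trilinE := (trilinD1, trilinD2, trilinD3, trilinZ1, trilinZ2, trilinZ3,
  trilin01, trilin02, trilin03).

Lemma polarization x y z :
  6%:R * T x y z = T (x + y + z) (x + y + z) (x + y + z)
    - T (x + y) (x + y) (x + y) - T (x + z) (x + z) (x + z)
    - T (y + z) (y + z) (y + z) + T x x x + T y y y + T z z z.
Proof.
have a u v : T u v u = T u u v by rewrite trilinC23.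
have b u v : T v u u = T u u v by rewrite trilinC12 trilinC23.
rewrite !trilinE.
rewrite !(a x y) !(a y x) !(a x z) !(a z x) !(a y z) !(a z y).
rewrite !(b x y) !(b y x) !(b x z) !(b z x) !(b y z) !(b z y).
rewrite (trilinC12 z x y) (trilinC23 x z y) (trilinC12 y x z).
rewrite (trilinC23 z y x) (trilinC12 z x y) (trilinC23 x z y).
rewrite (trilinC23 y z x) (trilinC12 y x z).
ring.
Qed.

End SymmetricTrilinear.

Lemma trilin_inj (K : numClosedFieldType) (V : vectType K) (T U : V -> V -> V -> K) :
  sym_trilinear T -> sym_trilinear U ->
  (forall x, T x x x = U x x x) -> forall x y z, T x y z = U x y z.
Proof.
move=> HT HU E x y z; apply: (@mulfI _ 6%:R); first by rewrite pnatr_eq0.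
by rewrite !polarization // !E.
Qed.

Lemma lfun_invl (K : fieldType) (V : vectType K) (g h : 'End(V)) :
  (g \o h)%VF = \1%VF ->
  [/\ lker g = 0%VS, lker h = 0%VS, (h \o g)%VF = \1%VF & (g^-1)%VF = h].
Proof.
have inj (f k : 'End(V)) : (f \o k)%VF = \1%VF -> lker k == 0%VS.
  move=> E; apply/lker0P => x y kxy.
  by rewrite -(id_lfunE x) -(id_lfunE y) -E !comp_lfunE kxy.
move=> gh; have lh := inj _ _ gh.
have Eg : g = (h^-1)%VF by rewrite -[LHS]comp_lfun1r -(lker0_compfV lh) comp_lfunA gh comp_lfun1l.
have hg : (h \o g)%VF = \1%VF by rewrite Eg lker0_compfV.
have lg := inj _ _ hg.
split=> //; try exact/eqP.
by rewrite -[LHS]comp_lfun1r -gh comp_lfunA lker0_compVf // comp_lfun1l.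
Qed.

Section CubicForm.
Variables (K : numClosedFieldType) (V : vectType K).
Variables (det : V -> K) (T : V -> V -> V -> K).
Hypothesis HT : sym_trilinear T.
Hypothesis Tdet : forall x, T x x x = 6%:R * det x.

Definition isometry : set 'End(V) :=
  [set g | lker g = 0%VS /\ forall x, det (g x) = det x].

Definition derivation (X : 'End(V)) : Prop :=
  forall x y z, T (X x) y z + T x (X y) z + T x y (X z) = 0.

Lemma isometryT g x y z : isometry g -> T (g x) (g y) (g z) = T x y z.
Proof.
move=> [_ Hg]; pose U x y z := T (g x) (g y) (g z).
have HU : sym_trilinear U.
  by case: HT => H1 H2 H3; split=> *; rewrite /U ?linearP ?H1 // 1?H2 // H3.
by apply: (trilin_inj HU HT) => t; rewrite /U !Tdet Hg.
Qed.

Lemma isometry1 : isometry \1%VF.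
Proof. by split=> [|x]; [apply/eqP/lker0P => x y; rewrite !id_lfunE|rewrite id_lfunE]. Qed.

Lemma isometry_comp g h : isometry g -> isometry h -> isometry (g \o h)%VF.
Proof.
move=> [/eqP lg Hg] [/eqP lh Hh]; split=> [|x]; last by rewrite comp_lfunE Hg Hh.
by apply/eqP/lker0P => x y; rewrite !comp_lfunE => /(lker0P lg) /(lker0P lh).
Qed.

Lemma isometry_inv g : isometry g -> isometry (g^-1)%VF.
Proof.
move=> [/eqP lg Hg]; have [lg' _ _ _] := lfun_invl (lker0_compVf lg).
split=> // x; by rewrite -Hg -comp_lfunE lker0_compfV // id_lfunE.
Qed.

Lemma derivation_conj g X : isometry g -> derivation X -> derivation (Ad g X).
Proof.
move=> Ig HX x y z; have [/eqP lg _] := Ig.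
have E t : t = g ((g^-1)%VF t) by rewrite -comp_lfunE lker0_compfV // id_lfunE.
rewrite /Ad !comp_lfunE [in X in X + _ + _](E y) [in X in X + _ + _](E z).
rewrite [in X in _ + X + _](E x) [in X in _ + X + _](E z).
rewrite [in X in _ + _ + X](E x) [in X in _ + _ + X](E y).
by rewrite !isometryT.
Qed.

Lemma derivationZ a X : derivation X -> derivation (a *: X).
Proof.
move=> HX x y z; rewrite !lfunE /= !trilinE // -!mulrDr.
by rewrite HX mulr0.
Qed.

Lemma derivation_sq0 X x : derivation X -> (X \o X)%VF = 0 ->
  [/\ T (X x) x x = 0, T (X x) (X x) x = 0 & T (X x) (X x) (X x) = 0].
Proof.
move=> HX X2; have XX t : X (X t) = 0 by rewrite -comp_lfunE X2 lfunE.
have H3 : T (X x) x x = 0.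
  have := HX x x x; rewrite (trilinC23 HT x x) (trilinC12 HT x (X x)) => H.
  by apply: (@mulfI _ 3%:R); rewrite ?pnatr_eq0 // mulr0 -H; ring.
have H2 : T (X x) (X x) x = 0.
  have := HX (X x) x x; rewrite XX (trilin01 HT) add0r (trilinC23 HT _ x) => H.
  by apply: (@mulfI _ 2%:R); rewrite ?pnatr_eq0 // mulr0 -H; ring.
split=> //.
by have := HX (X x) (X x) x; rewrite XX (trilin01 HT) (trilin02 HT) !add0r.
Qed.

Definition unip (X : 'End(V)) : 'End(V) := (\1 + X)%VF.

Lemma unipE X x : unip X x = x + X x. Proof. by rewrite lfunE /= id_lfunE. Qed.

Lemma unipN X : (X \o X)%VF = 0 -> (unip X \o unip (- X))%VF = \1%VF.
Proof.
move=> X2; rewrite /unip comp_lfunDl !comp_lfunDr !comp_lfun1l comp_lfun1r.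
by rewrite comp_lfunNr X2 oppr0 addr0 subrK.
Qed.

Lemma unipV X : (X \o X)%VF = 0 -> ((unip X)^-1)%VF = unip (- X).
Proof. by move=> /unipN/lfun_invl[]. Qed.

Lemma unip_isometry X : derivation X -> (X \o X)%VF = 0 -> isometry (unip X).
Proof.
move=> HX X2; split; first by have [] := lfun_invl (unipN X2).
move=> x; apply: (@mulfI _ 6%:R); rewrite ?pnatr_eq0 // -!Tdet unipE.
have [H1 H2 H3] := derivation_sq0 x HX X2.
have H1' : T x (X x) x = 0 by rewrite (trilinC12 HT).
have H1'' : T x x (X x) = 0 by rewrite (trilinC23 HT).
have H2' : T (X x) x (X x) = 0 by rewrite (trilinC23 HT).
have H2'' : T x (X x) (X x) = 0 by rewrite (trilinC12 HT).
by rewrite !trilinE // H1 H1' H1'' H2 H2' H2'' H3 !addr0.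
Qed.

Definition extremal (F : 'End(V)) : Prop :=
  [/\ derivation F, F != 0, (F \o F)%VF = 0 &
      forall X, derivation X -> exists c, (F \o X \o F)%VF = c *: F].

Lemma Ad_comp (g X Y : 'End(V)) : lker g = 0%VS -> (Ad g X \o Ad g Y)%VF = Ad g (X \o Y)%VF.
Proof.
move=> /eqP lg; rewrite /Ad !comp_lfunA; congr (_ \o _)%VF.
by rewrite lker0_compfVK // comp_lfunA.
Qed.

Lemma AdZ (g : 'End(V)) c (X : 'End(V)) : Ad g (c *: X) = c *: Ad g X.
Proof. by rewrite /Ad -comp_lfunZr -comp_lfunZl. Qed.

Lemma Ad0 (g : 'End(V)) : Ad g 0 = 0.
Proof. by rewrite /Ad comp_lfun0r comp_lfun0l. Qed.

Lemma Ad_prod (g h X : 'End(V)) : lker g = 0%VS -> lker h = 0%VS ->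
  Ad (g \o h)%VF X = Ad g (Ad h X).
Proof.
move=> /eqP lg /eqP lh; rewrite /Ad.
have E : ((g \o h) \o (h^-1 \o g^-1))%VF = \1%VF.
  by rewrite -comp_lfunA lker0_compVKf // lker0_compfV.
by have [_ _ _ ->] := lfun_invl E; rewrite !comp_lfunA.
Qed.

Lemma AdK (g X : 'End(V)) : lker g = 0%VS -> Ad (g^-1)%VF (Ad g X) = X.
Proof.
move=> /eqP lg; rewrite /Ad; have [_ _ _ ->] := lfun_invl (lker0_compVf lg).
by rewrite !comp_lfunA lker0_compVf // comp_lfun1l lker0_compfVK.
Qed.

Lemma AdKV (g X : 'End(V)) : lker g = 0%VS -> Ad g (Ad (g^-1)%VF X) = X.
Proof.
move=> /eqP lg; rewrite /Ad; have [_ _ _ ->] := lfun_invl (lker0_compVf lg).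
by rewrite !comp_lfunA lker0_compfV // comp_lfun1l lker0_compfK.
Qed.

Lemma extremalZ c F : c != 0 -> extremal F -> extremal (c *: F).
Proof.
move=> c0 [HF F0 F2 Fx]; split.
- exact: derivationZ.
- by rewrite scaler_eq0 negb_or c0.
- by rewrite -comp_lfunZr -comp_lfunZl F2 !scaler0.
- move=> X /Fx [d Hd]; exists (d * c); rewrite -comp_lfunZr -comp_lfunZl -comp_lfunZl.
  by rewrite Hd !scalerA; congr (_ *: _); ring.
Qed.

Lemma extremal_conj g F : isometry g -> extremal F -> extremal (Ad g F).
Proof.
move=> Ig [HF F0 F2 Fx]; have [lg _] := Ig; split.
- exact: derivation_conj.
- by apply: contraNneq F0 => E; rewrite -[F](AdK _ lg) E Ad0.
- by rewrite Ad_comp // F2 Ad0.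
- move=> X HX; have [c Hc] := Fx _ (derivation_conj (isometry_inv Ig) HX).
  by exists c; rewrite -AdZ -Hc -2!(Ad_comp _ _ lg) (AdKV _ lg).
Qed.

Definition extremal_at (w : V) (F : 'End(V)) : Prop := extremal F /\ F w = 0.

Lemma extremal_at_conj g w w' F : isometry g -> g w = w' -> extremal_at w F ->
  extremal_at w' (Ad g F).
Proof.
move=> Ig gw [HF Fw]; split; first exact: extremal_conj.
have [/eqP lg _] := Ig.
by rewrite -gw /Ad !comp_lfunE -(comp_lfunE _ g) lker0_compVf // id_lfunE Fw linear0.
Qed.

Lemma extremal_unip F : extremal F -> isometry (unip F).
Proof. by case=> HF _ F2 _; exact: unip_isometry. Qed.

End CubicForm.

Section ExtremalConjugacy.
Variables (K : numClosedFieldType) (V : vectType K).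
Variables (det : V -> K) (T : V -> V -> V -> K).
Hypothesis HT : sym_trilinear T.
Hypothesis Tdet : forall x, T x x x = 6%:R * det x.

Local Notation isometry := (isometry det).
Local Notation derivation := (derivation T).
Local Notation extremal := (extremal T).
Local Notation extremal_at := (extremal_at T).
Local Notation S := (derived_group isometry).

Lemma derived_isometry g : S g -> isometry g.
Proof.
elim=> [|a b h Ia Ib _ Ih]; first exact: isometry1.
apply: (isometry_comp _ Ih); apply: (isometry_comp _ (isometry_inv Ib)).
exact: (isometry_comp (isometry_comp Ia Ib) (isometry_inv Ia)).
Qed.

Lemma derived_comp g h : S g -> S h -> S (g \o h)%VF.
Proof.
move=> Hg Hh; elim: Hg => [|a b k Ia Ib _ IH]; first by rewrite comp_lfun1l.
by rewrite -comp_lfunA; exact: derived_M.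
Qed.

Lemma derived_commutator a b : isometry a -> isometry b ->
  S (a \o b \o a^-1 \o b^-1)%VF.
Proof. by move=> Ia Ib; rewrite -[X in S X]comp_lfun1r; apply: derived_M => //; exact: derived_1. Qed.

Lemma derived_inv g : S g -> S (g^-1)%VF.
Proof.
elim=> [|a b h Ia Ib Hh IH].
  by have [_ _ _ ->] := lfun_invl (comp_lfun1l (\1%VF : 'End(V))); exact: derived_1.
have [/eqP la _] := Ia; have [/eqP lb _] := Ib.
have [/eqP lh _] := derived_isometry Hh.
have E : ((a \o b \o a^-1 \o b^-1 \o h) \o (h^-1 \o (b \o a \o b^-1 \o a^-1)))%VF = \1%VF.
  rewrite !comp_lfunA lker0_compfK // lker0_compfVK // lker0_compfVK //.
  by rewrite lker0_compfK // lker0_compfV.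
have [_ _ _ ->] := lfun_invl E; apply: derived_comp => //.
exact: derived_commutator.
Qed.

Section SL2.
Variables e f : 'End(V).
Hypotheses (e2 : (e \o e)%VF = 0) (f2 : (f \o f)%VF = 0).
Hypotheses (efe : (e \o f \o e)%VF = e) (fef : (f \o e \o f)%VF = f).

Definition weyl_elt : 'End(V) := (unip e \o unip (- f) \o unip e)%VF.

Lemma weyl_elt_comp : (weyl_elt \o f)%VF = (- e \o weyl_elt)%VF.
Proof.
have e2' x : e (e x) = 0 by rewrite -comp_lfunE e2 lfunE.
have f2' x : f (f x) = 0 by rewrite -comp_lfunE f2 lfunE.
have efe' x : e (f (e x)) = e x by rewrite -!comp_lfunE ?comp_lfunA efe.
have fef' x : f (e (f x)) = f x by rewrite -!comp_lfunE ?comp_lfunA fef.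
have linD (g : 'End(V)) u v : g (u + v) = g u + g v by rewrite linearD.
have linB (g : 'End(V)) u v : g (u - v) = g u - g v by rewrite linearB.
have linN (g : 'End(V)) u : g (- u) = - g u by rewrite linearN.
have lin0 (g : 'End(V)) : g 0 = 0 by rewrite linear0.
apply/lfunP => x; rewrite /weyl_elt !comp_lfunE !unipE !opp_lfunE.
rewrite !(linD, linB, linN, lin0, e2', f2', efe', fef', addr0, add0r, subr0).
by rewrite subrr addr0 [f x + _]addrC addrK opprD opprK [e (f x) + e x]addrC addKr.
Qed.

Lemma weyl_elt_ker : lker weyl_elt = 0%VS.
Proof.
have [le _ _ _] := lfun_invl (unipN e2).
have [_ lf _ _] := lfun_invl (unipN f2).
apply/eqP/lker0P => x y; rewrite /weyl_elt !comp_lfunE.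
by move/eqP: le => /lker0P le; move/eqP: lf => /lker0P lf /le /lf /le.
Qed.

Lemma weyl_elt_Ad : Ad weyl_elt f = - e.
Proof.
by rewrite /Ad weyl_elt_comp lker0_compfK // ; apply/eqP; exact: weyl_elt_ker.
Qed.

End SL2.

(* The torus element W(2) W(1)^-1, where W(t) is the Weyl element of (t e, t^-1 f),
   multiplies e by 2^2 = 4. *)
Lemma torus_Ad e f : (e \o e)%VF = 0 -> (f \o f)%VF = 0 ->
  (e \o f \o e)%VF = e -> (f \o e \o f)%VF = f ->
  derivation e -> derivation f ->
  exists h, isometry h /\ Ad h e = 4%:R *: e.
Proof.
move=> e2 f2 efe fef De Df.
have n2 : (2%:R : K) != 0 by rewrite pnatr_eq0.
pose e' := 2%:R *: e; pose f' := 2%:R^-1 *: f.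
have e2' : (e' \o e')%VF = 0 by rewrite -comp_lfunZl -comp_lfunZr e2 !scaler0.
have f2' : (f' \o f')%VF = 0 by rewrite -comp_lfunZl -comp_lfunZr f2 !scaler0.
have efe' : (e' \o f' \o e')%VF = e'.
  rewrite -!comp_lfunZl -!comp_lfunZr -comp_lfunZl efe !scalerA.
  by rewrite [X in X *: _](_ : _ = 2%:R) //; field.
have fef' : (f' \o e' \o f')%VF = f'.
  rewrite -!comp_lfunZl -!comp_lfunZr -comp_lfunZl fef !scalerA.
  by rewrite [X in X *: _](_ : _ = 2%:R^-1) //; field.
have isoW a b : (a \o a)%VF = 0 -> (b \o b)%VF = 0 -> derivation a -> derivation b ->
    isometry (weyl_elt a b).
  move=> a2 b2 Da Db; apply: isometry_comp; first apply: isometry_comp.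
  - exact: (unip_isometry HT Tdet).
  - apply: (unip_isometry HT Tdet); last by rewrite comp_lfunNl comp_lfunNr b2 !oppr0.
    by rewrite -scaleN1r; exact: derivationZ.
  - exact: (unip_isometry HT Tdet).
have I1 := isoW _ _ e2 f2 De Df.
have I2 : isometry (weyl_elt e' f') by apply: isoW => //; exact: derivationZ.
exists (weyl_elt e' f' \o (weyl_elt e f)^-1)%VF; split.
  by apply: isometry_comp => //; exact: isometry_inv.
have [l1 _] := I1; have [l2 _] := I2.
rewrite Ad_prod //; last by have [] := isometry_inv I1.
have -> : Ad ((weyl_elt e f)^-1)%VF e = - f.
  have E : e = - 1 *: Ad (weyl_elt e f) f by rewrite (weyl_elt_Ad e2 f2 efe fef) scaleN1r opprK.
  by rewrite {2}E AdZ AdK // scaleN1r.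
have -> : - f = - 2%:R *: f' by rewrite scalerA mulNr mulfV // scaleN1r.
by rewrite AdZ (weyl_elt_Ad e2' f2' efe' fef') scaleNr scalerN opprK scalerA -natrM.
Qed.

Lemma extremal_pair F X : extremal F -> extremal X -> (F \o X \o F)%VF <> 0 ->
  exists c, [/\ c != 0, (F \o (c *: X) \o F)%VF = F & ((c *: X) \o F \o (c *: X))%VF = c *: X].
Proof.
move=> [DF F0 F2 Fx] [DX X0 X2 Xx] FXF.
have [c Hc] := Fx _ DX; have [d Hd] := Xx _ DF.
have c0 : c != 0 by apply/eqP => c0; apply: FXF; rewrite Hc c0 scale0r.
have E : c *: (F \o X)%VF = d *: (F \o X)%VF.
  by rewrite comp_lfunZl -Hc -comp_lfunA -!comp_lfunA [(X \o (F \o X))%VF]comp_lfunA Hd comp_lfunZr.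
have FX0 : (F \o X)%VF != 0 by apply/eqP => FX; apply: FXF; rewrite FX comp_lfun0l.
have cd : c = d.
  move/eqP: E; rewrite -subr_eq0 -scalerBl scaler_eq0 (negPf FX0) orbF subr_eq0.
  by move/eqP.
exists c^-1; split; first by rewrite invr_eq0.
- by rewrite -comp_lfunZr -comp_lfunZl Hc scalerA mulVf // scale1r.
- rewrite -!comp_lfunZl -comp_lfunZr Hd !scalerA -cd; congr (_ *: _).
  by field.
Qed.

Lemma unip_comp (X Y : 'End(V)) : (X \o Y)%VF = 0 -> (unip X \o unip Y)%VF = unip (X + Y).
Proof.
move=> XY; rewrite /unip comp_lfunDl !comp_lfunDr !comp_lfun1l comp_lfun1r XY addr0.
by rewrite -addrA [Y + X]addrC.
Qed.

Hypothesis detect0 : forall X, derivation X -> X != 0 ->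
  exists F, extremal F /\ (F \o X \o F)%VF <> 0.

Lemma extremal_derived F s : extremal F -> S (unip (s *: F)).
Proof.
move=> EF; have [DF F0 F2 Fx] := EF.
have [X0 [EX0 HX0]] := detect0 DF F0.
have [c [c0 H1 H2]] := extremal_pair EX0 EF HX0.
have EF' := extremalZ HT c0 EF; have [DF' _ F2' _] := EF'.
have [DX _ X2 _] := EX0.
have [h [Ih Ah]] := torus_Ad F2' X2 H2 H1 DF' DX.
have AF : Ad h F = 4%:R *: F.
  have -> : F = c^-1 *: (c *: F) by rewrite scalerA mulVf // scale1r.
  by rewrite AdZ Ah !scalerA mulrCA mulrA.
pose u := unip ((s / 3%:R) *: F).
have u2 t t' : ((t *: F) \o (t' *: F))%VF = 0.
  by rewrite -comp_lfunZl -comp_lfunZr F2 !scaler0.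
have Iu : isometry u by apply: (unip_isometry HT Tdet); [exact: derivationZ|exact: u2].
have [/eqP lh _] := Ih.
have := derived_commutator Ih Iu.
rewrite (unipV (u2 _ _)) -/(Ad h u).
have -> : Ad h u = unip ((s / 3%:R * 4%:R) *: F).
  rewrite /Ad /u /unip comp_lfunDr comp_lfunDl comp_lfun1r lker0_compfV //.
  by rewrite -/(Ad h _) AdZ AF scalerA.
rewrite -scaleNr unip_comp ?u2 // -scalerDl.
have -> // : s / 3%:R * 4%:R + - (s / 3%:R) = s.
by field.
Qed.

(* F' is, up to scalar, conjugate to F by the endpoint of a polynomial path from 1 in
   the stabilizer of w; such an endpoint lies in the identity component. *)
Definition path_conj (w : V) (F F' : 'End(V)) : Prop :=
  exists (p q : K -> 'End(V)) c,
    [/\ polycurve p, polycurve q, p 0 = \1%VF,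
        forall s, [/\ (p s \o q s)%VF = \1%VF, S (p s) & p s w = w] &
        c != 0 /\ F' = c *: (p 1 \o F \o q 1)%VF].

Lemma polycurve_comp (p q : K -> 'End(V)) : polycurve p -> polycurve q ->
  polycurve (fun s => p s \o q s)%VF.
Proof.
apply: polycurve_bilin => [g|g] a u v.
- by rewrite comp_lfunDr comp_lfunZr.
- by rewrite comp_lfunDl comp_lfunZl.
Qed.

Lemma polycurve_unip (X : 'End(V)) : polycurve (fun s => unip (s *: X)).
Proof.
by apply: polycurve_add; [exact: polycurve_cst|apply: polycurve_scale; exact: polycurve_cst].
Qed.

Lemma path_conj_trans w F1 F2 F3 :
  path_conj w F1 F2 -> path_conj w F2 F3 -> path_conj w F1 F3.
Proof.
move=> [p [q [c [Hp Hq p0 Hpq [c0 ->]]]]] [p' [q' [c' [Hp' Hq' p0' Hpq' [c0' ->]]]]].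
exists (fun s => p' s \o p s)%VF, (fun s => q s \o q' s)%VF, (c' * c).
split; try exact: polycurve_comp.
- by rewrite p0 p0' comp_lfun1l.
- move=> s; have [H1 H2 H3] := Hpq s; have [H1' H2' H3'] := Hpq' s; split.
  + by rewrite comp_lfunA -[(_ \o q s)%VF]comp_lfunA H1 comp_lfun1r.
  + exact: derived_comp.
  + by rewrite comp_lfunE H3 H3'.
- split; first by rewrite mulf_neq0.
  by rewrite -comp_lfunZr -comp_lfunZl scalerA !comp_lfunA.
Qed.

Lemma path_conj_sym w F1 F2 : path_conj w F1 F2 -> path_conj w F2 F1.
Proof.
move=> [p [q [c [Hp Hq p0 Hpq [c0 ->]]]]]; exists q, p, c^-1.
have qp s : (q s \o p s)%VF = \1%VF by have [/lfun_invl[]] := Hpq s.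
split=> //.
- by have [+ _ _] := Hpq 0; rewrite p0 comp_lfun1l.
- move=> s; have [H1 H2 H3] := Hpq s; split=> //.
  + by have [_ _ _ <-] := lfun_invl H1; exact: derived_inv.
  + by rewrite -{1}H3 -comp_lfunE qp id_lfunE.
- split; first by rewrite invr_eq0.
  rewrite -comp_lfunZr -comp_lfunZl scalerA mulVf // scale1r !comp_lfunA.
  by rewrite qp comp_lfun1l -comp_lfunA qp comp_lfun1r.
Qed.

Lemma path_conjZ w F c : c != 0 -> path_conj w F (c *: F).
Proof.
exists (fun=> \1%VF), (fun=> \1%VF), c; split=> //; try exact: polycurve_cst.
- by move=> s; split; rewrite ?comp_lfun1l ?id_lfunE //; exact: derived_1.
- by rewrite comp_lfun1l comp_lfun1r.
Qed.

Lemma path_conj_refl w F : path_conj w F F.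
Proof. by rewrite -{2}[F]scale1r; apply: path_conjZ; rewrite oner_eq0. Qed.

Lemma path_conj_unip w F X : extremal_at w F ->
  path_conj w X (unip F \o X \o unip (- F))%VF.
Proof.
move=> [EF Fw]; have [_ _ F2 _] := EF.
exists (fun s => unip (s *: F)), (fun s => unip (s *: - F)), 1; split.
- exact: polycurve_unip.
- exact: polycurve_unip.
- by rewrite scale0r /unip addr0.
- move=> s; split; last by rewrite unipE lfunE /= Fw scaler0 addr0.
  + by rewrite scalerN unipN // -comp_lfunZl -comp_lfunZr F2 !scaler0.
  + exact: extremal_derived.
- by rewrite oner_eq0 !scale1r.
Qed.

Lemma extremal_atZ w c F : c != 0 -> extremal_at w F -> extremal_at w (c *: F).
Proof.
by move=> c0 [EF Fw]; split; [exact: (extremalZ HT)|rewrite lfunE /= Fw scaler0].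
Qed.

Lemma path_conj_detect w F X : extremal_at w F -> extremal_at w X ->
  (F \o X \o F)%VF <> 0 -> path_conj w X F.
Proof.
move=> EF EX FXF.
have [c [c0 H1 H2]] := extremal_pair EF.1 EX.1 FXF.
have EcX := extremal_atZ c0 EX.
have [_ _ F2 _] := EF.1; have [_ _ X2 _] := EcX.1.
apply: (path_conj_trans (path_conjZ w X c0)).
set Y := c *: X in H1 H2 EcX X2 *.
have NY : extremal_at w (- Y) by rewrite -scaleN1r; apply: extremal_atZ; rewrite ?oppr_eq0 ?oner_eq0.
apply: (path_conj_trans (path_conj_unip Y EF)).
apply: (path_conj_trans (path_conj_unip _ NY)).
apply: (path_conj_trans (path_conj_unip _ EF)).
have -> : (unip F \o (unip (- Y) \o (unip F \o Y \o unip (- F)) \o unip (- - Y)) \o unip (- F))%VF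
   = - F.
  rewrite -[RHS](weyl_elt_Ad F2 X2 H1 H2) /Ad.
  have Y2' : ((- Y) \o (- Y))%VF = 0 by rewrite comp_lfunNl comp_lfunNr X2 !oppr0.
  have E : (weyl_elt F Y \o (unip (- F) \o unip (- - Y) \o unip (- F)))%VF = \1%VF.
    have cancel (Z g : 'End(V)) : (Z \o Z)%VF = 0 -> (unip Z \o (unip (- Z) \o g))%VF = g.
      by move=> Z2; rewrite comp_lfunA unipN // comp_lfun1l.
    by rewrite /weyl_elt -!comp_lfunA (cancel F) // (cancel (- Y)) // unipN.
  have [_ _ _ ->] := lfun_invl E.
  by rewrite /weyl_elt !comp_lfunA.
by rewrite -scaleN1r; apply: path_conj_sym; apply: path_conjZ; rewrite oppr_eq0 oner_eq0.
Qed.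

End ExtremalConjugacy.

Section PolynomialFunctions.
Variable K : numClosedFieldType.

Lemma polyfun_scalar (V : lmodType K) (f : V -> K) :
  (forall a u v, f (a *: u + v) = a * f u + f v) -> polyfun f.
Proof.
move=> Hf.
pose l : {scalar V} := HB.pack (f : V -> K^o) (GRing.isLinear.Build _ _ _ _ (f : V -> K^o) Hf).
exact: (polyfun_lin l).
Qed.

Lemma polyfun_comp (U V : lmodType K) (g : {linear V -> U}) (f : U -> K) :
  polyfun f -> polyfun (fun v => f (g v)).
Proof.
elim=> [c|l|f1 f2 _ H1 _ H2|f1 f2 _ H1 _ H2].
- exact: polyfun_cst.
- by apply: polyfun_scalar => a u v; rewrite linearP linearP.
- exact: polyfun_add.
- exact: polyfun_mul.
Qed.

Lemma polyfun_sum (V : lmodType K) (I : Type) (r : seq I) (f : I -> V -> K) :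
  (forall i, polyfun (f i)) -> polyfun (fun v => \sum_(i <- r) f i v).
Proof.
move=> Hf; elim: r => [|i r IH].
  by under eq_fun do rewrite big_nil; exact: polyfun_cst.
under eq_fun do rewrite big_cons; exact: polyfun_add.
Qed.

Lemma polyfun_prod (V : lmodType K) (I : Type) (r : seq I) (f : I -> V -> K) :
  (forall i, polyfun (f i)) -> polyfun (fun v => \prod_(i <- r) f i v).
Proof.
move=> Hf; elim: r => [|i r IH].
  by under eq_fun do rewrite big_nil; exact: polyfun_cst.
under eq_fun do rewrite big_cons; exact: polyfun_mul.
Qed.

Lemma polyfun_opp (V : lmodType K) (f : V -> K) :
  polyfun f -> polyfun (fun v => - f v).
Proof.
move=> Hf; under eq_fun do rewrite -mulN1r; apply: polyfun_mul => //.
exact: polyfun_cst.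
Qed.

Lemma polyfun_sub (V : lmodType K) (f g : V -> K) :
  polyfun f -> polyfun g -> polyfun (fun v => f v - g v).
Proof. by move=> Hf Hg; apply: polyfun_add => //; exact: polyfun_opp. Qed.

Lemma polyfun_ffun (D : finType) (d : D) : polyfun (fun t : {ffun D -> K^o} => t d).
Proof. by apply: polyfun_scalar => a t u; rewrite !ffunE. Qed.

Lemma polyfun_bilin (V : vectType K) (b : V -> V -> K) :
  (forall a u v w, b (a *: u + v) w = a * b u w + b v w) ->
  (forall a u v w, b w (a *: u + v) = a * b w u + b w v) ->
  polyfun (fun v => b v v).
Proof.
move=> bl br; pose e := vbasis (fullv : {vspace V}).
have E v : v = \sum_i coord e i v *: e`_i by exact: (coord_vbasis (memvf v)).
have b0l w : b 0 w = 0 by apply: (addrI (b 0 w)); have := bl 1 0 0 w; rewrite scale1r mul1r !addr0.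
have b0r w : b w 0 = 0 by apply: (addrI (b w 0)); have := br 1 0 0 w; rewrite scale1r mul1r !addr0.
have Sl (I : finType) (f : I -> K) (g : I -> V) w :
    b (\sum_i f i *: g i) w = \sum_i f i * b (g i) w.
  rewrite -!big_enum /=; elim: (enum I) => [|i r IH]; rewrite ?big_nil ?big_cons ?b0l //.
  by rewrite bl IH.
have Sr (I : finType) (f : I -> K) (g : I -> V) w :
    b w (\sum_i f i *: g i) = \sum_i f i * b w (g i).
  rewrite -!big_enum /=; elim: (enum I) => [|i r IH]; rewrite ?big_nil ?big_cons ?b0r //.
  by rewrite br IH.
have -> : (fun v => b v v) =
    (fun v => \sum_i coord e i v * \sum_j coord e j v * b e`_i e`_j).
  apply/funext => v; rewrite {1}(E v) Sl; apply: eq_bigr => i _.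
  by congr (_ * _); rewrite {1}(E v) Sr.
apply: polyfun_sum => i; apply: polyfun_mul; first exact: (polyfun_lin (coord e i)).
apply: polyfun_sum => j; apply: polyfun_mul; first exact: (polyfun_lin (coord e j)).
exact: polyfun_cst.
Qed.

Lemma polyfun_trilin (V : vectType K) (T : V -> V -> V -> K) :
  sym_trilinear T -> polyfun (fun v => T v v v).
Proof.
move=> HT; pose e := vbasis (fullv : {vspace V}).
have E v : v = \sum_i coord e i v *: e`_i by exact: (coord_vbasis (memvf v)).
have S1 (I : finType) (f : I -> K) (g : I -> V) y z :
    T (\sum_i f i *: g i) y z = \sum_i f i * T (g i) y z.
  rewrite -!big_enum /=; elim: (enum I) => [|i r IH]; rewrite ?big_nil ?big_cons ?(trilin01 HT) //.
  by rewrite (trilinP1 HT) IH.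
have -> : (fun v => T v v v) =
    (fun v => \sum_i coord e i v * T v v e`_i).
  apply/funext => v; rewrite {1}(E v) S1; apply: eq_bigr => i _.
  by rewrite (trilinC12 HT) (trilinC23 HT).
apply: polyfun_sum => i; apply: polyfun_mul; first exact: (polyfun_lin (coord e i)).
apply: (@polyfun_bilin _ (fun x y => T x y e`_i)) => *; first exact: trilinP1.
by rewrite (trilinD2 HT) (trilinZ2 HT).
Qed.

Lemma zariski_closed_zeros (V : lmodType K) (J : Type) (f : J -> V -> K) :
  (forall j, polyfun (f j)) -> zariski_closed [set v | forall j, f j v = 0].
Proof.
move=> Hf; exists (range f); split; first by move=> _ [j _ <-].
apply/seteqP; split => v /=; first by move=> H _ [j _ <-].
by move=> H j; apply: H; exists j.
Qed.

Lemma zariski_closedI (V : lmodType K) (S1 S2 : set V) :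
  zariski_closed S1 -> zariski_closed S2 -> zariski_closed (S1 `&` S2).
Proof.
move=> [I1 [P1 ->]] [I2 [P2 ->]]; exists (I1 `|` I2); split.
  by move=> f [/P1|/P2].
apply/seteqP; split => v /=; first by move=> [H1 H2] f [/H1|/H2].
by move=> H; split=> f If; apply: H; [left|right].
Qed.

Lemma colinearP (V : vectType K) (u v : V) : v != 0 ->
  (exists c, u = c *: v) <->
  (forall l m : {scalar V}, l u * m v - m u * l v = 0).
Proof.
move=> v0; split.
  by move=> [c ->] l m; rewrite !linearZ /=; apply/eqP; rewrite subr_eq0; apply/eqP; ring.
move=> H; pose e := vbasis (fullv : {vspace V}).
have E x : x = \sum_i coord e i x *: e`_i by exact: (coord_vbasis (memvf x)).
have [j vj] : exists j, coord e j v != 0.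
  apply: contra_notP (negP v0) => nj; apply/eqP; rewrite (E v) big1 // => i _.
  have [->|ni] := eqVneq (coord e i v) 0; first by rewrite scale0r.
  by case: nj; exists i.
have [c cE] : exists c, c * coord e j v = coord e j u.
  by exists (coord e j u / coord e j v); rewrite divfK.
exists c; rewrite [LHS]E [in RHS](E v) scaler_sumr.
apply: eq_bigr => i _; rewrite scalerA; congr (_ *: _).
apply: (mulIf vj); move/eqP: (H (coord e i) (coord e j)); rewrite subr_eq0 => /eqP ->.
by rewrite mulrAC cE.
Qed.

End PolynomialFunctions.

Section ExtremalOrbit.
Variables (K : numClosedFieldType) (V : vectType K).
Variables (det : V -> K) (T : V -> V -> V -> K).
Hypothesis HT : sym_trilinear T.
Hypothesis Tdet : forall x, T x x x = 6%:R * det x.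

Local Notation isometry := (isometry det).
Local Notation derivation := (derivation T).
Local Notation extremal := (extremal T).
Local Notation extremal_at := (extremal_at T).
Local Notation path_conj := (path_conj det).
Local Notation S := (derived_group isometry).

Lemma scalar_forms_eq0 (U : vectType K) (v : U) :
  (forall l : {scalar U}, l v = 0) -> v = 0.
Proof.
move=> H; rewrite (coord_vbasis (memvf v)) big1 // => i _.
by rewrite [coord _ _ _]H scale0r.
Qed.

Lemma extremal_at_closed w : zariski_closed ([set F | extremal_at w F] `|` [set 0]).
Proof.
have -> : ([set F | extremal_at w F] `|` [set 0]) =
  [set F : 'End(V) | forall p : V * V * V,
     T (F p.1.1) p.1.2 p.2 + T p.1.1 (F p.1.2) p.2 + T p.1.1 p.1.2 (F p.2) = 0]
  `&` ([set F : 'End(V) | forall p : {scalar V} * V, p.1 (F (F p.2)) = 0]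
  `&` ([set F : 'End(V) | forall l : {scalar V}, l (F w) = 0]
  `&` [set F : 'End(V) | forall p : {X | derivation X} * {scalar 'End(V)} * {scalar 'End(V)},
     p.1.2 (F \o sval p.1.1 \o F)%VF * p.2 F - p.2 (F \o sval p.1.1 \o F)%VF * p.1.2 F = 0])).
  apply/seteqP; split=> F /=.
    case=> [[[DF F0 F2 Fx] Fw]|->].
      do ?split.
      - by move=> [[x y] z]; exact: DF.
      - by move=> [l x]; rewrite /= -comp_lfunE F2 lfunE linear0.
      - by move=> l; rewrite Fw linear0.
      - by move=> [[[X DX] l] m]; exact: ((colinearP _ F0).1 (Fx _ DX) l m).
    do ?split.
    - by move=> [[x y] z]; rewrite !lfunE /= !trilinE // !addr0.
    - by move=> [l x]; rewrite /= lfunE linear0.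
    - by move=> l; rewrite lfunE linear0.
    - by move=> p; rewrite !linear0 !mulr0 subrr.
  move=> [DF [F2 [Fw Fx]]]; have [->|F0] := eqVneq F 0; first by right.
  left; split; last exact: scalar_forms_eq0.
  split=> //.
  - by move=> x y z; exact: (DF (x, y, z)).
  - by apply/lfunP => x; rewrite comp_lfunE [RHS]lfunE; apply: scalar_forms_eq0 => l; exact: (F2 (l, x)).
  - by move=> X DX; apply/(colinearP _ F0) => l m; exact: (Fx (exist _ X DX, l, m)).
do 3?apply: zariski_closedI.
- apply: zariski_closed_zeros => -[[x y] z]; apply: polyfun_scalar => a F G /=.
  by rewrite !lfunE /= !lfunE /= !trilinE //; ring.
- apply: zariski_closed_zeros => -[l x] /=.
  apply: (@polyfun_bilin _ _ (fun F G : 'End(V) => l (F (G x)))) => a F G H.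
  + by rewrite !lfunE /= !lfunE /= linearP.
  + by rewrite !lfunE /= !lfunE /= !linearP.
- by apply: zariski_closed_zeros => l; apply: polyfun_scalar => a F G; rewrite !lfunE /= !lfunE /= linearP.
- apply: zariski_closed_zeros => -[[[X DX] l] m] /=.
  have bil (k : {scalar 'End(V)}) : polyfun (fun F : 'End(V) => k (F \o X \o F)%VF).
    apply: (@polyfun_bilin _ _ (fun F G : 'End(V) => k (F \o X \o G)%VF)) => a F G H.
    + by rewrite !comp_lfunDl -!comp_lfunZl linearP.
    + by rewrite !comp_lfunDr -!comp_lfunZr linearP.
  by apply: polyfun_sub; apply: polyfun_mul => //; exact: polyfun_lin.
Qed.

Definition hub (w : V) : Prop :=
  exists E0, extremal_at w E0 /\
    forall X, derivation X -> X w = 0 -> X != 0 ->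
      exists F, [/\ extremal_at w F, (F \o X \o F)%VF <> 0 & path_conj w F E0].

Lemma path_conj_transport h w w' F F' : S h -> h w = w' ->
  path_conj w F F' -> path_conj w' (Ad h F) (Ad h F').
Proof.
move=> Sh hw [p [q [c [Hp Hq p0 Hpq [c0 ->]]]]].
have [/eqP lh _] := derived_isometry Sh.
exists (fun s => h \o p s \o h^-1)%VF, (fun s => h \o q s \o h^-1)%VF, c.
have conj r : polycurve r -> polycurve (fun s => h \o r s \o h^-1)%VF.
  by move=> Hr; do 2?[apply: polycurve_comp] => //; exact: polycurve_cst.
split; try exact: conj.
- by rewrite p0 comp_lfun1r lker0_compfV.
- move=> s; have [H1 H2 H3] := Hpq s; split.
  + by rewrite !comp_lfunA lker0_compfVK // -[(h \o p s \o q s)%VF]comp_lfunA H1 comp_lfun1r lker0_compfV.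
  + by apply: derived_comp; [exact: derived_comp|exact: derived_inv].
  + by rewrite !comp_lfunE -hw -(comp_lfunE _ h) lker0_compVf // id_lfunE H3.
- by split=> //; rewrite AdZ /Ad !comp_lfunA lker0_compfVK // lker0_compfVK.
Qed.

Hypothesis detect0 : forall X, derivation X -> X != 0 ->
  exists F, extremal F /\ (F \o X \o F)%VF <> 0.

Lemma hub_transport h w : S h -> hub (h w) -> hub w.
Proof.
move=> Sh [E0 [EE0 H]]; pose k := (h^-1)%VF.
have Ih := derived_isometry Sh; have [lh _] := Ih.
have Sk : S k := derived_inv Sh; have Ik := derived_isometry Sk; have [lk _] := Ik.
have kh : k (h w) = w by rewrite -comp_lfunE lker0_compVf ?id_lfunE //; exact/eqP.
exists (Ad k E0); split; first exact: (extremal_at_conj HT Tdet Ik kh).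
move=> X DX Xw X0.
have [||| F [EF FXF FE0]] := H (Ad h X).
- exact: (derivation_conj HT Tdet).
- by rewrite /Ad !comp_lfunE -/k kh Xw linear0.
- by apply: contraNneq X0 => E; rewrite -[X](AdK _ lh) E Ad0.
exists (Ad k F); split.
- exact: (extremal_at_conj HT Tdet Ik kh).
- rewrite -[X](AdK _ lh) -/k !(Ad_comp _ _ lk) => E; apply: FXF.
  by rewrite -[RHS](Ad0 h) -E AdKV.
- exact: (path_conj_transport Sk kh).
Qed.

Lemma hub_path_conj w F F' : hub w -> extremal_at w F -> extremal_at w F' ->
  path_conj w F F'.
Proof.
move=> [E0 [_ H]].
have toE0 X : extremal_at w X -> path_conj w X E0.
  move=> EX; have [[DX X0 _ _] Xw] := EX.
  have [Y [EY YXY YE0]] := H _ DX Xw X0.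
  apply: (path_conj_trans _ YE0).
  exact: (path_conj_detect HT Tdet detect0 EY EX YXY).
move=> EF EF'; apply: (path_conj_trans (toE0 _ EF)).
exact/path_conj_sym/toE0.
Qed.

Lemma closed_orbit_extremal w (G W : set 'End(V)) : hub w ->
  (forall p : K -> 'End(V), polycurve p -> p 0 = \1%VF ->
     (forall s, S (p s) /\ p s w = w) -> forall s, G (p s)) ->
  (forall g, G g -> isometry g /\ exists c, c != 0 /\ g w = c *: w) ->
  (forall X, W X -> derivation X /\ X w = 0) ->
  (forall F, extremal_at w F -> W F) ->
  closed_orbit G (@Ad _ _) W = [set F | extremal_at w F].
Proof.
move=> Hw G1 G2 W1 W2; have [E0 [EE0 HE0]] := Hw.
have path_G F F' : path_conj w F F' -> exists g c, [/\ G g, c != 0 & F' = c *: Ad g F].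
  move=> [p [q [c [Hp Hq p0 Hpq [c0 ->]]]]]; exists (p 1), c; split=> //.
    by apply: (G1 p) => // s; have [] := Hpq s.
  by rewrite /Ad; have [/lfun_invl[_ _ _ ->]] := Hpq 1.
have atZ a X : a != 0 -> extremal_at (a *: w) X -> extremal_at w X.
  move=> a0 [EX /eqP]; rewrite linearZ scaler_eq0 (negPf a0) => /eqP Xw.
  by split.
apply: closed_orbitE.
- exact: extremal_at_closed.
- by exists E0; split=> //; exact: W2.
- by move=> [[_ /eqP]].
- by move=> c v; exact: (extremal_atZ HT).
- move=> g F /G2 [Ig [c [c0 gw]]] EF; apply: (atZ c) => //.
  exact: (extremal_at_conj HT Tdet Ig gw EF).
- move=> g F /G2 [Ig [c [c0 gw]]] _ EF; have [lg _] := Ig.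
  apply: (atZ c^-1); first by rewrite invr_eq0.
  rewrite -[F](AdK _ lg).
  apply: (extremal_at_conj HT Tdet (isometry_inv Ig) _ EF).
  have : (g^-1)%VF (g w) = w by rewrite -comp_lfunE lker0_compVf ?id_lfunE //; exact/eqP.
  by rewrite gw linearZ /= => {2}<-; rewrite scalerA mulVf // scale1r.
- by move=> F F' EF EF'; apply: path_G; exact: (hub_path_conj Hw).
- move=> X WX X0; have [DX Xw] := W1 _ WX.
  have [F [EF FXF _]] := HE0 _ DX Xw X0.
  have [_ _ F2 Fx] := EF.1.
  exists (fun s => (s *: \1 + F) \o X \o (s *: \1 - F))%VF; split.
  + have lin Y : polycurve (fun s => s *: \1 + Y : 'End(V))%VF.
      by apply: polycurve_add; [apply: polycurve_scale|]; exact: polycurve_cst.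
    by apply: polycurve_comp; [apply: polycurve_comp; [|exact: polycurve_cst]|]; exact: lin.
  + have [c Hc] := Fx _ DX.
    rewrite scale0r !add0r comp_lfunNr Hc -scaleNr; apply: (extremal_atZ HT) => //.
    by rewrite oppr_eq0; apply/eqP => c0; apply: FXF; rewrite Hc c0 scale0r.
  + move=> s s0; exists (unip (s^-1 *: F)), (s ^+ 2); split.
    * apply: (G1 (fun t => unip (t *: F)) _ _ _ s^-1); first exact: polycurve_unip.
        by rewrite scale0r /unip addr0.
      move=> t; split; first exact: (extremal_derived HT Tdet detect0 _ EF.1).
      by rewrite unipE lfunE /= EF.2 scaler0 addr0.
    * by rewrite expf_neq0.
    * rewrite /Ad unipV; last by rewrite -comp_lfunZl -comp_lfunZr F2 !scaler0.
      have E Y : s *: \1%VF + Y = s *: unip (s^-1 *: Y) :> 'End(V).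
        by rewrite /unip scalerDr scalerA mulfV // scale1r.
      by rewrite !E scalerN -!comp_lfunZl -comp_lfunZr scalerA.
Qed.

End ExtremalOrbit.

Section TangentSpaces.
Variables (K : numClosedFieldType) (V : vectType K).
Variables (det : V -> K) (T : V -> V -> V -> K).
Hypothesis HT : sym_trilinear T.
Hypothesis Tdet : forall x, T x x x = 6%:R * det x.

Local Notation isometry := (isometry det).
Local Notation derivation := (derivation T).
Local Notation extremal := (extremal T).
Local Notation extremal_at := (extremal_at T).
Local Notation S := (derived_group isometry).

Lemma polyfun_det : polyfun det.
Proof.
have -> : det = (fun x => 6%:R^-1 * T x x x).
  by apply/funext => x; rewrite Tdet mulKf // pnatr_eq0.
by apply: polyfun_mul; [exact: polyfun_cst|exact: polyfun_trilin].
Qed.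

Lemma lie_algebra_derivation (G : set 'End(V)) X :
  G `<=` isometry -> lie_algebra G X -> derivation X.
Proof.
move=> GI HX.
have DX x : T (X x) x x = 0.
  pose f (g : 'End(V)) := det (g x) - det x.
  pose p : {poly K} := (2%:R^-1 * T (X x) x x) *: 'X + (2%:R^-1 * T (X x) (X x) x) *: 'X^2
    + (6%:R^-1 * T (X x) (X x) (X x)) *: 'X^3.
  have := HX f p; have -> : p`_1 = 2%:R^-1 * T (X x) x x.
    by rewrite !coefD !coefZ coefX !coefXn mulr1 !mulr0 !addr0.
  move=> H; apply: (@mulfI _ 2%:R^-1); first by rewrite invr_eq0 pnatr_eq0.
  rewrite mulr0; apply: H.
  - apply: polyfun_sub; last exact: polyfun_cst.
    pose ev (g : 'End(V)) : V := g x.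
    have evl : linear ev by move=> a g h; rewrite /ev !lfunE /= !lfunE.
    pose evL : {linear 'End(V) -> V} := HB.pack ev (GRing.isLinear.Build _ _ _ _ ev evl).
    exact: (polyfun_comp evL polyfun_det).
  - by move=> g /GI [_ Hg]; rewrite /f Hg subrr.
  - move=> t; rewrite /f add_lfunE id_lfunE scale_lfunE.
    have E y : det y = 6%:R^-1 * T y y y by rewrite Tdet mulKf // pnatr_eq0.
    have a u v : T u v u = T u u v by rewrite (trilinC23 HT).
    have b u v : T v u u = T u u v by rewrite (trilinC12 HT) (trilinC23 HT).
    rewrite !E !trilinE // /p !hornerD !hornerZ hornerX !hornerXn.
    rewrite !(a x) !(b x) !(a (X x)) !(b (X x)); by field.
move=> x y z; pose C x y z := T (X x) y z + T x (X y) z + T x y (X z).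
have HC : sym_trilinear C.
  rewrite /C; split=> *; rewrite ?linearP ?trilinE //; first ring.
  - rewrite [X in _ = X + _ + _](trilinC12 HT) [X in _ = _ + X + _](trilinC12 HT).
    by rewrite [X in _ = _ + X](trilinC12 HT) [X in _ = X + _]addrC.
  - rewrite [X in _ = X + _ + _](trilinC23 HT) [X in _ = _ + X + _](trilinC23 HT).
    by rewrite [X in _ = _ + X](trilinC23 HT) addrAC.
apply: (@mulfI _ 6%:R); rewrite ?pnatr_eq0 // -/(C x y z) (polarization HC).
have C0 t : C t t t = 0.
  by rewrite /C DX (trilinC12 HT t) DX (trilinC23 HT t t) (trilinC12 HT t) DX !addr0.
by rewrite !C0 !subr0 !addr0 mulr0.
Qed.

Lemma lie_algebra_line (G : set 'End(V)) X :
  (forall t, G (unip (t *: X))) -> lie_algebra G X.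
Proof.
move=> H f p _ Gf Hp.
have -> : p = 0 by apply: poly_vanish => t _; rewrite -Hp; apply: Gf; exact: H.
by rewrite coef0.
Qed.

Hypothesis detect0 : forall X, derivation X -> X != 0 ->
  exists F, extremal F /\ (F \o X \o F)%VF <> 0.

Lemma closed_orbit_derived : hub det T 0 ->
  closed_orbit S (@Ad _ _) (lie_algebra S) = [set F | extremal F].
Proof.
move=> H0; rewrite (closed_orbit_extremal HT Tdet detect0 H0).
- by apply/seteqP; split=> F /=; [case|split=> //; rewrite linear0].
- by move=> p _ _ Hp s; have [] := Hp s.
- move=> g /derived_isometry Ig; split=> //.
  by exists 1; rewrite oner_eq0 linear0 scaler0.
- move=> X HX; split; last by rewrite linear0.
  apply: lie_algebra_derivation HX; exact: derived_isometry.
- move=> F [EF _]; apply: lie_algebra_line => t.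
  exact: (extremal_derived HT Tdet detect0 _ EF).
Qed.

Lemma closed_orbit_stabilizer w (G : set 'End(V)) :
  G = component [set g | S g /\ exists c, c != 0 /\ g w = c *: w] \1%VF ->
  det w != 0 -> hub det T w ->
  closed_orbit G (@Ad _ _) (lie_algebra G) = [set F | extremal_at w F].
Proof.
move=> EG dw Hw.
have G1 (p : K -> 'End(V)) : polycurve p -> p 0 = \1%VF ->
     (forall s, S (p s) /\ p s w = w) -> forall s, G (p s).
  move=> Hp p0 Hs s; rewrite EG -p0; apply: component_polycurve => // t.
  have [S1 S2] := Hs t; split=> //; exists 1.
  by rewrite oner_eq0 S2 scale1r.
have G2 g : G g -> isometry g /\ exists c, c != 0 /\ g w = c *: w.
  by rewrite EG => /component_sub [/derived_isometry Ig Hc].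
apply: closed_orbit_extremal => //.
- move=> X HX; have DX : derivation X.
    by apply: lie_algebra_derivation HX => g /G2 [].
  split=> //.
  have w0 : w != 0.
    apply: contraNneq dw => ->; apply/eqP.
    by apply: (@mulfI _ 6%:R); rewrite ?pnatr_eq0 // -Tdet trilin01 // mulr0.
  have [c Xc] : exists c, X w = c *: w.
    apply/colinearP => // l m.
    pose f (g : 'End(V)) := l (g w) * m w - m (g w) * l w.
    pose p : {poly K} := (l (X w) * m w - m (X w) * l w) *: 'X.
    have := HX f p; rewrite coefZ coefX mulr1; apply.
    + apply: polyfun_scalar => a g h; rewrite /f !lfunE /= !lfunE /= !linearP /=; ring.
    + by move=> g /G2 [_ [c [_ gw]]]; rewrite /f gw !linearZ /=; apply/eqP; rewrite subr_eq0; apply/eqP; ring.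
    + move=> t; rewrite /f /p hornerZ hornerX add_lfunE id_lfunE scale_lfunE !linearD !linearZ /=; ring.
  have := DX w w w; rewrite Xc !trilinE // -!mulrDl Tdet => /eqP.
  rewrite mulf_eq0 mulf_eq0 pnatr_eq0 (negPf dw) /= orbF => /eqP c3.
  have -> : c = 0 by apply: (@mulfI _ 3%:R); rewrite ?pnatr_eq0 // mulr0 -c3; ring.
  by rewrite scale0r.
- move=> F EF; apply: lie_algebra_line => t.
  apply: (G1 (fun t => unip (t *: F))); first exact: polycurve_unip.
    by rewrite scale0r /unip addr0.
  move=> s; split; first exact: (extremal_derived HT Tdet detect0 _ EF.1).
  by rewrite unipE lfunE /= EF.2 scaler0 addr0.
Qed.

End TangentSpaces.

(** * The cubic form on the 27 lines *)

(* Over a field containing 'i the complexification of C is K x K, through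
   u = a + 'i b and v = a - 'i b; the coordinates (u, v) of the four complex
   components of each octonion, with the three diagonal entries, make of det8 a sum
   of 45 monomials with coefficients 1 and -1: the tritangent planes of the 27 lines
   on a cubic surface.  The boolean is true for the coefficient -1. *)
Definition triads : seq (nat * nat * nat * bool) :=
  [:: (0, 1, 2, false); (0, 3, 4, true); (0, 5, 6, true); (0, 7, 8, true);
   (0, 9, 10, true); (1, 11, 12, true); (1, 13, 14, true); (1, 15, 16, true);
   (1, 17, 18, true); (2, 19, 20, true); (2, 21, 22, true); (2, 23, 24, true);
   (2, 25, 26, true); (3, 11, 19, false); (3, 13, 22, true); (3, 15, 24, true);
   (3, 18, 25, true); (4, 12, 20, false); (4, 14, 21, true); (4, 16, 23, true);
   (4, 17, 26, true); (5, 12, 22, true); (5, 14, 19, true); (5, 15, 26, true);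
   (5, 18, 23, false); (6, 11, 21, true); (6, 13, 20, true); (6, 16, 25, true);
   (6, 17, 24, false); (7, 12, 24, true); (7, 13, 26, false); (7, 16, 19, true);
   (7, 18, 21, true); (8, 11, 23, true); (8, 14, 25, false); (8, 15, 20, true);
   (8, 17, 22, true); (9, 11, 26, true); (9, 14, 24, true); (9, 16, 22, false);
   (9, 18, 20, true); (10, 12, 25, true); (10, 13, 23, true); (10, 15, 21, false);
   (10, 17, 19, true)].

Section WeightBasis.
Variable K : numClosedFieldType.

Definition C_uv (u v : K) : Cc K := ((u + v) / 2%:R, (u - v) / (2%:R * 'i)).

Definition O_uv (f : nat -> K) n : Oc K :=
  (((C_uv (f n) (f n.+1)), (C_uv (f n.+2) (f n.+3))),
   ((C_uv (f n.+4) (f n.+4.+1)), (C_uv (f n.+4.+2) (f n.+4.+3)))).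

Definition of_weights (f : nat -> K) : J8 K :=
  ((f 0%N, f 1%N, f 2%N), (O_uv f 3, O_uv f 11, O_uv f 19)).

Definition C_list (x : Cc K) : seq K := [:: x.1 + 'i * x.2; x.1 - 'i * x.2].

Definition O_list (x : Oc K) : seq K :=
  C_list x.1.1 ++ C_list x.1.2 ++ C_list x.2.1 ++ C_list x.2.2.

Definition weight_list (x : J8 K) : seq K :=
  [:: x.1.1.1; x.1.1.2; x.1.2] ++ O_list x.2.1.1 ++ O_list x.2.1.2 ++ O_list x.2.2.

Definition weight (x : J8 K) (n : nat) : K := nth 0 (weight_list x) n.

Lemma two_neq0 : (2%:R : K) != 0. Proof. by rewrite pnatr_eq0. Qed.

Lemma C_uvK (x : Cc K) : C_uv (x.1 + 'i * x.2) (x.1 - 'i * x.2) = x.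
Proof.
case: x => a b; rewrite /C_uv /=; have := two_neq0; have := neq0Ci K => i0 n2.
by congr pair; field; do ?exact: i0.
Qed.

Lemma C_list_uv u v : C_list (C_uv u v) = [:: u; v].
Proof.
have := two_neq0; have := neq0Ci K => i0 n2; rewrite /C_list /C_uv /=.
congr [:: _; _]; field; do ?exact: i0.
Qed.

Lemma of_weightsK (x : J8 K) : of_weights (weight x) = x.
Proof.
case: x => [[[r1 r2] r3] [[x1 x2] x3]].
by rewrite /of_weights /O_uv /weight /weight_list /O_list /C_list /= !C_uvK; case: x1 x2 x3 => [[? ?] [? ?]] [[? ?] [? ?]] [[? ?] [? ?]].
Qed.

Lemma O_list_uv f n : O_list (O_uv f n) =
  [:: f n; f n.+1; f n.+2; f n.+3; f n.+4; f n.+4.+1; f n.+4.+2; f n.+4.+3].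
Proof.
have -> : O_list (O_uv f n) = C_list (C_uv (f n) (f n.+1)) ++ C_list (C_uv (f n.+2) (f n.+3))
  ++ C_list (C_uv (f n.+4) (f n.+4.+1)) ++ C_list (C_uv (f n.+4.+2) (f n.+4.+3)) by [].
by rewrite !C_list_uv.
Qed.

Lemma weight_of_weights f n : (n < 27)%N -> weight (of_weights f) n = f n.
Proof.
move=> n27; rewrite /weight.
have -> : weight_list (of_weights f) =
  [:: f 0; f 1; f 2]%N ++ O_list (O_uv f 3) ++ O_list (O_uv f 11) ++ O_list (O_uv f 19) by [].
rewrite !O_list_uv.
by rewrite (_ : _ ++ _ = mkseq f 27) // nth_mkseq.
Qed.

Lemma of_weights_linear a f g :
  of_weights (fun n => a * f n + g n) = a *: of_weights f + of_weights g.
Proof.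
have E u v u' v' : C_uv (a * u + u') (a * v + v') = a *: C_uv u v + C_uv u' v'.
  by have := two_neq0; have := neq0Ci K => i0 n2; rewrite /C_uv; congr pair; rewrite /= /GRing.scale /=; field; do ?exact: i0.
by rewrite /of_weights /O_uv !E.
Qed.

Lemma weight8P a x y n : (n < 27)%N -> weight (a *: x + y) n = a * weight x n + weight y n.
Proof.
move=> n27; rewrite -{1}[x]of_weightsK -{1}[y]of_weightsK -of_weights_linear.
by rewrite weight_of_weights.
Qed.

Definition uv_mul (p q : K * K) : K * K := (p.1 * q.1, p.2 * q.2).
Definition uv_conj (p : K * K) : K * K := (p.2, p.1).
Definition uv_of (p : K * K) : Cc K := C_uv p.1 p.2.

Lemma uv_ofM p q : Cmul (uv_of p) (uv_of q) = uv_of (uv_mul p q).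
Proof.
case: p q => u v [u' v'].
have := two_neq0; have := neq0Ci K => i0 n2; have i2 : 'i * 'i = -1 :> K by rewrite -expr2 sqrCi.
rewrite /Cmul /cd_mul /uv_of /C_uv /=; congr pair; last by field; do ?exact: i0.
have -> : (u' - v') / (2 * 'i) * ((u - v) / (2 * 'i)) = (u' - v') * (u - v) / (4%:R * ('i * 'i)).
  by field; do ?exact: i0.
by rewrite i2; field.
Qed.

Lemma uv_ofC p : Cconj (uv_of p) = uv_of (uv_conj p).
Proof. by rewrite /Cconj /cd_conj /uv_of /C_uv /= -mulNr opprB addrC. Qed.

Lemma uv_ofB p q : uv_of (p - q) = uv_of p - uv_of q.
Proof.
by case: p q => u v [u' v']; rewrite /uv_of /C_uv; congr pair; rewrite /= -mulrBl; congr (_ / _); ring.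
Qed.

Definition pair_map (A B : Type) (f : A -> B) (x : A * A) : B * B := (f x.1, f x.2).

Section DoublingMorphism.
Variables (A B : zmodType) (f : A -> B).
Variables (m : A -> A -> A) (c : A -> A) (m' : B -> B -> B) (c' : B -> B).
Hypothesis fB : forall x y, f (x - y) = f x - f y.
Hypothesis fM : forall x y, m' (f x) (f y) = f (m x y).
Hypothesis fC : forall x, c' (f x) = f (c x).

Lemma doubling_opp x : f (- x) = - f x.
Proof. by have f0 : f 0 = 0 by [rewrite -(subrr 0) fB subrr]; rewrite -sub0r fB f0 sub0r. Qed.

Lemma pair_mapB x y : pair_map f (x - y) = pair_map f x - pair_map f y.
Proof. by rewrite /pair_map !fB. Qed.

Lemma cd_mul_map x y : cd_mul m' c' (pair_map f x) (pair_map f y) = pair_map f (cd_mul m c x y).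
Proof.
rewrite /cd_mul /pair_map /=; rewrite !fC !fM !fB; congr pair.
by rewrite -[X in _ = f (_ + X)]opprK fB doubling_opp opprK.
Qed.

Lemma cd_conj_map x : cd_conj c' (pair_map f x) = pair_map f (cd_conj c x).
Proof. by rewrite /cd_conj /pair_map /= fC doubling_opp. Qed.

End DoublingMorphism.

Definition oct_of (x : ((K * K) * (K * K)) * ((K * K) * (K * K))) : Oc K :=
  pair_map (pair_map uv_of) x.
Definition oct_mul := cd_mul (cd_mul uv_mul uv_conj) (cd_conj uv_conj).
Definition oct_conj := cd_conj (cd_conj uv_conj).

Lemma oct_ofM x y : Omul (oct_of x) (oct_of y) = oct_of (oct_mul x y).
Proof.
apply: cd_mul_map => *; first by apply: pair_mapB; exact: uv_ofB.
- by apply: cd_mul_map; [exact: uv_ofB|exact: uv_ofM|exact: uv_ofC].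
- by apply: cd_conj_map; [exact: uv_ofB|exact: uv_ofC].
Qed.

Lemma oct_ofC x : Oconj (oct_of x) = oct_of (oct_conj x).
Proof.
apply: cd_conj_map => *; first by apply: pair_mapB; exact: uv_ofB.
by apply: cd_conj_map; [exact: uv_ofB|exact: uv_ofC].
Qed.

Lemma Ore_oct_of x : Ore (oct_of x) = (x.1.1.1 + x.1.1.2) / 2%:R.
Proof. by []. Qed.

Definition sgb (b : bool) : K := if b then -1 else 1.

Definition oct_weights (f : nat -> K) n :=
  (((f n, f n.+1), (f n.+2, f n.+3)), ((f n.+4, f n.+4.+1), (f n.+4.+2, f n.+4.+3))).

Lemma det8_of_weights f : det8 (of_weights f) =
  \sum_(t <- triads) sgb t.2 * f t.1.1.1 * f t.1.1.2 * f t.1.2.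
Proof.
rewrite /det8 /of_weights /Onorm.
have E n : O_uv f n = oct_of (oct_weights f n) by [].
rewrite !E !oct_ofC !oct_ofM !Ore_oct_of /triads /sgb unlock /=.
have := two_neq0 => n2.
by field.
Qed.

End WeightBasis.

Definition third_rule (a b : nat) : option (nat * bool) :=
  ohead (pmap (fun t : nat * nat * nat * bool => let: (x, y, z, e) := t in
    if ((a == x) && (b == y)) || ((a == y) && (b == x)) then Some (z, e)
    else if ((a == x) && (b == z)) || ((a == z) && (b == x)) then Some (y, e)
    else if ((a == y) && (b == z)) || ((a == z) && (b == y)) then Some (x, e)
    else None) triads).

Definition third_table : seq (seq (option (nat * bool))) :=
  Eval vm_compute in [seq [seq third_rule a b | b <- iota 0 27] | a <- iota 0 27].

(* The third line and the sign of the triad containing a and b, if these lines are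
   distinct and meet. *)
Definition third (a b : nat) : option (nat * bool) := nth None (nth [::] third_table a) b.

Definition all27 (P : pred nat) : bool := all P (iota 0 27).

Lemma all27P P : all27 P -> forall a, (a < 27)%N -> P a.
Proof. by move=> /allP H a a27; apply: H; rewrite mem_iota. Qed.

Lemma third_oversize a b : third a b <> None -> (a < 27)%N /\ (b < 27)%N.
Proof.
rewrite /third => H; have a27 : (a < 27)%N.
  by rewrite ltnNge; apply/negP => a27; apply: H; rewrite (@nth_default _ _ third_table _ a27) nth_nil.
split=> //; rewrite ltnNge; apply/negP => b27; apply: H; rewrite nth_default //.
have : all27 (fun a => size (nth [::] third_table a) == 27) by vm_compute.
by move=> /all27P /(_ a a27) /eqP ->.
Qed.

Lemma third_sym a b c e : third a b = Some (c, e) ->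
  [/\ (c < 27)%N, third b a = Some (c, e), third a c = Some (b, e) & a != b].
Proof.
move=> H; have [a27 b27] : (a < 27)%N /\ (b < 27)%N by apply: third_oversize; rewrite H.
have : all27 (fun a => all27 (fun b => if third a b is Some (c, e) then
  [&& c < 27, third b a == Some (c, e), third a c == Some (b, e) & a != b]%N else true)).
  by vm_compute.
move=> /all27P /(_ a a27) /all27P /(_ b b27); rewrite H.
by case/and4P=> ? /eqP ? /eqP ?.
Qed.

Lemma third_symN a b : third a b = None -> third b a = None.
Proof. by case E: (third b a) => [[c e]|] //; have [_ -> _ _] := third_sym E. Qed.

Lemma third_rot a b c e : third a b = Some (c, e) -> third b c = Some (a, e).
Proof. by case/third_sym=> _ /third_sym[]. Qed.

Section WeightSystem.
Variables (K : numClosedFieldType) (V : lmodType K).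

Definition weight_system (weight : V -> nat -> K) (basis : nat -> V) : Prop :=
  [/\ forall a x y n, (n < 27)%N -> weight (a *: x + y) n = a * weight x n + weight y n,
      forall a n, (n < 27)%N -> weight (basis a) n = (n == a)%:R &
      forall x y, (forall n, (n < 27)%N -> weight x n = weight y n) -> x = y].

End WeightSystem.

Section Trilinear27.
Variables (K : numClosedFieldType) (V : vectType K) (weight : V -> nat -> K) (basis : nat -> V).
Hypothesis HW : weight_system weight basis.
Local Notation sgb := (@sgb K).

Lemma weightP a x y n : (n < 27)%N -> weight (a *: x + y) n = a * weight x n + weight y n.
Proof. by case: HW => H _ _; exact: H. Qed.

Lemma weight_basis a n : (n < 27)%N -> weight (basis a) n = (n == a)%:R.
Proof. by case: HW => _ H _; exact: H. Qed.

Lemma weight_ext x y : (forall n, (n < 27)%N -> weight x n = weight y n) -> x = y.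
Proof. by case: HW => _ _ H; exact: H. Qed.

Lemma weight0 n : (n < 27)%N -> weight 0 n = 0.
Proof. by move=> n27; have := @weightP (-1) 0 0 n n27; rewrite scaler0 addr0 mulN1r addNr. Qed.

Lemma weightD x y n : (n < 27)%N -> weight (x + y) n = weight x n + weight y n.
Proof. by move=> n27; rewrite -[x]scale1r weightP // mul1r scale1r. Qed.

Lemma weightZ a x n : (n < 27)%N -> weight (a *: x) n = a * weight x n.
Proof. by move=> n27; rewrite -[a *: x]addr0 weightP // weight0 // addr0. Qed.

Lemma weight_sum (I : Type) (r : seq I) (P : pred I) (F : I -> V) n : (n < 27)%N ->
  weight (\sum_(i <- r | P i) F i) n = \sum_(i <- r | P i) weight (F i) n.
Proof.
move=> n27; apply: (big_morph (fun x => weight x n)) => [x y|]; first exact: weightD.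
exact: weight0.
Qed.

Lemma basis_expand x : x = \sum_(a < 27) weight x a *: basis a.
Proof.
apply: weight_ext => n n27; rewrite weight_sum // (bigD1 (Ordinal n27)) //=.
rewrite weightZ // weight_basis // eqxx mulr1 big1 ?addr0 // => i ni.
rewrite weightZ // weight_basis // (_ : (n == i) = false) ?mulr0 //.
by apply/negP => /eqP E; case/eqP: ni; apply/val_inj.
Qed.

Definition third_coef (a b c : nat) : K :=
  if third a b is Some (d, e) then if d == c then sgb e else 0 else 0.

Lemma third_coefC12 a b c : third_coef a b c = third_coef b a c.
Proof.
rewrite /third_coef; case E: (third a b) => [[d e]|]; first by have [_ -> _ _] := third_sym E.
by rewrite (third_symN E).
Qed.

Lemma third_coefC23 a b c : third_coef a b c = third_coef a c b.
Proof.
rewrite /third_coef; case E: (third a b) => [[d e]|].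
  case: (eqVneq d c) => [dc|dc].
    by subst d; have [_ _ -> _] := third_sym E; rewrite eqxx.
  case F: (third a c) => [[d' e']|] //; case: (eqVneq d' b) => // db.
  have [_ _ F' _] := third_sym F; move: F'; rewrite db E => -[dc' _].
  by rewrite dc' eqxx in dc.
case F: (third a c) => [[d' e']|] //; case: (eqVneq d' b) => // db.
by have [_ _ F' _] := third_sym F; move: F'; rewrite db E.
Qed.

Definition T27 (x y z : V) : K :=
  \sum_(a < 27) \sum_(b < 27) \sum_(c < 27) third_coef a b c * weight x a * weight y b * weight z c.

Lemma T27_sym : sym_trilinear T27.
Proof.
split=> [y z a x x'|x y z|x y z].
- rewrite /T27 mulr_sumr -big_split; apply: eq_bigr => i _ /=.
  rewrite mulr_sumr -big_split; apply: eq_bigr => j _ /=.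
  rewrite mulr_sumr -big_split; apply: eq_bigr => k _ /=.
  by rewrite weightP //; ring.
- rewrite /T27 exchange_big; apply: eq_bigr => i _; apply: eq_bigr => j _; apply: eq_bigr => k _ /=.
  by rewrite third_coefC12; ring.
- rewrite /T27; apply: eq_bigr => i _; rewrite exchange_big; apply: eq_bigr => j _; apply: eq_bigr => k _ /=.
  by rewrite third_coefC23; ring.
Qed.

Lemma T27_basis2 x b c : (b < 27)%N -> (c < 27)%N ->
  T27 x (basis b) (basis c) = if third b c is Some (d, e) then sgb e * weight x d else 0.
Proof.
move=> b27 c27; rewrite (trilinC12 T27_sym) (trilinC23 T27_sym) /T27.
rewrite (bigD1 (Ordinal b27)) //= [X in _ + X]big1 ?addr0; last first.
  move=> i ni; rewrite big1 // => j _; rewrite big1 // => k _.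
  rewrite weight_basis // (_ : (val i == b) = false) ?mulr0 ?mul0r //.
  by apply/negP => /eqP E; case/eqP: ni; apply/val_inj.
rewrite (bigD1 (Ordinal c27)) //= [X in _ + X]big1 ?addr0; last first.
  move=> i ni; rewrite big1 // => k _.
  rewrite (weight_basis c) // (_ : (val i == c) = false) ?mulr0 ?mul0r //.
  by apply/negP => /eqP E; case/eqP: ni; apply/val_inj.
under eq_bigr => k _ do rewrite !weight_basis // !eqxx !mulr1.
rewrite /third_coef; case E: (third b c) => [[d e]|]; last by rewrite big1 // => k _; rewrite mul0r.
have [d27 _ _ _] := third_sym E.
rewrite (bigD1 (Ordinal d27)) //= eqxx big1 ?addr0 // => k nk.
by case: eqVneq; rewrite ?mul0r // => E'; case/eqP: nk; apply/val_inj.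
Qed.

Definition triad_terms : seq (nat * nat * nat * bool) :=
  flatten [seq [:: (t.1.1.1, t.1.1.2, t.1.2, t.2); (t.1.1.1, t.1.2, t.1.1.2, t.2);
     (t.1.1.2, t.1.1.1, t.1.2, t.2); (t.1.1.2, t.1.2, t.1.1.1, t.2);
     (t.1.2, t.1.1.1, t.1.1.2, t.2); (t.1.2, t.1.1.2, t.1.1.1, t.2)] | t <- triads].

Definition third_terms : seq (nat * nat * nat * bool) :=
  flatten [seq flatten [seq if third a b is Some (c, e) then [:: (a, b, c, e)] else [::]
    | b <- iota 0 27] | a <- iota 0 27].

Definition cubic (x : V) : K :=
  \sum_(t <- triads) sgb t.2 * weight x t.1.1.1 * weight x t.1.1.2 * weight x t.1.2.

Lemma T27_det x : T27 x x x = 6%:R * cubic x.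
Proof.
pose F (t : nat * nat * nat * bool) : K :=
  sgb t.2 * weight x t.1.1.1 * weight x t.1.1.2 * weight x t.1.2.
transitivity (\sum_(t <- third_terms) F t).
  rewrite /T27 /third_terms big_flatten big_map -[iota 0 27]/(index_iota 0 27) big_mkord.
  apply: eq_bigr => a _; rewrite big_flatten big_map big_mkord.
  apply: eq_bigr => b _; rewrite /third_coef.
  case E: (third a b) => [[d e]|]; last by rewrite big_nil big1 // => c _; rewrite !mul0r.
  rewrite big_seq1 /F /=; have [d27 _ _ _] := third_sym E.
  rewrite (bigD1 (Ordinal d27)) //= eqxx big1 ?addr0 // => k nk.
  by case: eqVneq; rewrite ?mul0r // => E'; case/eqP: nk; apply/val_inj.
have perm : perm_eq third_terms triad_terms by vm_compute.
rewrite (perm_big _ perm) /triad_terms /cubic big_flatten big_map mulr_sumr; apply: eq_bigr => -[[[a b] c] e] _.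
by rewrite !big_cons big_nil /F /=; ring.
Qed.

End Trilinear27.

Section Sparse.
Variables (K : numClosedFieldType) (V : vectType K) (weight : V -> nat -> K) (basis : nat -> V).
Hypothesis HW : weight_system weight basis.
Local Notation sgb := (@sgb K).
Local Notation T27 := (T27 weight).
Local Notation derivation := (derivation T27).
Let HT : sym_trilinear T27 := T27_sym HW.

Lemma sgb_sq e : sgb e * sgb e = 1.
Proof. by case: e; rewrite /sgb ?mulrNN mulr1. Qed.

Lemma sgb_neq0 e : sgb e != 0.
Proof. by case: e; rewrite /sgb ?oppr_eq0 oner_eq0. Qed.

Lemma sgb_addb e e' : sgb (e (+) e') = sgb e * sgb e'.
Proof. by case: e e' => [] []; rewrite /sgb /= ?mulrNN ?mulr1 ?mul1r. Qed.

Lemma sgb_neg e : sgb (~~ e) = - sgb e.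
Proof. by case: e; rewrite /sgb /= ?opprK. Qed.

Definition entry (X : 'End(V)) a b : K := weight (X (basis b)) a.

Definition third_entry (X : 'End(V)) b c a : K :=
  if third b c is Some (d, e) then sgb e * entry X d a else 0.

Lemma derivation_entries X a b c : derivation X -> (a < 27)%N -> (b < 27)%N -> (c < 27)%N ->
  third_entry X b c a + third_entry X a c b + third_entry X a b c = 0.
Proof.
move=> DX a27 b27 c27; rewrite -(DX (basis a) (basis b) (basis c)).
rewrite (trilinC12 HT (basis a)) (trilinC23 HT (basis a) (basis b)).
by rewrite (trilinC12 HT (basis a) (X (basis c))) !(T27_basis2 HW).
Qed.

Lemma derivation_basis (X : 'End(V)) :
  (forall x b c, (b < 27)%N -> (c < 27)%N ->
     T27 (X x) (basis b) (basis c) + T27 x (X (basis b)) (basis c)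
     + T27 x (basis b) (X (basis c)) = 0) -> derivation X.
Proof.
move=> H x y z; pose f y z := T27 (X x) y z + T27 x (X y) z + T27 x y (X z).
have fD1 y' y'' t : f (y' + y'') t = f y' t + f y'' t.
  by rewrite /f linearD !(trilinE HT); ring.
have fZ1 a y' t : f (a *: y') t = a * f y' t.
  by rewrite /f linearZ /= !(trilinE HT); ring.
have fD2 t y' y'' : f t (y' + y'') = f t y' + f t y''.
  by rewrite /f linearD !(trilinE HT); ring.
have fZ2 a t y' : f t (a *: y') = a * f t y'.
  by rewrite /f linearZ /= !(trilinE HT); ring.
have f01 t : f 0 t = 0 by rewrite -[X in f X](scale0r 0) fZ1 mul0r.
have f02 t : f t 0 = 0 by rewrite -[X in f _ X](scale0r 0) fZ2 mul0r.
rewrite -/(f y z) (basis_expand HW y) (big_morph (f^~ z) (fun u v => fD1 u v z) (f01 z)) big1 // => b _.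
rewrite fZ1 (basis_expand HW z) (big_morph (f (basis b)) (fD2 _) (f02 _)) big1 ?mulr0 // => c _.
by rewrite fZ2 /f H ?mulr0.
Qed.

Lemma lfun_basis_ext (X Y : 'End(V)) :
  (forall b, (b < 27)%N -> X (basis b) = Y (basis b)) -> X = Y.
Proof.
move=> H; apply/lfunP => x; rewrite (basis_expand HW x) !linear_sum; apply: eq_bigr => b _.
by rewrite !linearZ /= H.
Qed.

Lemma entry0_eq0 (X : 'End(V)) :
  (forall a b, (a < 27)%N -> (b < 27)%N -> entry X a b = 0) -> X = 0.
Proof.
move=> H; apply: lfun_basis_ext => b b27; apply: (weight_ext HW) => a a27.
by rewrite lfunE (weight0 HW) //; exact: H.
Qed.

Lemma entry_expand (X : 'End(V)) x a : (a < 27)%N ->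
  weight (X x) a = \sum_(b < 27) entry X a b * weight x b.
Proof.
move=> a27; rewrite {1}(basis_expand HW x) linear_sum (weight_sum HW) //; apply: eq_bigr => b _.
by rewrite linearZ /= (weightZ HW) // mulrC.
Qed.

Definition sparse_fun (L : seq (nat * nat * bool)) (x : V) : V :=
  \sum_(t <- L) (sgb t.2 * weight x t.1.2) *: basis t.1.1.

Definition sparse (L : seq (nat * nat * bool)) : 'End(V) := linfun (sparse_fun L).

Definition in_range (L : seq (nat * nat * bool)) : bool :=
  all (fun t => (t.1.1 < 27) && (t.1.2 < 27))%N L.

Lemma sparseE L x : in_range L ->
  sparse L x = \sum_(t <- L) (sgb t.2 * weight x t.1.2) *: basis t.1.1.
Proof.
move=> /allP HL; rewrite /sparse.
have lin : linear (sparse_fun L).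
  move=> a u v; rewrite /sparse_fun scaler_sumr -big_split /=; apply: eq_big_seq => t tL.
  have /andP [_ m27] := HL _ tL.
  by rewrite (weightP HW) // scalerA -scalerDl; congr (_ *: _); ring.
pose l : {linear V -> V} := HB.pack (sparse_fun L) (GRing.isLinear.Build _ _ _ _ _ lin).
exact: (lfunE l x).
Qed.

Lemma sparse_basis L b : in_range L ->
  sparse L (basis b) = \sum_(t <- L | t.1.2 == b) sgb t.2 *: basis t.1.1.
Proof.
move=> HL; rewrite sparseE // [RHS]big_mkcond; apply: eq_big_seq => t tL.
have /andP [_ m27] := allP HL _ tL.
by rewrite (weight_basis HW) //; case: eqP => _; rewrite ?mulr1 // mulr0 scale0r.
Qed.

Lemma weight_sparse L x n : in_range L -> (n < 27)%N ->
  weight (sparse L x) n = \sum_(t <- L | t.1.1 == n) sgb t.2 * weight x t.1.2.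
Proof.
move=> HL n27; rewrite sparseE // (weight_sum HW) // [RHS]big_mkcond; apply: eq_bigr => t _.
by rewrite (weightZ HW) // (weight_basis HW) // [n == _]eq_sym; case: eqP; rewrite ?mulr1 ?mulr0.
Qed.

Definition sparse_nilp (L : seq (nat * nat * bool)) : bool :=
  all (fun t => all (fun t' => t.1.2 != t'.1.1) L) L.

Lemma sparse_sq0 L : in_range L -> sparse_nilp L -> (sparse L \o sparse L)%VF = 0.
Proof.
move=> HL nL; apply/lfunP => x; rewrite comp_lfunE [RHS]lfunE sparseE // big_seq big1 // => t tL.
have /andP [_ m27] := allP HL _ tL.
rewrite weight_sparse // big_seq_cond big1 ?mulr0 ?scale0r // => t' /andP [t'L /eqP E].
by have := allP (allP nL _ tL) _ t'L; rewrite E eqxx.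
Qed.

Lemma T27_sparse L x y z : in_range L ->
  T27 (sparse L x) y z = \sum_(t <- L) sgb t.2 * weight x t.1.2 * T27 (basis t.1.1) y z.
Proof.
move=> HL; rewrite sparseE // (big_morph (fun u => T27 u y z) (fun u v => trilinD1 HT u v y z) (trilin01 HT y z)).
by apply: eq_bigr => t _; rewrite (trilinZ1 HT).
Qed.

(* The terms that the entries in L contribute to T27 (E x) b c + T27 x (E b) c + T27 x b (E c). *)
Definition defect_terms (L : seq (nat * nat * bool)) b c : seq (nat * bool) :=
  flatten [seq
    (if third b c is Some (d, e) then if d == t.1.1 then [:: (t.1.2, t.2 (+) e)] else [::] else [::])
    ++ (if t.1.2 == b then if third t.1.1 c is Some (d, e) then [:: (d, t.2 (+) e)] else [::] else [::])
    ++ (if t.1.2 == c then if third b t.1.1 is Some (d, e) then [:: (d, t.2 (+) e)] else [::] else [::])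
    | t <- L].

Definition cancelling (s : seq (nat * bool)) : bool :=
  match s with
  | [::] => true
  | [:: u; v] => (u.1 == v.1) && (u.2 != v.2)
  | _ => false
  end.

Lemma sparse_derivation L : in_range L ->
  (forall b c, (b < 27)%N -> (c < 27)%N -> cancelling (defect_terms L b c)) ->
  derivation (sparse L).
Proof.
move=> HL Hc; apply: derivation_basis => x b c b27 c27.
pose F (u : nat * bool) := sgb u.2 * weight x u.1.
transitivity (\sum_(u <- defect_terms L b c) F u); last first.
  have := Hc _ _ b27 c27; case: (defect_terms L b c) => [|u [|v [|]]] //=; first by rewrite big_nil.
  move=> /andP [/eqP E nE]; rewrite !big_cons big_nil /F E addr0.
  have -> : sgb u.2 = - sgb v.2 by rewrite -sgb_neg; case: u.2 v.2 nE {E} => [] [].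
  by rewrite mulNr addNr.
rewrite (trilinC12 HT x (sparse L (basis b))) (trilinC23 HT x (basis b)).
rewrite (trilinC12 HT x (sparse L (basis c))) !T27_sparse //.
rewrite /defect_terms big_flatten big_map -!big_split; apply: eq_big_seq => t tL /=.
have /andP [k27 m27] := allP HL _ tL.
rewrite !big_cat /= (trilinC12 HT _ x (basis c)) (trilinC12 HT _ x (basis b)).
rewrite (trilinC23 HT x _ (basis b)) !(T27_basis2 HW) // !(weight_basis HW) // addrA.
congr (_ + _ + _).
- case E: (third b c) => [[d e]|]; last by rewrite big_nil mulr0.
  have [d27 _ _ _] := third_sym E; rewrite (weight_basis HW) //.
  case: eqP => _; last by rewrite big_nil !mulr0.
  by rewrite big_seq1 /F /= sgb_addb mulr1; ring.
- case: eqP => _; last by rewrite big_nil mulr0 mul0r.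
  case E: (third t.1.1 c) => [[d e]|]; last by rewrite big_nil mulr0.
  by rewrite big_seq1 /F /= sgb_addb mulr1; ring.
- case: eqP => _; last by rewrite big_nil mulr0 mul0r.
  case E: (third b t.1.1) => [[d e]|]; last by rewrite big_nil mulr0.
  by rewrite big_seq1 /F /= sgb_addb mulr1; ring.
Qed.

End Sparse.

Definition skew (i m : nat) : bool := (i != m) && (third i m == None).

(* The weights of the root element taking the weight vector m to i.  The invariance of the
   cubic form forces each other entry: if third i c = (b, e) and third m b = (k, e'), then
   the entries (i, m) and (k, c) satisfy e E_im + e' E_kc = 0. *)
Definition root_rule (i m : nat) : seq (nat * nat * bool) :=
  (i, m, false) :: flatten [seq if third i c is Some (b, e) then
    if third m b is Some (k, e') then [:: (k, c, ~~ (e (+) e'))] else [::] else [::]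
    | c <- iota 0 27].

Definition root_table : seq (seq (seq (nat * nat * bool))) :=
  Eval vm_compute in [seq [seq root_rule i m | m <- iota 0 27] | i <- iota 0 27].

Definition root (i m : nat) : seq (nat * nat * bool) := nth [::] (nth [::] root_table i) m.

Lemma root_ruleE i m : (i < 27)%N -> (m < 27)%N -> root i m = root_rule i m.
Proof.
have : all27 (fun i => all27 (fun m => root i m == root_rule i m)) by vm_compute.
by move=> H i27 m27; apply/eqP; exact: (all27P (all27P H i27) m27).
Qed.

Lemma rootP i m t : (i < 27)%N -> (m < 27)%N -> reflect (t = (i, m, false) \/
   exists b e e', [/\ (t.1.2 < 27)%N, third i t.1.2 = Some (b, e),
     third m b = Some (t.1.1, e') & t.2 = ~~ (e (+) e')]) (t \in root i m).
Proof.
move=> i27 m27; rewrite root_ruleE // /root_rule in_cons; apply: (iffP orP).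
- move=> [/eqP ->|/flatten_mapP [c]]; first by left.
  rewrite mem_iota => c27; case E: (third i c) => [[b e]|] //.
  case E': (third m b) => [[k e']|] //; rewrite inE => /eqP ->.
  by right; exists b, e, e'.
- move=> [->|[b [e [e' [c27 H1 H2 H3]]]]]; [by left|right].
  apply/flatten_mapP; exists t.1.2; first by rewrite mem_iota.
  by rewrite H1 H2 inE -H3; case: t {H1 H2 H3 c27} => [[]].
Qed.

Lemma mem_root i m : (i < 27)%N -> (m < 27)%N -> (i, m, false) \in root i m.
Proof. by move=> i27 m27; rewrite root_ruleE // mem_head. Qed.

Definition root_check (i m : nat) : bool :=
  let L := root i m in
  [&& in_range L, sparse_nilp L, uniq L, all27 (fun b => all27 (fun c => cancelling (defect_terms L b c))),
      all (fun t => all (fun t' => (t == t') || (third t.1.2 t'.1.1 != None)) L) L &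
      all (fun t => (t.1.2, t.1.1, t.2) \in root m i) L].

Lemma root_checked : all27 (fun i => all27 (fun m => skew i m ==> root_check i m)).
Proof. by vm_compute. Qed.

Lemma skew_sym i m : skew i m -> skew m i.
Proof. by rewrite /skew eq_sym => /andP [-> /eqP /third_symN ->]. Qed.

Section RootElements.
Variables (K : numClosedFieldType) (V : vectType K) (weight : V -> nat -> K) (basis : nat -> V).
Hypothesis HW : weight_system weight basis.
Local Notation sgb := (@sgb K).
Local Notation T27 := (T27 weight).
Local Notation derivation := (derivation T27).
Local Notation extremal := (extremal T27).
Local Notation entry := (entry weight basis).
Let HT : sym_trilinear T27 := T27_sym HW.

Definition rootE i m : 'End(V) := sparse weight basis (root i m).

Lemma entry_meeting X i m : derivation X -> third i m != None -> entry X i m = 0.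
Proof.
move=> DX im; have [i27 m27] : (i < 27)%N /\ (m < 27)%N by apply: third_oversize; apply/eqP.
have : all27 (fun i => all27 (fun m => (third i m != None) ==> has (fun b =>
    if third i b is Some (c, _) then (third m b == None) && (third m c == None) else false) (iota 0 27))).
  by vm_compute.
move=> /all27P /(_ i i27) /all27P /(_ m m27); rewrite im => /hasP [b].
rewrite mem_iota => b27; case E: (third i b) => [[c e]|] // /andP [/eqP mb /eqP mc].
have [c27 _ _ _] := third_sym E.
have := derivation_entries HW DX m27 b27 c27; rewrite /third_entry mb mc (third_rot E) !addr0.
by move/eqP; rewrite mulf_eq0 (negPf (sgb_neq0 _ _)) => /eqP.
Qed.

Lemma entry_diag X a b c e : derivation X -> third a b = Some (c, e) ->
  entry X a a + entry X b b + entry X c c = 0.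
Proof.
move=> DX E; have [a27 b27] : (a < 27)%N /\ (b < 27)%N by apply: third_oversize; rewrite E.
have [c27 _ Eac _] := third_sym E.
have := derivation_entries HW DX a27 b27 c27; rewrite /third_entry E Eac (third_rot E).
rewrite -!mulrDr => /eqP.
by rewrite mulf_eq0 (negPf (sgb_neq0 _ _)) => /eqP.
Qed.

Lemma entry_root X i m t : derivation X -> skew i m -> (i < 27)%N -> (m < 27)%N ->
  t \in root i m -> entry X t.1.1 t.1.2 = sgb t.2 * entry X i m.
Proof.
move=> DX sk i27 m27 /(rootP _ i27 m27) [->|[b [e [e' [c27 H1 H2 H3]]]]]; first by rewrite mul1r.
have [b27 _ _ _] := third_sym H1.
have mc : third m t.1.2 = None.
  have : all27 (fun m => all27 (fun b => all27 (fun c => (third m b != None) && (third b c != None)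
     && (third b c != Some (m, false)) && (third b c != Some (m, true)) ==> (third m c == None)))).
    by vm_compute.
  move=> /all27P /(_ m m27) /all27P /(_ b b27) /all27P /(_ _ c27).
  have [_ _ H1' _] := third_sym H1; have [_ H1'' _ _] := third_sym H1'.
  have := third_rot (third_rot H1) => H1'''.
  have bc : third b t.1.2 = Some (i, e) by have [_ ->] := third_sym (third_rot H1).
  rewrite H2 bc /=.
  have im : i != m by case/andP: sk.
  by rewrite !(inj_eq Some_inj) !xpair_eqE (negPf im) /= => /eqP.
have bc : third b t.1.2 = Some (i, e) by have [_ ->] := third_sym (third_rot H1).
have := derivation_entries HW DX m27 b27 c27; rewrite /third_entry mc bc H2 addr0.
move/eqP; rewrite addr_eq0 => /eqP E.
rewrite -[LHS]mul1r -(sgb_sq K e') -mulrA; have -> : sgb e' * entry X t.1.1 t.1.2 = - (sgb e * entry X i m).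
  by rewrite E opprK.
by rewrite H3 sgb_neg sgb_addb; ring.
Qed.

Section Fixed.
Variables i m : nat.
Hypotheses (i27 : (i < 27)%N) (m27 : (m < 27)%N) (im : skew i m).

Lemma root_facts : root_check i m.
Proof. by have := all27P (all27P root_checked i27) m27; rewrite im. Qed.

Lemma root_range : in_range (root i m).
Proof. by case/andP: root_facts. Qed.

Lemma rootE_sq0 : (rootE i m \o rootE i m)%VF = 0.
Proof. by have /and3P [? ? _] := root_facts; exact: sparse_sq0. Qed.

Lemma rootE_derivation : derivation (rootE i m).
Proof.
have /and4P [? _ _ /andP [H _]] := root_facts; apply: sparse_derivation => // b c b27 c27.
exact: (all27P (all27P H b27) c27).
Qed.

Lemma rootE_basis q : (q < 27)%N -> skew i q ->
  rootE i m (basis q) = (q == m)%:R *: basis i.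
Proof.
move=> q27 iq; rewrite /rootE sparse_basis //; last exact: root_range.
have uL : uniq (root i m) by have /and3P [_ _ /andP []] := root_facts.
case: eqP => [->|qm].
- rewrite big_mkcond (bigD1_seq (i, m, false)) ?mem_root //= ?eqxx big1_seq ?addr0 ?scale1r //.
  move=> t /andP [tn /(rootP _ i27 m27) [E|[b [e [e' [_ H _ _]]]]]]; first by rewrite E eqxx in tn.
  by case: eqP => // tm; have := im; rewrite /skew -tm H andbF.
- rewrite scale0r big1_seq // => t /andP [/eqP tq /(rootP _ i27 m27) [E|[b [e [e' [_ H _ _]]]]]].
    by case: qm; rewrite -tq E.
  by move: iq; rewrite /skew -tq H andbF.
Qed.

Lemma rootE_sandwich X : derivation X ->
  (rootE i m \o X \o rootE i m)%VF = entry X m i *: rootE i m.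
Proof.
move=> DX; apply/lfunP => x; rewrite !comp_lfunE scale_lfunE.
have HL := root_range.
have /and5P [_ _ uL _ /andP [H4 H5]] := root_facts.
rewrite /rootE (sparseE HW (X _) HL) [in RHS](sparseE HW x HL) scaler_sumr.
apply: eq_big_seq => t tL; rewrite scalerA; congr (_ *: _).
have /andP [_ mt27] := allP HL _ tL.
rewrite (sparseE HW x HL) linear_sum (weight_sum HW) // (bigD1_seq t) //= [X in _ + X]big1_seq; last first.
  move=> t' /andP [nt t'L]; rewrite linearZ /= (weightZ HW) // -/(entry X t.1.2 t'.1.1).
  rewrite entry_meeting ?mulr0 //.
  by have := allP (allP H4 _ tL) _ t'L; rewrite eq_sym (negPf nt).
rewrite addr0 linearZ /= (weightZ HW) // -/(entry X t.1.2 t.1.1).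
rewrite (entry_root DX (skew_sym im) m27 i27 (allP H5 _ tL)) /=.
transitivity ((sgb t.2 * sgb t.2) * sgb t.2 * weight x t.1.2 * entry X m i); first by ring.
by rewrite sgb_sq; ring.
Qed.

Lemma rootE_extremal : extremal (rootE i m).
Proof.
split.
- exact: rootE_derivation.
- apply/eqP => E; have := rootE_basis m27 im; rewrite E lfunE eqxx scale1r => E'.
  have := weight_basis HW i i27; rewrite -E' (weight0 HW) // eqxx => /eqP.
  by rewrite eq_sym oner_eq0.
- exact: rootE_sq0.
- by move=> X DX; exists (entry X m i); exact: rootE_sandwich.
Qed.

Lemma rootE_neq0 : rootE i m != 0. Proof. by case: rootE_extremal. Qed.

Lemma rootE_detect X : derivation X -> entry X m i != 0 ->
  (rootE i m \o X \o rootE i m)%VF <> 0.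
Proof.
move=> DX X0; rewrite rootE_sandwich //; apply/eqP.
by rewrite scaler_eq0 negb_or X0 rootE_neq0.
Qed.

Lemma weight_rootE x n : (n < 27)%N -> third m n = None ->
  weight (rootE i m x) n = (n == i)%:R * weight x m.
Proof.
move=> n27 mn; rewrite /rootE (weight_sparse HW) //; last exact: root_range.
have uL : uniq (root i m) by have /and3P [_ _ /andP []] := root_facts.
rewrite big_mkcond (bigD1_seq (i, m, false)) ?mem_root //= big1_seq ?addr0; last first.
  move=> t /andP [tn /(rootP _ i27 m27) [E|[b [e [e' [_ _ H _]]]]]]; first by rewrite E eqxx in tn.
  case: eqP => // tE; rewrite tE in H; have [_ _ H' _] := third_sym H.
  by rewrite mn in H'.
by rewrite [n == i]eq_sym; case: eqP; rewrite ?mul0r.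
Qed.

End Fixed.
End RootElements.

Section Bfs.
Variables (T : eqType) (succs : T -> seq T).

Fixpoint bfs (n : nat) (rest front : seq T) : bool :=
  match n with
  | 0%N => nilp rest
  | n'.+1 => let sc := flatten [seq succs q | q <- front] in
      bfs n' [seq p <- rest | p \notin sc] [seq p <- rest | p \in sc]
  end.

Lemma bfsP (P : pred T) (R : T -> Prop) n rest front :
  (forall q p, P q -> P p -> p \in succs q -> R q -> R p) ->
  {subset rest <= P} -> {subset front <= P} -> bfs n rest front ->
  {in front, forall q, R q} -> {in rest, forall p, R p}.
Proof.
move=> HR; elim: n rest front => [|n IH] rest front Pr Pf /=.
  by move=> /nilP -> _ p.
move=> Hb Rf; set sc := flatten _ in Hb.
have Rsc : {in [seq p <- rest | p \in sc], forall p, R p}.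
  move=> p; rewrite mem_filter => /andP [/flatten_mapP [q qf pq] pr].
  exact: (HR q p (Pf _ qf) (Pr _ pr) pq (Rf _ qf)).
move=> p pr; case psc: (p \in sc); first by apply: Rsc; rewrite mem_filter psc.
apply: (IH _ _ _ _ Hb Rsc); last by rewrite mem_filter psc.
- by move=> q; rewrite mem_filter => /andP [_ /Pr].
- by move=> q; rewrite mem_filter => /andP [_ /Pr].
Qed.

End Bfs.

Definition pairs27 : seq (nat * nat) := [seq (i, m) | i <- iota 0 27, m <- iota 0 27].

Lemma mem_pairs27 i m : ((i, m) \in pairs27) = (i < 27)%N && (m < 27)%N.
Proof.
apply/allpairsP/andP => [[[a b] [H1 H2 [-> ->]]]|[i27 m27]].
  by move: H1 H2; rewrite !mem_iota.
by exists (i, m); rewrite !mem_iota.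
Qed.

Definition root_succs (P : pred (nat * nat)) (q : nat * nat) : seq (nat * nat) :=
  [seq (q.2, j) | j <- iota 0 27 & skew j q.2 && P (j, q.1)]
  ++ [seq (t.1.2, t.1.1) | t <- root q.1 q.2].

Definition root_connected (P : pred (nat * nat)) (q : nat * nat) : bool :=
  if P q then bfs (root_succs P) 6 [seq p <- pairs27 | P p] [:: q] else false.

Section RootConjugacy.
Variables (K : numClosedFieldType) (V : vectType K) (weight : V -> nat -> K) (basis : nat -> V).
Hypothesis HW : weight_system weight basis.
Local Notation sgb := (@sgb K).
Local Notation T27 := (T27 weight).
Local Notation cubic := (cubic weight).
Local Notation derivation := (derivation T27).
Local Notation extremal := (extremal T27).
Local Notation extremal_at := (extremal_at T27).
Local Notation entry := (entry weight basis).
Local Notation rootE := (rootE weight basis).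
Local Notation path_conj := (path_conj cubic).
Let HT : sym_trilinear T27 := T27_sym HW.
Let Tdet := @T27_det K V weight.

Lemma rootE_basisT i m : (i < 27)%N -> (m < 27)%N -> skew i m ->
  rootE i m (basis m) = basis i.
Proof. by move=> i27 m27 im; rewrite (rootE_basis HW) // eqxx scale1r. Qed.

Lemma entry_rootE i m t : (i < 27)%N -> (m < 27)%N -> skew i m -> t \in root i m ->
  entry (rootE i m) t.1.1 t.1.2 = sgb t.2.
Proof.
move=> i27 m27 im tL; rewrite (entry_root HW (rootE_derivation HW i27 m27 im) im) //.
by rewrite /entry rootE_basisT // (weight_basis HW) // eqxx mulr1.
Qed.

Lemma unipC (X : 'End(V)) x : unip (- X) x = x - X x.
Proof. by rewrite unipE opp_lfunE. Qed.

Definition diag_root i m : 'End(V) := (unip (- rootE i m) \o rootE m i \o unip (rootE i m))%VF.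

Lemma diag_root_extremal i m : (i < 27)%N -> (m < 27)%N -> skew i m -> extremal (diag_root i m).
Proof.
move=> i27 m27 im; have E2 := rootE_sq0 HW i27 m27 im.
have E2' : (- rootE i m \o - rootE i m)%VF = 0 by rewrite comp_lfunNl comp_lfunNr E2 !oppr0.
rewrite /diag_root -{2}[rootE i m]opprK -(unipV E2') -/(Ad _ _).
apply: (extremal_conj HT Tdet); last exact: (rootE_extremal HW m27 i27 (skew_sym im)).
apply: (unip_isometry HT Tdet) => //.
by rewrite -scaleN1r; apply: derivationZ => //; exact: rootE_derivation.
Qed.

Lemma diag_detect X i m : (i < 27)%N -> (m < 27)%N -> skew i m -> derivation X ->
  entry X i m = 0 -> entry X m i = 0 -> entry X i i != entry X m m ->
  (diag_root i m \o X \o diag_root i m)%VF <> 0.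
Proof.
move=> i27 m27 im DX Xim Xmi dim; set F := diag_root i m.
have mi := skew_sym im.
pose E := rootE i m; pose Y := (unip E \o X \o unip (- E))%VF.
have E2 : (E \o E)%VF = 0 by exact: rootE_sq0.
have E2' : (- E \o - E)%VF = 0 by rewrite comp_lfunNl comp_lfunNr E2 !oppr0.
have nE : (unip (- E) \o unip E)%VF = \1%VF by rewrite -{2}[E]opprK unipN.
have En : (unip E \o unip (- E))%VF = \1%VF by rewrite unipN.
have DY : derivation Y.
  rewrite /Y -(unipV E2); apply: (derivation_conj HT Tdet) => //.
  by apply: (unip_isometry HT Tdet) => //; exact: rootE_derivation.
have mi3 : third m i = None by case/andP: mi => _ /eqP.
have Yim : entry Y i m != 0.
  rewrite /entry /Y !comp_lfunE unipC rootE_basisT // linearB /= unipE linearB /=.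
  have wB x y n : (n < 27)%N -> weight (x - y) n = weight x n - weight y n.
    by move=> n27; rewrite -scaleN1r (weightD HW) // (weightZ HW) // mulN1r.
  rewrite (weightD HW) // !wB // !(weight_rootE HW) // eqxx !mul1r.
  rewrite -/(entry X i m) -/(entry X i i) -/(entry X m m) -/(entry X m i) Xim Xmi.
  by rewrite sub0r subr0 addrC subr_eq0 eq_sym.
have HY := rootE_detect HW m27 i27 mi DY Yim.
have FXF : (F \o X \o F)%VF = (unip (- E) \o (rootE m i \o Y \o rootE m i) \o unip E)%VF.
  by rewrite /F /diag_root /Y !comp_lfunA.
move=> F0; apply: HY.
have : (unip E \o (F \o X \o F) \o unip (- E))%VF = 0 by rewrite F0 comp_lfun0r comp_lfun0l.
rewrite FXF => <-.
by rewrite !comp_lfunA En comp_lfun1l -!comp_lfunA En comp_lfun1r.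
Qed.

Lemma entry_undetected X : derivation X ->
  (forall i m, (i < 27)%N -> (m < 27)%N -> skew i m -> entry X i m = 0) ->
  (forall i m, (i < 27)%N -> (m < 27)%N -> skew i m -> entry X i i = entry X m m) -> X = 0.
Proof.
move=> DX off diag; apply: (entry0_eq0 HW) => a b a27 b27.
have [<-|nab] := eqVneq a b; last first.
  have [ab|ab] := eqVneq (third a b) None; last exact: (entry_meeting HW).
  by apply: off => //; rewrite /skew nab ab eqxx.
have : all27 (fun a => has (fun b => if third a b is Some (c, e) then
    has (fun m => skew a m && skew b m) (iota 0 27) && has (fun m => skew a m && skew c m) (iota 0 27)
    else false) (iota 0 27)) by vm_compute.
move=> /all27P /(_ a a27) /hasP [b']; rewrite mem_iota => b'27.
case E: (third a b') => [[c e]|] //.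
have [c27 _ _ _] := third_sym E.
have eqd x y : (x < 27)%N -> (y < 27)%N ->
    has (fun m => skew x m && skew y m) (iota 0 27) -> entry X x x = entry X y y.
  move=> x27 y27 /hasP [k]; rewrite mem_iota => k27 /andP [xk yk].
  by rewrite (diag _ _ x27 k27 xk) (diag _ _ y27 k27 yk).
move=> /andP [/(eqd _ _ a27 b'27) Eb /(eqd _ _ a27 c27) Ec].
have := entry_diag HW DX E; rewrite -Eb -Ec => H.
by apply: (@mulfI _ 3%:R); rewrite ?pnatr_eq0 // mulr0 -H; ring.
Qed.

Lemma extremal_detect X : derivation X -> X != 0 ->
  exists F, extremal F /\ (F \o X \o F)%VF <> 0.
Proof.
move=> DX X0; apply: contrapT => nF.
have off i m : (i < 27)%N -> (m < 27)%N -> skew i m -> entry X i m = 0.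
  move=> i27 m27 im; apply/eqP; apply: contraT => Xim; case: nF.
  exists (rootE m i); split; first exact: (rootE_extremal HW m27 i27 (skew_sym im)).
  exact: (rootE_detect HW m27 i27 (skew_sym im) DX Xim).
case/eqP: X0; apply: (entry_undetected DX off) => i m i27 m27 im.
apply/eqP; apply: contraT => dim; case: nF.
exists (diag_root i m); split; first exact: diag_root_extremal.
exact: (diag_detect i27 m27 im DX (off _ _ i27 m27 im) (off _ _ m27 i27 (skew_sym im)) dim).
Qed.

Let detect0 := extremal_detect.

Section Connected.
Variables (w : V) (P : pred (nat * nat)).
Hypothesis Pskew : forall p, P p -> [/\ (p.1 < 27)%N, (p.2 < 27)%N & skew p.1 p.2].
Hypothesis Pw : forall p, P p -> rootE p.1 p.2 w = 0.

Lemma rootE_at p : P p -> extremal_at w (rootE p.1 p.2).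
Proof. by move=> Pp; have [? ? ?] := Pskew Pp; split; [exact: rootE_extremal|exact: Pw]. Qed.

Lemma root_succs_conj q p : P q -> P p -> p \in root_succs P q ->
  path_conj w (rootE q.1 q.2) (rootE p.1 p.2).
Proof.
case: q => i m; case: p => k l Pq Pp; have [i27 m27 im] := Pskew Pq.
rewrite /= in i27 m27 im *; rewrite mem_cat => /orP [].
- move=> /mapP [j]; rewrite mem_filter => /andP [/andP [/= jm Pji] _] [Ek El]; subst k l.
  have [j27 _ ji] := Pskew Pji; rewrite /= in j27 ji.
  have [Eji Ejiw] := rootE_at Pji; have [_ _ Eji2 _] := Eji.
  have EX : extremal_at w (unip (rootE j i) \o rootE i m \o unip (- rootE j i))%VF.
    rewrite -(unipV Eji2); apply: (extremal_at_conj HT Tdet (w := w)).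
    + by apply: (extremal_unip HT Tdet).
    + by rewrite unipE Ejiw addr0.
    + exact: (rootE_at Pq).
  apply: (path_conj_trans (path_conj_unip HT Tdet detect0 (rootE i m) (rootE_at Pji))).
  have mj := skew_sym jm.
  apply: (path_conj_detect HT Tdet detect0 (rootE_at Pp) EX).
  apply: (rootE_detect HW) => //; first by case: EX.1.
  rewrite /entry !comp_lfunE unipC (rootE_basis HW) //.
  have -> : (m == i) = false by case/andP: im => + _; rewrite eq_sym => /negPf.
  rewrite scale0r subr0 rootE_basisT // unipE rootE_basisT // (weightD HW) // !(weight_basis HW) // eqxx.
  by case/andP: ji => /negPf -> _; rewrite add0r oner_eq0.
- move=> /mapP [t tL [Ek El]]; subst k l; have [k27 l27 kl] := Pskew Pp.
  apply: (path_conj_detect HT Tdet detect0 (rootE_at Pp) (rootE_at Pq)).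
  apply: (rootE_detect HW) => //; first exact: rootE_derivation.
  by rewrite entry_rootE // sgb_neq0.
Qed.

Lemma diag_root_at i m : P (i, m) -> P (m, i) ->
  extremal_at w (diag_root i m) /\ path_conj w (diag_root i m) (rootE m i).
Proof.
move=> Pim Pmi; have [i27 m27 im] := Pskew Pim.
have Nim : extremal_at w (- rootE i m).
  by rewrite -scaleN1r; apply: (extremal_atZ HT); [rewrite oppr_eq0 oner_eq0|exact: (rootE_at Pim)].
split.
  split; first exact: diag_root_extremal.
  have := Pw Pim; have := Pw Pmi; rewrite /= /diag_root !comp_lfunE [unip (rootE i m) w]unipE => Emi Eim.
  by rewrite Eim addr0 Emi linear0.
apply: path_conj_sym; have := path_conj_unip HT Tdet detect0 (rootE m i) Nim.
by rewrite opprK.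
Qed.

Lemma root_connected_conj q : root_connected P q ->
  forall p, P p -> path_conj w (rootE p.1 p.2) (rootE q.1 q.2).
Proof.
rewrite /root_connected; case Pq: (P q) => // Hb p Pp; apply: path_conj_sym.
have H := @bfsP _ _ P (fun p => path_conj w (rootE q.1 q.2) (rootE p.1 p.2)) _ _ _ _ _ _ Hb.
apply: (H _ _ _ _ p).
- by move=> a b Pa Pb ab Ha; apply: (path_conj_trans Ha); exact: root_succs_conj.
- by move=> a; rewrite mem_filter => /andP [].
- by move=> a; rewrite inE => /eqP ->.
- by move=> a; rewrite inE => /eqP ->; exact: path_conj_refl.
- by have [p27 q27 _] := Pskew Pp; rewrite mem_filter Pp; case: p Pp p27 q27 => a b _ /= a27 b27; rewrite mem_pairs27 a27 b27.
Qed.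

End Connected.

Lemma hub_zero : hub cubic T27 0.
Proof.
pose P : pred (nat * nat) := fun p => [&& p.1 < 27, p.2 < 27 & skew p.1 p.2]%N.
have Pskew p : P p -> [/\ (p.1 < 27)%N, (p.2 < 27)%N & skew p.1 p.2] by case/and3P.
have Pw p : P p -> rootE p.1 p.2 0 = 0 by rewrite linear0.
have conn : root_connected P (0, 11)%N by vm_compute.
have conj := root_connected_conj Pskew Pw conn.
have EP i m : (i < 27)%N -> (m < 27)%N -> skew i m -> P (i, m).
  by move=> i27 m27 im; rewrite /P /= i27 m27 im.
have P0 : P (0, 11)%N by move: conn; rewrite /root_connected; case: (P (0, 11)%N).
exists (rootE 0%N 11%N); split; first exact: (rootE_at Pskew Pw P0).
move=> X DX _ X0; apply: contrapT => nF.
have off i m : (i < 27)%N -> (m < 27)%N -> skew i m -> entry X i m = 0.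
  move=> i27 m27 im; apply/eqP; apply: contraT => Xim; case: nF.
  have Pmi : P (m, i) := EP _ _ m27 i27 (skew_sym im).
  exists (rootE m i); split; first exact: (rootE_at Pskew Pw Pmi).
    exact: (rootE_detect HW m27 i27 (skew_sym im) DX Xim).
  exact: (conj _ Pmi).
case/eqP: X0; apply: (entry_undetected DX off) => i m i27 m27 im.
apply/eqP; apply: contraT => dim; case: nF.
have Pmi : P (m, i) := EP _ _ m27 i27 (skew_sym im).
have Pim := EP _ _ i27 m27 im.
have [dw dc] := diag_root_at Pskew Pw Pim Pmi.
exists (diag_root i m); split; [exact: dw| |exact: (path_conj_trans dc (conj _ Pmi))].
exact: (diag_detect i27 m27 im DX (off _ _ i27 m27 im) (off _ _ m27 i27 (skew_sym im)) dim).
Qed.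

End RootConjugacy.

Definition block (tl : seq nat) (x i : nat) : bool := (third x i != None) && (i \notin tl).

(* For a triad tl, the pairs of the 24 roots of D4, the root elements killing the three
   weight vectors of tl. *)
Definition d4_pair (tl : seq nat) (p : nat * nat) : bool :=
  if has (fun x => block tl x p.1 && block tl x p.2) tl
  then [&& p.1 < 27, p.2 < 27 & skew p.1 p.2]%N else false.

Definition sources (i m q : nat) : seq (nat * nat * bool) := [seq t <- root i m | t.1.2 == q].

Definition side_ok (tl : seq nat) (x r j y m mb : nat) (e : bool) : bool :=
  [&& [&& m < 27, mb < 27, y < 27 & y \in tl]%N, [&& skew m x, skew m y, x != y, x != r & y != r],
      [&& d4_pair tl (j, mb), d4_pair tl (mb, j), d4_pair tl (j, m) & third j r != None],
      [&& third x j == None, third y j == None & j != m],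
      [&& sources m x y == [::], sources m x r == [::], sources m x m == [::] &
          sources m x mb == [:: (y, mb, e)]] &
      [&& sources m y x == [::], sources m y r == [::] & sources m y mb == [:: (x, mb, e)]]].

(* The checks are evaluated by vm_compute, for which && and || are strict, whence the
   conditionals. *)
Definition side_check (tl : seq nat) (x r j : nat) : bool :=
  if third x r is Some (y, _) then
    let m := head 0 [seq m <- iota 0 27 | if block tl r m then d4_pair tl (j, m) else false]%N in
    if third r m is Some (mb, _) then
      side_ok tl x r j y m mb (head (0, 0, false)%N (sources m x mb)).2
    else false
  else false.

Definition triad_check (t : nat * nat * nat * bool) : bool :=
  let tl := [:: t.1.1.1; t.1.1.2; t.1.2] in
  let d4 := [seq p <- pairs27 | d4_pair tl p] in
  [&& uniq tl && all (fun x => all (fun y => (x == y) || (third x y != None)) tl) tl && all (fun x => x < 27)%N tl,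
      all (fun p => (d4_pair tl (p.2, p.1)) && all (fun x => sources p.1 p.2 x == [::]) tl) d4,
      root_connected (d4_pair tl) (head (0, 0)%N d4),
      all (fun p => if skew p.1 p.2 then has (fun s => d4_pair tl s.1 ||
         ((s.1.2 \in tl) && has (fun r => (r != s.1.2) && block tl r s.1.1) tl)) (root p.1 p.2) else true) pairs27,
      all (fun x => all (fun r => if x == r then true else
         all27 (fun j => if block tl r j then side_check tl x r j else true)) tl) tl &
      all27 (fun a => (a \in tl) || has (fun x => if third x a is Some (b, _) then
         has (fun m => d4_pair tl (a, m) && d4_pair tl (b, m)) (iota 0 27) else false) tl)].

Lemma triads_checked : all triad_check triads.
Proof. by vm_compute. Qed.

Section HubTriad.
Variables (K : numClosedFieldType) (V : vectType K) (weight : V -> nat -> K) (basis : nat -> V).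
Hypothesis HW : weight_system weight basis.
Local Notation sgb := (@sgb K).
Local Notation T27 := (T27 weight).
Local Notation cubic := (cubic weight).
Local Notation derivation := (derivation T27).
Local Notation extremal := (extremal T27).
Local Notation extremal_at := (extremal_at T27).
Local Notation entry := (entry weight basis).
Local Notation rootE := (rootE weight basis).
Local Notation path_conj := (path_conj cubic).
Let HT : sym_trilinear T27 := T27_sym HW.
Let Tdet := @T27_det K V weight.
Let detect0 := extremal_detect HW.

Lemma rootE_sources i m q : (i < 27)%N -> (m < 27)%N -> skew i m ->
  rootE i m (basis q) = \sum_(t <- sources i m q) sgb t.2 *: basis t.1.1.
Proof.
by move=> i27 m27 im; rewrite /rootE (sparse_basis HW) ?big_filter //; exact: root_range.
Qed.

Variable t0 : nat * nat * nat * bool.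
Hypothesis t0_triad : t0 \in triads.
Let tl := [:: t0.1.1.1; t0.1.1.2; t0.1.2].
Variable w : V.
Hypothesis w_off : forall n, (n < 27)%N -> n \notin tl -> weight w n = 0.
Hypothesis w_on : forall x, x \in tl -> weight w x != 0.

Let check : triad_check t0 := allP triads_checked _ t0_triad.

Lemma triad_uniq : uniq tl. Proof. by case/andP: check => /andP [/andP []]. Qed.

Lemma triad_lt x : x \in tl -> (x < 27)%N.
Proof. by case/andP: check => /andP [_ /allP H] _; exact: H. Qed.

Lemma triad_expand : w = \sum_(x <- tl) weight w x *: basis x.
Proof.
apply: (weight_ext HW) => n n27; rewrite (weight_sum HW) //.
have [ntl|ntl] := boolP (n \in tl); last first.
  rewrite w_off // big1_seq // => x /andP [_ xl]; rewrite (weightZ HW) // (weight_basis HW) //.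
  by case: eqP => [E|]; [rewrite E xl in ntl|rewrite mulr0].
rewrite (bigD1_seq n) ?triad_uniq //= (weightZ HW) // (weight_basis HW) // eqxx mulr1.
rewrite big1_seq ?addr0 // => x /andP [nx xl]; rewrite (weightZ HW) // (weight_basis HW) //.
by rewrite eq_sym (negPf nx) mulr0.
Qed.

Lemma d4P p : d4_pair tl p -> [/\ (p.1 < 27)%N, (p.2 < 27)%N & skew p.1 p.2].
Proof. by rewrite /d4_pair; case: ifP => // _ /and3P. Qed.

Lemma d4_mem p : d4_pair tl p -> p \in [seq p <- pairs27 | d4_pair tl p].
Proof.
by move=> Pp; rewrite mem_filter Pp; have [p1 p2 _] := d4P Pp; case: p Pp p1 p2 => a b _ /= p1 p2; rewrite mem_pairs27 p1 p2.
Qed.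

Lemma d4_sym i m : d4_pair tl (i, m) -> d4_pair tl (m, i).
Proof. by case/and3P: check => _ /allP H _ /d4_mem /H /andP []. Qed.

Lemma d4_kill p : d4_pair tl p -> rootE p.1 p.2 w = 0.
Proof.
move=> Pp; have [p1 p2 ps] := d4P Pp.
case/and3P: check => _ /allP H _; have /andP [_ /allP Hp] := H _ (d4_mem Pp).
rewrite triad_expand linear_sum big1_seq // => x /andP [_ xl].
by rewrite linearZ /= rootE_sources // (eqP (Hp x xl)) big_nil scaler0.
Qed.

Section Side.
Variables (X : 'End(V)) (x r j y m mb : nat) (e : bool).
Hypotheses (DX : derivation X) (Xw : X w = 0).
Hypothesis Xd4 : forall p, d4_pair tl p -> entry X p.1 p.2 = 0.
Hypotheses (xl : x \in tl) (rl : r \in tl) (j27 : (j < 27)%N).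
Hypothesis ok : side_ok tl x r j y m mb e.

Let c := weight w x / weight w y.
Let E1 := rootE m x.
Let E2 := rootE m y.

Let g (s : K) : 'End(V) := (unip (s *: E1) \o unip (s *: (- c *: E2)))%VF.
Let gi (s : K) : 'End(V) := (unip (s *: (c *: E2)) \o unip (s *: - E1))%VF.

Let m27 : (m < 27)%N. Proof. by case/andP: ok => /and4P []. Qed.
Let mb27 : (mb < 27)%N. Proof. by case/andP: ok => /and4P []. Qed.
Let y27 : (y < 27)%N. Proof. by case/andP: ok => /and4P []. Qed.
Let yl : y \in tl. Proof. by case/andP: ok => /and4P []. Qed.
Let x27 : (x < 27)%N := triad_lt xl.
Let mx : skew m x. Proof. by case/and3P: ok => _ /and5P []. Qed.
Let my : skew m y. Proof. by case/and3P: ok => _ /and5P []. Qed.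
Let xy : x != y. Proof. by case/and3P: ok => _ /and5P []. Qed.
Let xr : x != r. Proof. by case/and3P: ok => _ /and5P []. Qed.
Let yr : y != r. Proof. by case/and3P: ok => _ /and5P []. Qed.
Let Djmb : d4_pair tl (j, mb). Proof. by case/and4P: ok => _ _ /and4P []. Qed.
Let Djm : d4_pair tl (j, m). Proof. by case/and4P: ok => _ _ /and4P []. Qed.
Let jr : third j r != None. Proof. by case/and4P: ok => _ _ /and4P []. Qed.
Let xj : third x j = None. Proof. by case/and5P: ok => _ _ _ /and3P [/eqP]. Qed.
Let yj : third y j = None. Proof. by case/and5P: ok => _ _ _ /and3P [_ /eqP]. Qed.
Let jm : j != m. Proof. by case/and5P: ok => _ _ _ /and3P []. Qed.

Let E1x : E1 (basis x) = basis m. Proof. by rewrite /E1 rootE_basisT. Qed.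
Let E2y : E2 (basis y) = basis m. Proof. by rewrite /E2 rootE_basisT. Qed.

Let s1 : [/\ E1 (basis y) = 0, E1 (basis r) = 0, E1 (basis m) = 0 & E1 (basis mb) = sgb e *: basis y].
Proof.
case/and5P: ok => _ _ _ _ /andP [/and4P [/eqP H1 /eqP H2 /eqP H3 /eqP H4] _].
by rewrite /E1 !rootE_sources // H1 H2 H3 H4 !big_nil big_seq1.
Qed.

Let s2 : [/\ E2 (basis x) = 0, E2 (basis r) = 0 & E2 (basis mb) = sgb e *: basis x].
Proof.
case/and5P: ok => _ _ _ _ /andP [_ /and3P [/eqP H1 /eqP H2 /eqP H3]].
by rewrite /E2 !rootE_sources // H1 H2 H3 !big_nil big_seq1.
Qed.

Let w_sum : w = weight w x *: basis x + weight w y *: basis y + weight w r *: basis r.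
Proof.
have perm : perm_eq tl [:: x; y; r].
  have U : uniq [:: x; y; r] by rewrite /= !inE negb_or xy xr yr.
  have S : {subset [:: x; y; r] <= tl}.
    move=> z; rewrite inE => /orP [/eqP ->//|]; rewrite inE => /orP [/eqP ->//|].
    by rewrite inE => /eqP ->.
  have [_ E] := uniq_min_size U S (leqnn 3).
  by rewrite perm_sym uniq_perm ?triad_uniq.
by rewrite {1}triad_expand (perm_big _ perm) !big_cons big_nil /= addr0 addrA.
Qed.

Let E1w : E1 w = weight w x *: basis m.
Proof. by have [a b _ _] := s1; rewrite {1}w_sum !linearD !linearZ /= E1x a b !scaler0 !addr0. Qed.

Let E2w : E2 w = weight w y *: basis m.
Proof. by have [a b _] := s2; rewrite {1}w_sum !linearD !linearZ /= E2y a b !scaler0 add0r addr0. Qed.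

Let E1_sq0 : (E1 \o E1)%VF = 0. Proof. exact: rootE_sq0. Qed.
Let E2_sq0 : (E2 \o E2)%VF = 0. Proof. exact: rootE_sq0. Qed.

Let g_gi s : (g s \o gi s)%VF = \1%VF.
Proof.
have sq0 a F : (F \o F)%VF = 0 -> ((a *: F) \o (a *: F))%VF = 0 :> 'End(V).
  by move=> F0; rewrite -comp_lfunZl -comp_lfunZr F0 !scaler0.
have -> : gi s = (unip (- (s *: (- c *: E2))) \o unip (- (s *: E1)))%VF.
  by rewrite /gi !scalerA mulrN scaleNr opprK scalerN.
rewrite /g comp_lfunA -[(_ \o unip (- (s *: (- c *: E2))))%VF]comp_lfunA unipN.
  by rewrite comp_lfun1r unipN //; exact: sq0.
by apply/sq0/sq0.
Qed.

Let g_w s : g s w = w.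
Proof.
have [_ _ E1m _] := s1.
rewrite /g comp_lfunE [unip (s *: (- c *: E2)) w]unipE !scale_lfunE E2w unipE linearD /=.
rewrite !scale_lfunE E1w !linearZ /= E1m !scaler0 addr0 -addrA -[RHS]addr0; congr (_ + _).
rewrite !scalerA -scalerDl [X in X *: _](_ : _ = 0) ?scale0r //.
by rewrite /c; field; exact: w_on.
Qed.

Let conj_entry : weight (gi 1 (X (g 1 (basis mb)))) j = - 2%:R * c * sgb e * entry X j x.
Proof.
have [E1y _ _ E1mb] := s1; have [_ _ E2mb] := s2.
have gmb : g 1 (basis mb) = basis mb + sgb e *: basis y + (- c * sgb e) *: basis x + (- c * sgb e) *: basis m.
  rewrite /g !scale1r comp_lfunE [unip (- c *: E2) _]unipE scale_lfunE E2mb scalerA unipE linearD linearZ /=.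
  by rewrite E1mb E1x addrACA !addrA.
have gij v : weight (gi 1 v) j = weight v j.
  have nm : (j == m) = false by exact: negPf.
  have E1j u : weight (E1 u) j = 0 by rewrite /E1 (weight_rootE HW) // nm mul0r.
  have E2j u : weight (E2 u) j = 0 by rewrite /E2 (weight_rootE HW) // nm mul0r.
  rewrite /gi !scale1r comp_lfunE unipE (weightD HW) // scale_lfunE (weightZ HW) // E2j mulr0 addr0.
  by rewrite unipE (weightD HW) // opp_lfunE -scaleN1r (weightZ HW) // E1j mulr0 addr0.
rewrite gij gmb !linearD !linearZ /= !(weightD HW) // !(weightZ HW) //.
rewrite -!/(entry X j _) (Xd4 Djmb) (Xd4 Djm).
have row : weight w x * entry X j x + weight w y * entry X j y = 0.
  have := weight0 HW j27; rewrite -[in LHS]Xw {1}w_sum !linearD !linearZ /= !(weightD HW) // !(weightZ HW) //.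
  by rewrite -!/(entry X j _) (entry_meeting HW DX jr) mulr0 addr0.
have -> : entry X j y = - c * entry X j x.
  have wy := w_on yl; apply: (mulfI wy); apply/eqP; rewrite -subr_eq0 -row; apply/eqP.
  by rewrite /c; field.
by rewrite /=; ring.
Qed.

Lemma side_detect : entry X j x != 0 ->
  exists F, [/\ extremal_at w F, (F \o X \o F)%VF <> 0 & path_conj w F (rootE mb j)].
Proof.
move=> Xjx; have Dmbj := d4_sym Djmb; have [_ _ mbj] := d4P Dmbj.
have ext1 : extremal E1 by exact: (rootE_extremal HW).
have ext2 : extremal E2 by exact: (rootE_extremal HW).
have Sg s : derived_group (isometry cubic) (g s).
  by apply: derived_comp; rewrite ?scalerA; exact: (extremal_derived HT Tdet detect0).
have Ig := derived_isometry (Sg 1).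
have [_ lgi gig gV] := lfun_invl (g_gi 1).
have [_ _ _ giV] := lfun_invl gig.
have DY : derivation (gi 1 \o X \o g 1)%VF.
  rewrite -giV -/(Ad _ _); apply: (derivation_conj HT Tdet) => //.
  by rewrite -gV; exact: isometry_inv.
have Y0 : entry (gi 1 \o X \o g 1)%VF j mb != 0.
  rewrite /entry (comp_lfunE _ (g 1)) (comp_lfunE (gi 1) X) conj_entry.
  by rewrite !mulf_neq0 ?oppr_eq0 ?pnatr_eq0 ?sgb_neq0 ?invr_eq0 ?w_on.
exists (g 1 \o rootE mb j \o gi 1)%VF; split.
- rewrite -gV -/(Ad _ _); apply: (extremal_at_conj HT Tdet Ig (g_w 1)).
  by split; [exact: (rootE_extremal HW mb27 j27 mbj)|exact: (d4_kill Dmbj)].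
- move=> F0; apply: (rootE_detect HW mb27 j27 mbj DY Y0).
  have key (G Gi E : 'End(V)) : (Gi \o G)%VF = \1%VF ->
      (E \o (Gi \o X \o G) \o E)%VF = (Gi \o ((G \o E \o Gi) \o X \o (G \o E \o Gi)) \o G)%VF.
    by move=> GG; rewrite !comp_lfunA GG comp_lfun1l -!comp_lfunA GG comp_lfun1r.
  by rewrite (key _ _ _ gig) F0 comp_lfun0r comp_lfun0l.
- apply: path_conj_sym; exists g, gi, 1; split.
  + by apply: polycurve_comp; exact: polycurve_unip.
  + by apply: polycurve_comp; exact: polycurve_unip.
  + by rewrite /g !scale0r /unip !addr0 comp_lfun1l.
  + by move=> s; split.
  + by rewrite oner_eq0 scale1r.
Qed.

End Side.

Lemma side_entry X x r j : derivation X -> X w = 0 ->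
  (forall p, d4_pair tl p -> entry X p.1 p.2 = 0) ->
  x \in tl -> r \in tl -> x != r -> (j < 27)%N -> block tl r j -> entry X j x != 0 ->
  exists F i m, [/\ extremal_at w F, (F \o X \o F)%VF <> 0, d4_pair tl (i, m) & path_conj w F (rootE i m)].
Proof.
move=> DX Xw Xd4 xl rl xr j27 rj Xjx.
case/and5P: check => _ _ _ _ /andP [/allP H _].
have Hx := H x xl; have := allP Hx r rl; rewrite (negPf xr) => /all27P /(_ j j27); rewrite rj /side_check.
case E: (third x r) => [[y s]|] //; set m := head _ _.
case E': (third r m) => [[mb s']|] // ok.
have [F [H1 H2 H3]] := side_detect DX Xw Xd4 xl rl j27 ok Xjx.
exists F, mb, j; split=> //; apply: d4_sym.
by case/and4P: ok => _ _ /and4P [].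
Qed.

Lemma hub_triad : hub cubic T27 w.
Proof.
case/and5P: (check) => _ _ conn /allP rel /andP [_ diag].
set q0 := head _ _ in conn.
have conj := root_connected_conj HW d4P d4_kill conn.
have Pq0 : d4_pair tl q0 by move: conn; rewrite /root_connected; case: (d4_pair tl q0).
exists (rootE q0.1 q0.2); split; first exact: (rootE_at HW d4P d4_kill Pq0).
move=> X DX Xw X0; apply: contrapT => nF.
have Xd4 p : d4_pair tl p -> entry X p.1 p.2 = 0.
  case: p => i m Pim; apply/eqP; apply: contraT => Xim; case: nF.
  have Pmi := d4_sym Pim; have [m27 i27 mi] := d4P Pmi; have [_ _ im] := d4P Pim.
  exists (rootE m i); split; [exact: (rootE_at HW d4P d4_kill Pmi)| |exact: (conj _ Pmi)].
  exact: (rootE_detect HW m27 i27 mi DX Xim).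
have side x r j : x \in tl -> r \in tl -> x != r -> (j < 27)%N -> block tl r j -> entry X j x = 0.
  move=> xl rl xr j27 rj; apply/eqP; apply: contraT => Xjx; case: nF.
  have [F [i [m [H1 H2 H3 H4]]]] := side_entry DX Xw Xd4 xl rl xr j27 rj Xjx.
  by exists F; split=> //; exact: (path_conj_trans H4 (conj _ H3)).
have off a b : (a < 27)%N -> (b < 27)%N -> a != b -> entry X a b = 0.
  move=> a27 b27 ab; have [tab|tab] := eqVneq (third a b) None; last exact: (entry_meeting HW DX tab).
  have sab : skew a b by rewrite /skew ab tab.
  have abm : (a, b) \in pairs27 by rewrite mem_pairs27 a27 b27.
  have := rel _ abm; rewrite sab => /hasP [s sL Hs].
  have Es := entry_root HW DX sab a27 b27 sL.
  have Es0 : entry X s.1.1 s.1.2 = 0.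
    case/orP: Hs => [/Xd4 //|/andP [sl /hasP [r rl /andP [rs rb]]]].
    apply: (side _ r) => //; first by rewrite eq_sym.
    by case/andP: rb => /eqP /third_oversize [].
  by move: Es; rewrite Es0 => /esym/eqP; rewrite mulf_eq0 (negPf (sgb_neq0 _ _)) => /eqP.
have dtl x : x \in tl -> entry X x x = 0.
  move=> xl; have x27 := triad_lt xl.
  have := weight0 HW x27; rewrite -Xw (entry_expand HW) // (bigD1 (Ordinal x27)) //= big1 ?addr0.
    by move/eqP; rewrite mulf_eq0 (negPf (w_on xl)) orbF => /eqP.
  move=> b nb; rewrite off ?mul0r //.
  by apply: contra nb => /eqP E; apply/eqP/val_inj.
have dd i m : d4_pair tl (i, m) -> entry X i i = entry X m m.
  move=> Pim; have Pmi := d4_sym Pim; have [i27 m27 im] := d4P Pim.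
  apply/eqP; apply: contraT => dim; case: nF.
  have [dw dc] := diag_root_at HW d4P d4_kill Pim Pmi.
  exists (diag_root weight basis i m); split; [exact: dw| |exact: (path_conj_trans dc (conj _ Pmi))].
  exact: (diag_detect HW i27 m27 im DX (Xd4 _ Pim) (Xd4 _ Pmi) dim).
case/eqP: X0; apply: (entry0_eq0 HW) => a b a27 b27.
have [<-{b b27}|ab] := eqVneq a b; last exact: off.
have [atl|natl] := boolP (a \in tl); first exact: dtl.
have := all27P diag a27; rewrite -/tl (negPf natl) orFb => /hasP [x xl].
case E: (third x a) => [[b s]|] // /hasP [m _ /andP [/dd am /dd bm]].
have := entry_diag HW DX E; rewrite (dtl _ xl) add0r bm -am => H.
by apply: (@mulfI _ 2%:R); rewrite ?pnatr_eq0 // mulr0 -H; ring.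
Qed.

End HubTriad.

Lemma third_irr a : third a a = None.
Proof. by case E: (third a a) => [[b e]|] //; have [_ _ _] := third_sym E; rewrite eqxx. Qed.

Definition clear_check (i a b m : nat) : bool :=
  skew m a && all (fun t => [|| t == (m, a, false), t.1.1 == b | skew i t.1.2]) (root m a).

Lemma clear_checked i a b e m : third i a = Some (b, e) -> third i m != None ->
  m != a -> m != b -> clear_check i a b m.
Proof.
move=> E im ma mb; have [i27 a27] : (i < 27)%N /\ (a < 27)%N by apply: third_oversize; rewrite E.
have [_ m27] : (i < 27)%N /\ (m < 27)%N by apply: third_oversize; apply/eqP.
have : all27 (fun i => all27 (fun a => if third i a is Some (b, _) then
    all27 (fun m => if (third i m == None) || (m == a) || (m == b) then true else clear_check i a b m)
  else true)) by vm_compute.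
move=> H; have := all27P (all27P H i27) a27; rewrite E => /all27P /(_ m m27).
by rewrite (negPf im) (negPf ma) (negPf mb).
Qed.

Section HubGeneral.
Variables (K : numClosedFieldType) (V : vectType K) (weight : V -> nat -> K) (basis : nat -> V).
Hypothesis HW : weight_system weight basis.
Local Notation sgb := (@sgb K).
Local Notation T27 := (T27 weight).
Local Notation cubic := (cubic weight).
Local Notation rootE := (rootE weight basis).
Local Notation S := (derived_group (isometry cubic)).
Let HT : sym_trilinear T27 := T27_sym HW.
Let Tdet := @T27_det K V weight.
Let detect0 := extremal_detect HW.

Lemma cubic_neq0 x : cubic x != 0 ->
  exists t, [/\ t \in triads, weight x t.1.1.1 != 0, weight x t.1.1.2 != 0 & weight x t.1.2 != 0].
Proof.
apply: contra_neqP => nt; rewrite /cubic big1_seq // => t /andP [_ tt].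
have [->|n1] := eqVneq (weight x t.1.1.1) 0; first by rewrite mulr0 !mul0r.
have [->|n2] := eqVneq (weight x t.1.1.2) 0; first by rewrite mulr0 !mul0r.
have [->|n3] := eqVneq (weight x t.1.2) 0; first by rewrite mulr0.
by case: nt; exists t.
Qed.

Lemma triads_lt t : t \in triads ->
  [&& t.1.1.1 < 27, t.1.1.2 < 27 & t.1.2 < 27]%N && uniq [:: t.1.1.1; t.1.1.2; t.1.2].
Proof.
have : all (fun t : nat * nat * nat * bool => [&& t.1.1.1 < 27, t.1.1.2 < 27 & t.1.2 < 27]%N
  && uniq [:: t.1.1.1; t.1.1.2; t.1.2]) triads by vm_compute.
by move=> /allP H /H.
Qed.

Lemma unip_rootE_derived i m s : (i < 27)%N -> (m < 27)%N -> skew i m -> S (unip (s *: rootE i m)).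
Proof. by move=> i27 m27 im; exact: (extremal_derived HT Tdet detect0 _ (rootE_extremal HW i27 m27 im)). Qed.

Lemma weight_unip s (F : 'End(V)) x n : (n < 27)%N ->
  weight (unip (s *: F) x) n = weight x n + s * weight (F x) n.
Proof. by move=> n27; rewrite unipE scale_lfunE (weightD HW) // (weightZ HW). Qed.

Lemma clear_skew w i (ms : seq nat) : (i < 27)%N -> weight w i != 0 ->
  (forall m, m \in ms -> (m < 27)%N /\ skew m i) ->
  exists h, [/\ S h, weight (h w) i != 0 & forall m, m \in ms -> weight (h w) m = 0].
Proof.
move=> i27 wi; elim: ms => [|m ms IH] Hms.
  by exists \1%VF; split=> //; [exact: derived_1|rewrite id_lfunE].
have [|h [Sh hi hms]] := IH; first by move=> k kms; apply: Hms; rewrite in_cons kms orbT.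
have [m27 mi] := Hms m (mem_head _ _).
pose s := - (weight (h w) m / weight (h w) i).
exists (unip (s *: rootE m i) \o h)%VF; split.
- by apply: derived_comp => //; exact: unip_rootE_derived.
- rewrite comp_lfunE weight_unip // (weight_rootE HW) ?third_irr //.
  by have /andP [/negPf] := mi; rewrite eq_sym => -> _; rewrite mul0r mulr0 addr0.
- move=> k; rewrite in_cons comp_lfunE => /orP [/eqP ->|kms].
    have im3 : third i m = None by case/andP: (skew_sym mi) => _ /eqP.
    rewrite weight_unip // (weight_rootE HW) // eqxx mul1r /s; field; exact: hi.
  have [k27 ki] : (k < 27)%N /\ skew k i by apply: Hms; rewrite in_cons kms orbT.
  have ik3 : third i k = None by case/andP: (skew_sym ki) => _ /eqP.
  rewrite weight_unip // (weight_rootE HW) // hms // add0r.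
  case: eqP => [km|]; last by rewrite mul0r mulr0.
  by rewrite /s -km hms // mul0r oppr0 mul0r.
Qed.

Lemma clear_meeting w i a b e (ms : seq nat) : third i a = Some (b, e) -> weight w i != 0 -> weight w a != 0 ->
  (forall n, (n < 27)%N -> skew i n -> weight w n = 0) ->
  (forall m, m \in ms -> [/\ third i m != None, m != a & m != b]) ->
  exists h, [/\ S h, weight (h w) i != 0, weight (h w) a != 0,
    forall n, (n < 27)%N -> skew i n -> weight (h w) n = 0 &
    forall m, m \in ms -> weight (h w) m = 0].
Proof.
move=> E wi wa wskew; have [i27 a27] : (i < 27)%N /\ (a < 27)%N by apply: third_oversize; rewrite E.
have [b27 _ E' ia] := third_sym E; have [_ _ _ ib] := third_sym E'.
have ab : a != b by have [_ _ _] := third_sym (third_rot E).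
elim: ms => [|m ms IH] Hms.
  by exists \1%VF; split=> //; rewrite ?id_lfunE //; exact: derived_1.
have [|h [Sh hi ha hskew hms]] := IH; first by move=> k kms; apply: Hms; rewrite in_cons kms orbT.
have [im ma mb] := Hms m (mem_head _ _).
have [_ m27] : (i < 27)%N /\ (m < 27)%N by apply: third_oversize; apply/eqP.
have /andP [sma /allP Hroot] := clear_checked E im ma mb.
pose s := - (weight (h w) m / weight (h w) a).
have Eoff n : (n < 27)%N -> n != b -> weight (rootE m a (h w)) n = (n == m)%:R * weight (h w) a.
  move=> n27 nb; rewrite /rootE (weight_sparse HW) //; last exact: (root_range m27 a27 sma).
  have uL : uniq (root m a) by have /and3P [_ _ /andP []] := root_facts m27 a27 sma.
  rewrite big_mkcond (bigD1_seq (m, a, false)) ?mem_root //= big1_seq ?addr0; last first.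
    move=> t /andP [tn tL]; case: eqP => // tnE.
    have := Hroot _ tL; rewrite (negPf tn) tnE (negPf nb) /= => st.
    by rewrite hskew ?mulr0 //; case/andP: (allP (root_range m27 a27 sma) _ tL).
  by rewrite [n == m]eq_sym; case: eqP; rewrite ?mul0r // /sgb.
have keep n : (n < 27)%N -> n != b -> n != m ->
    weight ((unip (s *: rootE m a) \o h)%VF w) n = weight (h w) n.
  by move=> n27 nb nm; rewrite comp_lfunE weight_unip // Eoff // (negPf nm) mul0r mulr0 addr0.
have i_neq_m : i != m by apply: contraNneq im => ->; rewrite third_irr.
exists (unip (s *: rootE m a) \o h)%VF; split.
- by apply: derived_comp => //; exact: unip_rootE_derived.
- by rewrite keep.
- by rewrite keep // eq_sym.
- move=> n n27 sn; rewrite keep ?hskew //.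
  + by apply: contraTneq sn => ->; rewrite /skew E' andbF.
  + by apply: contraTneq sn => ->; rewrite /skew (negPf im) andbF.
- move=> k; rewrite in_cons => /orP [/eqP ->|kms].
    by rewrite comp_lfunE weight_unip // Eoff // eqxx mul1r /s; field; exact: ha.
  have [km|km] := eqVneq k m.
    rewrite km comp_lfunE weight_unip // Eoff // eqxx mul1r /s -km hms //.
    by rewrite mul0r oppr0 mul0r addr0.
  have [ik ka kb] : [/\ third i k != None, k != a & k != b] by apply: Hms; rewrite in_cons kms orbT.
  have [_ k27] : (i < 27)%N /\ (k < 27)%N by apply: third_oversize; apply/eqP.
  by rewrite keep // hms.
Qed.

Lemma hub_nonzero w : cubic w != 0 -> hub cubic T27 w.
Proof.
have tr h x : S h -> hub cubic T27 (h x) -> hub cubic T27 x.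
  by move=> Sh; exact: (hub_transport HT Tdet Sh).
have det h x : S h -> cubic (h x) = cubic x by move=> /derived_isometry [_].
move=> dw; have [i [i27 t1]] : exists i, (i < 27)%N /\ weight w i != 0.
  have [t [tt t1 _ _]] := cubic_neq0 dw; exists t.1.1.1; split=> //.
  by case/andP: (triads_lt tt) => /and3P [].
have [|h [Sh hi hs]] := @clear_skew w i [seq m <- iota 0 27 | skew m i] i27 t1.
  by move=> m; rewrite mem_filter mem_iota => /andP [? ?].
apply: (tr h) => //; rewrite -(det h) // in dw; move: (h w) dw hi hs => {t1 h Sh w} w dw wi ws.
have wskew n : (n < 27)%N -> skew i n -> weight w n = 0.
  by move=> n27 ni; apply: ws; rewrite mem_filter mem_iota n27 (skew_sym ni).
have [a [wa ai a27]] : exists a, [/\ weight w a != 0, a != i & (a < 27)%N].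
  have [t [tt n1 n2 _]] := cubic_neq0 dw; have /andP [/and3P [l1 l2 _] /= /and3P [u _ _]] := triads_lt tt.
  have [E|E] := eqVneq t.1.1.1 i; last by exists t.1.1.1.
  exists t.1.1.2; split=> //; apply: contraNneq u => E'.
  by rewrite !inE E E' eqxx.
have [b [e E]] : exists b e, third i a = Some (b, e).
  case E: (third i a) => [[b e]|]; first by exists b, e.
  by move: wa; rewrite wskew ?eqxx // /skew E eq_sym ai eqxx.
have [|h [Sh hi ha hskew hms]] := @clear_meeting w i a b e
    [seq m <- iota 0 27 | [&& third i m != None, m != a & m != b]] E wi wa wskew.
  by move=> m; rewrite mem_filter => /andP [/and3P []].
apply: (tr h) => //; rewrite -(det h) // in dw; move: (h w) dw hskew hms => {hi ha wi wa wskew ws h Sh} x dx xs xms.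
have sup n : (n < 27)%N -> n \notin [:: i; a; b] -> weight x n = 0.
  move=> n27; rewrite !inE !negb_or => /and3P [ni na nb].
  have [tn|tn] := eqVneq (third i n) None.
    by apply: xs => //; rewrite /skew eq_sym ni tn.
  by apply: xms; rewrite mem_filter mem_iota n27 tn na nb.
have [t [tt n1 n2 n3]] := cubic_neq0 dx; have /andP [/and3P [l1 l2 l3] U] := triads_lt tt.
have S : {subset [:: t.1.1.1; t.1.1.2; t.1.2] <= [:: i; a; b]}.
  have in3 n : (n < 27)%N -> weight x n != 0 -> n \in [:: i; a; b].
    by move=> n27; apply: contraNT => /(sup n n27) ->.
  move=> n; rewrite in_cons => /orP [/eqP ->|]; first exact: in3.
  rewrite in_cons => /orP [/eqP ->|]; first exact: in3.
  by rewrite inE => /eqP ->; exact: in3.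
have [_ Eset] := uniq_min_size U S (leqnn 3).
apply: (hub_triad HW tt) => [n n27 nt|n].
  by apply: sup => //; rewrite -Eset.
rewrite in_cons => /orP [/eqP ->//|]; rewrite in_cons => /orP [/eqP ->//|].
by rewrite inE => /eqP ->.
Qed.

Lemma extremal_locus (det : V -> K) w : det = cubic -> det w != 0 ->
  let S := derived_group [set g : 'End(V) | lker g = 0%VS /\ forall w, det (g w) = det w] in
  let G := component [set g | S g /\ exists c, c != 0 /\ g w = c *: w] \1%VF in
  [set X | closed_orbit S (@Ad _ _) (lie_algebra S) X /\ w \in lker X] =
  closed_orbit G (@Ad _ _) (lie_algebra G).
Proof.
move=> -> dw S G.
rewrite (closed_orbit_stabilizer HT Tdet detect0 (erefl G) dw (hub_nonzero dw)).
rewrite (closed_orbit_derived HT Tdet detect0 (hub_zero HW)).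
apply/seteqP; split=> F /=; first by case=> EF; rewrite memv_ker => /eqP.
by case=> EF Fw; split=> //; rewrite memv_ker Fw.
Qed.

End HubGeneral.

Section Case8Theorem.
Variable K : numClosedFieldType.

Lemma weight8_system : weight_system (@weight K) (fun a => of_weights (fun n => (n == a)%:R)).
Proof.
split; first exact: weight8P.
- by move=> a n n27; exact: weight_of_weights.
- move=> x y H; rewrite -[x]of_weightsK -[y]of_weightsK.
  by rewrite /of_weights /O_uv !H.
Qed.

Lemma det8_cubic (w : J8 K) : det8 w = cubic (@weight K) w.
Proof. by rewrite -{1}[w]of_weightsK det8_of_weights. Qed.

Lemma zero_locus8E (w : J8 K) : det8 w != 0 -> zero_locus8 w = isotropic8 w.
Proof.
move=> dw; have Ed : @det8 K = cubic (@weight K) by apply/funext; exact: det8_cubic.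
exact: (extremal_locus weight8_system Ed dw).
Qed.

End Case8Theorem.

(** * Exterior powers *)

Section ExteriorPowers.
Variables (K : fieldType) (k n : nat).
Implicit Types (t : tensor K k n) (f h : {ffun 'I_k -> 'I_n}) (s : 'S_k).

Lemma reindex_ffun_perm s (F : {ffun 'I_k -> 'I_n} -> K) :
  \sum_h F h = \sum_(h : {ffun 'I_k -> 'I_n}) F [ffun i => h (s i)].
Proof.
have inv : injective (fun h : {ffun 'I_k -> 'I_n} => [ffun i => h (s i)]).
  move=> h h' /ffunP E; apply/ffunP => i.
  by have := E ((s^-1)%g i); rewrite !ffunE permKV.
exact: (reindex_inj inv).
Qed.

Lemma tensor_act_ext (g : 'M[K]_n) t : ext_power t -> ext_power (tensor_act g t).
Proof.
move=> Ht s f; rewrite !ffunE (reindex_ffun_perm s) mulr_sumr; apply: eq_bigr => h _.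
rewrite Ht mulrA; congr (_ * _); rewrite [RHS](reindex_perm s) /=.
by apply: eq_bigr => i _; rewrite !ffunE.
Qed.

Lemma det_mulmx_expand (M : 'M[K]_(k, n)) (C : 'M[K]_(n, k)) :
  \det (M *m C) = \sum_(h : {ffun 'I_k -> 'I_n}) wedge M h * \prod_i C (h i) i.
Proof.
rewrite -det_tr /determinant.
transitivity (\sum_(s : 'S_k) \sum_(h : {ffun 'I_k -> 'I_n}) (-1) ^+ s * \prod_i (M (s i) (h i) * C (h i) i)).
  apply: eq_bigr => s _; rewrite -mulr_sumr; congr (_ * _).
  under eq_bigr => i _ do rewrite mxE mxE.
  by rewrite bigA_distr_bigA.
rewrite exchange_big; apply: eq_bigr => h _.
rewrite ffunE -det_tr /determinant mulr_suml; apply: eq_bigr => s _.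
rewrite big_split mulrA; congr (_ * _ * _); apply: eq_bigr => i _.
by rewrite !mxE.
Qed.

Lemma wedge_ext (M : 'M[K]_(k, n)) : ext_power (wedge M).
Proof.
move=> s f; rewrite !ffunE; have -> : colsub [ffun i => f (s i)] M = col_perm s (colsub f M).
  by apply/matrixP => i j; rewrite !mxE ffunE.
by rewrite col_permE det_mulmx det_perm odd_permV mulrC.
Qed.

Lemma tensor_act_wedge (g : 'M[K]_n) (M : 'M[K]_(k, n)) :
  tensor_act g (wedge M) = wedge (M *m g).
Proof.
apply/ffunP => f; rewrite !ffunE.
have -> : colsub f (M *m g) = M *m colsub f g.
  by apply/matrixP => i j; rewrite !mxE; apply: eq_bigr => l _; rewrite !mxE.
rewrite det_mulmx_expand; apply: eq_bigr => h _; congr (_ * _).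
by apply: eq_bigr => i _; rewrite !mxE.
Qed.

Lemma wedge_mul (P : 'M[K]_k) (M : 'M[K]_(k, n)) : wedge (P *m M) = \det P *: wedge M.
Proof.
apply/ffunP => f; rewrite !ffunE /GRing.scale /= -det_mulmx; congr (\det _).
by apply/matrixP => i j; rewrite !mxE; apply: eq_bigr => l _; rewrite !mxE.
Qed.

End ExteriorPowers.

Lemma det_ImulmxC (K : fieldType) (m n : nat) (U : 'M[K]_(n, m)) (C : 'M[K]_(m, n)) :
  \det (1%:M + U *m C) = \det (1%:M + C *m U).
Proof.
pose B := block_mx (1%:M : 'M[K]_n) (- U) C (1%:M : 'M[K]_m).
have E1 : block_mx 1%:M U 0 1%:M *m B = block_mx (1%:M + U *m C) 0 C 1%:M.
  rewrite mulmx_block !mul1mx !mul0mx !add0r ?mulmx1.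
  by rewrite addNr.
have E2 : B *m block_mx 1%:M U 0 1%:M = block_mx 1%:M 0 C (1%:M + C *m U).
  by rewrite mulmx_block !mulmx1 !mulmx0 !addr0 mul1mx subrr addrC.
have D1 : \det (block_mx (1%:M : 'M[K]_n) U 0 (1%:M : 'M[K]_m)) = 1 by rewrite det_ublock !det1 mul1r.
have := congr1 determinant E1; rewrite det_mulmx D1 mul1r det_lblock det1 mulr1 => <-.
by have := congr1 determinant E2; rewrite det_mulmx D1 mulr1 det_lblock det1 mul1r.
Qed.

(** * The case a = 2 *)

Lemma det_mx2 (R : comNzRingType) (A : 'M[R]_2) : \det A = A 0 0 * A 1 1 - A 0 1 * A 1 0.
Proof.
rewrite (expand_det_row _ 0) !big_ord_recl big_ord0 /cofactor !det_mx11 !mxE /=.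
rewrite (_ : lift 0 0 = 1); last exact/val_inj.
rewrite (_ : lift 1 0 = 0); last exact/val_inj.
by rewrite /=; ring.
Qed.

Lemma det_mx3 (R : comNzRingType) (A : 'M[R]_3) : \det A =
  A 0 0 * (A 1 1 * A 2 2 - A 1 2 * A 2 1) - A 0 1 * (A 1 0 * A 2 2 - A 1 2 * A 2 0)
  + A 0 2 * (A 1 0 * A 2 1 - A 1 1 * A 2 0).
Proof.
have l00 : lift (0 : 'I_3) (0 : 'I_2) = 1 by exact/val_inj.
have l01 : lift (0 : 'I_3) (1 : 'I_2) = 2 by exact/val_inj.
have l10 : lift (1 : 'I_3) (0 : 'I_2) = 0 by exact/val_inj.
have l11 : lift (1 : 'I_3) (1 : 'I_2) = 2 by exact/val_inj.
have l20 : lift (2 : 'I_3) (0 : 'I_2) = 0 by exact/val_inj.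
have l21 : lift (2 : 'I_3) (1 : 'I_2) = 1 by exact/val_inj.
rewrite (expand_det_row _ 0) !big_ord_recl big_ord0 /cofactor !det_mx2 !mxE.
rewrite -[lift 0 (lift 0 0)]/(lift (0 : 'I_3) (lift (0 : 'I_2) 0)).
rewrite (_ : lift (0 : 'I_2) (0 : 'I_1) = 1) ?l01 ?l00 ?l10 ?l11 ?l20 ?l21; last exact/val_inj.
by rewrite /=; ring.
Qed.

Lemma ord2P (P : 'I_2 -> Prop) : P 0 -> P 1 -> forall i, P i.
Proof.
by move=> P0 P1 [[|[|//]] lt]; [rewrite (_ : Ordinal lt = 0)|rewrite (_ : Ordinal lt = 1)];
  rewrite //; exact/val_inj.
Qed.

Lemma ord3P (P : 'I_3 -> Prop) : P 0 -> P 1 -> P 2 -> forall i, P i.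
Proof.
by move=> P0 P1 P2 [[|[|[|//]]] lt]; [rewrite (_ : Ordinal lt = 0)|rewrite (_ : Ordinal lt = 1)
  |rewrite (_ : Ordinal lt = 2)]; rewrite //; exact/val_inj.
Qed.

Lemma sum_ord3 (V : nmodType) (F : 'I_3 -> V) : \sum_i F i = F 0 + F 1 + F 2.
Proof.
by rewrite !big_ord_recl big_ord0 addr0 addrA; congr (F _ + F _ + F _); apply/val_inj.
Qed.

Section LeviCivita.
Variable K : comNzRingType.

Definition levi_civita (a b c : 'I_3) : K :=
  (a == 0)%:R * ((b == 1)%:R * (c == 2)%:R - (b == 2)%:R * (c == 1)%:R)
  - (a == 1)%:R * ((b == 0)%:R * (c == 2)%:R - (b == 2)%:R * (c == 0)%:R)
  + (a == 2)%:R * ((b == 0)%:R * (c == 1)%:R - (b == 1)%:R * (c == 0)%:R).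

Lemma det_col_mx21 (M : 'M[K]_(2, 3)) (x : 'rV[K]_3) :
  \det (col_mx M x : 'M[K]_3) = \sum_a \sum_b \sum_c levi_civita a b c * M 0 a * M 1 b * x 0 c.
Proof.
have e0 j : (col_mx M x : 'M[K]_3) 0 j = M 0 j.
  by rewrite -(col_mxEu M x); congr (fun_of_matrix _ _ _); apply/val_inj.
have e1 j : (col_mx M x : 'M[K]_3) 1 j = M 1 j.
  by rewrite -(col_mxEu M x); congr (fun_of_matrix _ _ _); apply/val_inj.
have e2 j : (col_mx M x : 'M[K]_3) 2 j = x 0 j.
  by rewrite -(col_mxEd M x); congr (fun_of_matrix _ _ _); apply/val_inj.
rewrite det_mx3 !e0 !e1 !e2 !sum_ord3 /levi_civita /=.
by rewrite ?(mulr0, mul0r, mul1r, mulr1, subr0, sub0r, addr0, add0r); ring.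
Qed.

End LeviCivita.

Lemma levi_civita_intr (K : comNzRingType) a b c :
  levi_civita K a b c = (levi_civita int a b c)%:~R.
Proof. by rewrite /levi_civita !(rmorphD, rmorphN, rmorphM, rmorph_nat). Qed.

Lemma levi_civita_contract (K : comNzRingType) a b c d :
  \sum_i levi_civita K a b i * levi_civita K c d i =
  (a == c)%:R * (b == d)%:R - (a == d)%:R * (b == c)%:R.
Proof.
have E : levi_civita int a b 0 * levi_civita int c d 0 + levi_civita int a b 1 * levi_civita int c d 1
    + levi_civita int a b 2 * levi_civita int c d 2
  = (a == c)%:R * (b == d)%:R - (a == d)%:R * (b == c)%:R.
  by elim/ord3P: a; elim/ord3P: b; elim/ord3P: c; elim/ord3P: d.
rewrite sum_ord3 !(levi_civita_intr K) -!rmorphM -!rmorphD E.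
by rewrite !(rmorphD, rmorphN, rmorphM, rmorph_nat).
Qed.

Lemma levi_civita_contract2 (K : comNzRingType) i k :
  \sum_a \sum_b levi_civita K a b i * levi_civita K a b k = (i == k)%:R *+ 2.
Proof.
pose F (R : comNzRingType) (i k a b : 'I_3) : R := levi_civita R a b i * levi_civita R a b k.
have E : F int i k 0 0 + F int i k 0 1 + F int i k 0 2
    + (F int i k 1 0 + F int i k 1 1 + F int i k 1 2)
    + (F int i k 2 0 + F int i k 2 1 + F int i k 2 2) = (i == k)%:R *+ 2.
  by elim/ord3P: i; elim/ord3P: k.
have FE a b : F K i k a b = (F int i k a b)%:~R by rewrite /F !(levi_civita_intr K) rmorphM.
rewrite !sum_ord3 -!/(F K i k _ _) !FE -!rmorphD E.
by rewrite rmorphMn rmorph_nat.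
Qed.

Lemma vol_levi_civita (K : fieldType) (f : {ffun 'I_2 -> 'I_3}) i : vol K f i = levi_civita K (f 0) (f 1) i.
Proof.
rewrite /vol det_col_mx21 (bigD1 (f 0)) //= (bigD1 (f 1)) //= (bigD1 i) //=.
rewrite !mxE !eqxx !mulr1 !big1 ?addr0 // => [a na|b nb|c nc].
- rewrite big1 // => b _; rewrite big1 // => c _.
  by rewrite !mxE [f 0 == a]eq_sym (negPf na) mulr0 !mul0r.
- by rewrite big1 // => c _; rewrite !mxE [f 1 == b]eq_sym (negPf nb) mulr0 mul0r.
- by rewrite !mxE (negPf nc) andbF mulr0.
Qed.

Lemma sum_ffun2 (V : nmodType) (T : finType) (G : T -> T -> V) :
  \sum_(f : {ffun 'I_2 -> T}) G (f 0) (f 1) = \sum_a \sum_b G a b.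
Proof.
rewrite pair_big /= (reindex (fun p : T * T => [ffun i : 'I_2 => if i == 0 then p.1 else p.2])) /=.
  by apply: eq_bigr => p _; rewrite !ffunE.
exists (fun f : {ffun 'I_2 -> T} => (f 0, f 1)) => [[a b] _|f _]; first by rewrite !ffunE.
by apply/ffunP; elim/ord2P; rewrite !ffunE.
Qed.

Section Case2Coordinates.
Variable K : numClosedFieldType.
Local Notation eps := (levi_civita K).

(* wedge^2 A (x) B ~ A^* (x) B ~ M_3(K) through the volume form. *)
Definition vol_contract (t : T2 K) : 'M[K]_3 := \matrix_(i, l) \sum_f t (f, l) * vol K f i.

Definition vol_expand (N : 'M[K]_3) : T2 K :=
  [ffun p : {ffun 'I_2 -> 'I_3} * 'I_3 => \sum_i vol K p.1 i * N i p.2].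

Definition cross (M : 'M[K]_(2, 3)) : 'rV[K]_3 :=
  \row_i \sum_a \sum_b eps a b i * M 0 a * M 1 b.

Lemma form2E w t : form2 w t = vol_contract t *m w^T.
Proof.
apply/matrixP => i j; rewrite !mxE exchange_big /=; apply: eq_bigr => l _.
by rewrite !mxE mulr_suml.
Qed.

Lemma vol_expandK N : vol_contract (vol_expand N) = N *+ 2.
Proof.
apply/matrixP => k l; rewrite !mxE.
under eq_bigr => f _ do rewrite ffunE /= mulr_suml.
rewrite exchange_big /= (bigD1 k) //= [X in _ + X]big1 ?addr0 => [|i ik].
  under eq_bigr => f _ do rewrite mulrAC !vol_levi_civita.
  rewrite -mulr_suml (sum_ffun2 (fun a b => eps a b k * eps a b k)) levi_civita_contract2 eqxx.
  by rewrite mulrC mulr_natr.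
under eq_bigr => f _ do rewrite mulrAC !vol_levi_civita.
rewrite -mulr_suml (sum_ffun2 (fun a b => eps a b i * eps a b k)) levi_civita_contract2.
by rewrite (negPf ik) mul0rn mul0r.
Qed.

Lemma ext2P (t : tensor K 2 3) : ext_power t <->
  forall f : {ffun 'I_2 -> 'I_3}, t [ffun i => f (tperm 0 1 i)] = - t f.
Proof.
split=> [H f|H s f]; first by rewrite H odd_tperm /= expr1 mulN1r.
have [->|->] : s = 1%g \/ s = tperm 0 1.
  have [s0|s0] := eqVneq (s 0) 0.
    left; apply/permP; elim/ord2P; rewrite perm1 //.
    by have : s 1 != 0; [rewrite -s0 (inj_eq perm_inj)|elim/ord2P: (s 1)].
  have E0 : s 0 = 1 by move: s0; elim/ord2P: (s 0).
  right; apply/permP; elim/ord2P; rewrite ?tpermL ?tpermR //.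
  by have : s 1 != 1; [rewrite -E0 (inj_eq perm_inj)|elim/ord2P: (s 1)].
- by rewrite odd_perm1 mul1r; congr (t _); apply/ffunP => i; rewrite ffunE perm1.
- by rewrite H odd_tperm /= expr1 mulN1r.
Qed.

Lemma levi_civitaC a b c : eps b a c = - eps a b c.
Proof. by rewrite /levi_civita; ring. Qed.

Lemma vol_expand_V2 N : V2 (vol_expand N).
Proof.
move=> l; apply/ext2P => f; rewrite !ffunE /= -sumrN; apply: eq_bigr => i _.
by rewrite !vol_levi_civita !ffunE tpermL tpermR levi_civitaC mulNr.
Qed.

Lemma vol_contractK t : V2 t -> vol_expand (vol_contract t) = 2%:R *: t.
Proof.
move=> Vt; apply/ffunP => -[f l]; rewrite !ffunE /=.
under eq_bigr => i _ do rewrite mxE mulr_sumr.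
rewrite exchange_big /=.
transitivity (\sum_(h : {ffun 'I_2 -> 'I_3}) t (h, l) *
   ((f 0 == h 0)%:R * (f 1 == h 1)%:R - (f 0 == h 1)%:R * (f 1 == h 0)%:R)).
  apply: eq_bigr => h _; rewrite -levi_civita_contract mulr_sumr; apply: eq_bigr => i _.
  by rewrite !vol_levi_civita mulrCA.
under eq_bigr do rewrite mulrBr; rewrite sumrB.
have D (h h' : {ffun 'I_2 -> 'I_3}) : (h 0 == h' 0) && (h 1 == h' 1) = (h == h').
  apply/andP/eqP => [[/eqP h0 /eqP h1]|->//]; apply/ffunP; elim/ord2P => //.
rewrite (bigD1 f) //= !eqxx !mulr1 [X in _ + X - _]big1 ?addr0; last first.
  by move=> h hf; rewrite -natrM mulnb D eq_sym (negPf hf) mulr0.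
pose f' : {ffun 'I_2 -> 'I_3} := [ffun i => f (tperm 0 1 i)].
rewrite (bigD1 f') //= [X in _ - (_ + X)]big1 ?addr0; last first.
  move=> h hf; rewrite -natrM mulnb; have -> : (f 0 == h 1) && (f 1 == h 0) = (f' == h).
    by rewrite -D /f' !ffunE tpermL tpermR andbC.
  by rewrite eq_sym (negPf hf) mulr0.
have := (ext2P _).1 (Vt l) f; rewrite !ffunE => ->.
by rewrite tpermL tpermR !eqxx !mulr1 opprK /GRing.scale /= mulr_natl mulr2n.
Qed.

Lemma wedge2E (M : 'M[K]_(2, 3)) (f : {ffun 'I_2 -> 'I_3}) : wedge M f = M 0 (f 0) * M 1 (f 1) - M 0 (f 1) * M 1 (f 0).
Proof. by rewrite ffunE det_mx2 !mxE. Qed.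

Lemma pure2E M b : pure2 M b = vol_expand ((cross M)^T *m b).
Proof.
apply/ffunP => -[f l]; have -> : pure2 M b (f, l) = wedge M f * b 0 l by rewrite ffunE.
rewrite wedge2E ffunE /=.
under eq_bigr => i _ do rewrite mxE big_ord1 !mxE mulrA vol_levi_civita.
rewrite -mulr_suml; congr (_ * _); move: (f 0) (f 1) => {f l} c d.
transitivity (\sum_a \sum_b' ((c == a)%:R * (d == b')%:R - (c == b')%:R * (d == a)%:R)
   * (M 0 a * M 1 b')).
  by rewrite !sum_ord3; elim/ord3P: c; elim/ord3P: d; rewrite /=; ring.
under eq_bigr => a _ do under eq_bigr => b' _ do rewrite -levi_civita_contract mulr_suml.
under eq_bigr => a _ do rewrite exchange_big.
rewrite exchange_big /=; apply: eq_bigr => i _; rewrite mulr_sumr; apply: eq_bigr => a _.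
by rewrite mulr_sumr; apply: eq_bigr => b' _; ring.
Qed.

Lemma cross_orth M : M *m (cross M)^T = 0.
Proof.
apply/matrixP => p j; rewrite !mxE; under eq_bigr => i _ do rewrite !mxE.
by rewrite !sum_ord3 /levi_civita; elim/ord2P: p; rewrite /=; ring.
Qed.

Lemma det_cross (M : 'M[K]_(2, 3)) (x : 'rV[K]_3) : \det (col_mx M x : 'M[K]_3) = (x *m (cross M)^T) 0 0.
Proof.
rewrite det_col_mx21 mxE; under [RHS]eq_bigr => i _ do rewrite !mxE mulr_sumr.
rewrite [RHS]exchange_big /=; apply: eq_bigr => a _.
under [RHS]eq_bigr => i _ do rewrite mulr_sumr.
by rewrite exchange_big /=; apply: eq_bigr => b _; apply: eq_bigr => i _; ring.
Qed.

End Case2Coordinates.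

Section Case2Action.
Variable K : numClosedFieldType.
Local Notation eps := (levi_civita K).

Lemma cross_rowsub1 (h : {ffun 'I_2 -> 'I_3}) k : cross (rowsub h 1%:M) 0 k = vol K h k.
Proof.
rewrite mxE vol_levi_civita (bigD1 (h 0)) //= (bigD1 (h 1)) //= !mxE !eqxx !mulr1.
rewrite !big1 ?addr0 // => [a na|b nb].
- by rewrite big1 // => b _; rewrite !mxE [h 0 == a]eq_sym (negPf na) mulr0 mul0r.
- by rewrite !mxE [h 1 == b]eq_sym (negPf nb) mulr0.
Qed.

Lemma cross_rowsub (h : {ffun 'I_2 -> 'I_3}) (g : 'M[K]_3) i : g \in unitmx ->
  cross (rowsub h g) 0 i = \det g * \sum_k invmx g i k * vol K h k.
Proof.
move=> gu; pose d : 'rV[K]_3 := delta_mx 0 i.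
have -> : cross (rowsub h g) 0 i = \det (col_mx (rowsub h g) d : 'M[K]_3).
  by rewrite det_cross -rowE [RHS]mxE [RHS]mxE.
have -> : (col_mx (rowsub h g) d : 'M[K]_3) = (col_mx (rowsub h 1%:M) (d *m invmx g) : 'M[K]_3) *m g.
  apply: etrans (esym (mul_col_mx (rowsub h 1%:M) (d *m invmx g) g)).
  by rewrite -mulmxA mulVmx // mulmx1 mul_rowsub_mx mul1mx.
rewrite det_mulmx mulrC; congr (_ * _); rewrite det_cross mxE; apply: eq_bigr => k _.
rewrite [X in _ * X]mxE cross_rowsub1; congr (_ * _).
by rewrite -rowE mxE.
Qed.

Lemma vol_contract_act (g : 'M[K]_3 * 'M[K]_3) t : g.1 \in unitmx ->
  vol_contract (V2_act g t) = \det g.1 *: (invmx g.1 *m vol_contract t *m g.2).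
Proof.
move=> gu; apply/matrixP => i l'; rewrite !mxE.
transitivity (\sum_l \sum_(h : {ffun 'I_2 -> 'I_3}) t (h, l) * g.2 l l' * cross (rowsub h g.1) 0 i).
  under eq_bigr => f _ do rewrite ffunE mulr_suml.
  rewrite exchange_big /=; apply: eq_bigr => l _.
  under eq_bigr => f _ do rewrite ffunE -mulrA mulr_suml.
  rewrite exchange_big /=; apply: eq_bigr => h _; rewrite ffunE.
  rewrite mxE -(sum_ffun2 (fun a b => eps a b i * rowsub h g.1 0 a * rowsub h g.1 1 b)) mulr_sumr.
  apply: eq_bigr => f _; rewrite vol_levi_civita !big_ord_recl big_ord0 !mxE mulr1.
  rewrite (_ : lift ord0 ord0 = 1); last exact/val_inj.
  by rewrite (_ : ord0 = 0) //; ring.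
rewrite [in RHS]mulr_sumr; apply: eq_bigr => l _; rewrite mxE mulr_suml mulr_sumr.
under [RHS]eq_bigr => k _ do rewrite mxE mulr_sumr mulr_suml mulr_sumr.
rewrite exchange_big /=; apply: eq_bigr => h _; rewrite cross_rowsub // !mulr_sumr.
by apply: eq_bigr => k _; ring.
Qed.

Lemma V2_act_V2 (g : 'M[K]_3 * 'M[K]_3) t : V2 t -> V2 (V2_act g t).
Proof.
move=> Vt l' s f; rewrite !ffunE mulr_sumr; apply: eq_bigr => l _ /=.
by rewrite mulrA; congr (_ * _); have := tensor_act_ext g.1 (Vt l); apply.
Qed.

Lemma V2_inj (t u : T2 K) : V2 t -> V2 u -> vol_contract t = vol_contract u -> t = u.
Proof.
move=> Vt Vu E; apply: (@scalerI _ _ 2%:R); first by rewrite pnatr_eq0.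
by rewrite -!vol_contractK // E.
Qed.

End Case2Action.

Section Case2Theorem.
Variable K : numClosedFieldType.

Lemma kernel_line (M : 'M[K]_(2, 3)) (x y : 'rV[K]_3) : row_free M -> x != 0 ->
  M *m x^T = 0 -> M *m y^T = 0 -> exists c, y = c *: x.
Proof.
move=> Mfree x0 Mx My; apply/sub_rVP.
have sub (z : 'rV_3) : M *m z^T = 0 -> (z <= kermx M^T)%MS.
  by move=> Mz; apply/sub_kermxP; rewrite -[z]trmxK -trmx_mul Mz trmx0.
apply: submx_trans (sub _ My) _.
have := mxrank_leqif_sup (sub _ Mx); rewrite rank_rV x0 mxrank_ker mxrank_tr (eqP Mfree).
by move=> [_ <-].
Qed.

Lemma cross_neq0 (M : 'M[K]_(2, 3)) : row_free M -> cross M != 0.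
Proof.
move=> /row_freeP [P MP]; apply/eqP => M0.
have W0 f : wedge M f = 0.
  have : pure2 M (const_mx 1) (f, 0) = 0.
    by rewrite pure2E M0 trmx0 mul0mx ffunE big1 // => i _; rewrite mxE mulr0.
  by rewrite ffunE mxE mulr1.
have := det_mulmx_expand M P; rewrite MP det1 big1 => [/eqP|f _]; first by rewrite oner_eq0.
by rewrite W0 mul0r.
Qed.

Lemma exists_orth (n : 'rV[K]_3) : n != 0 ->
  exists M : 'M[K]_(2, 3), row_free M /\ M *m n^T = 0.
Proof.
move=> n0; have rk : \rank (kermx n^T) = 2%N by rewrite mxrank_ker mxrank_tr rank_rV n0.
have Rf := row_base_free (kermx n^T).
have R0 : row_base (kermx n^T) *m n^T = 0 by apply/sub_kermxP; rewrite eq_row_base.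
by move: (row_base _) Rf R0; rewrite rk => M; exists M.
Qed.

Variable w : 'M[K]_3.
Hypothesis dw : \det w != 0.

Let wu : w \in unitmx. Proof. by rewrite unitmxE unitfE. Qed.
Let wtu : w^T \in unitmx. Proof. by rewrite unitmx_tr. Qed.

Definition rank_one_form (t : T2 K) : Prop :=
  V2 t /\ exists n : 'rV[K]_3, n != 0 /\ form2 w t = n^T *m n.

Lemma sqrt_scale (c : K) (n : 'rV[K]_3) : c != 0 -> n != 0 ->
  exists m : 'rV[K]_3, m != 0 /\ c *: (n^T *m n) = m^T *m m.
Proof.
move=> c0 n0; exists (sqrtC c *: n); split.
  by rewrite scaler_eq0 negb_or n0 sqrtC_eq0 c0.
by rewrite [(_ *: n)^T]linearZ /= -scalemxAl -scalemxAr scalerA -expr2 sqrtCK.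
Qed.

Lemma zero_locus2E : zero_locus2 w = rank_one_form.
Proof.
apply/seteqP; split=> t.
- move=> [M [b [Mf b0 -> Mwb]]]; rewrite pure2E; split; first exact: vol_expand_V2.
  have n0 := cross_neq0 Mf.
  have [c Hc] : exists c, b *m w^T = c *: cross M.
    by apply: (kernel_line Mf n0 (cross_orth M)); rewrite trmx_mul trmxK mulmxA.
  have c0 : c != 0.
    apply: contraNneq b0 => c0; rewrite c0 scale0r in Hc.
    by rewrite -[b](mulmxK wtu) Hc mul0mx.
  have c20 : 2%:R * c != 0 by rewrite mulf_neq0 ?pnatr_eq0.
  have [m [m0 Hm]] := sqrt_scale c20 n0.
  exists m; split=> //; rewrite form2E vol_expandK -Hm mulr2n mulmxDl -mulmxA Hc.
  by rewrite -scalemxAr -mulr2n -scaler_nat scalerA.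
- move=> [Vt [n [n0 Ft]]]; have [M [Mf Mn]] := exists_orth n0.
  have m0 := cross_neq0 Mf.
  have [a Ha] := kernel_line Mf n0 Mn (cross_orth M).
  have a0 : a != 0 by apply: contraNneq m0 => a0; rewrite Ha a0 scale0r.
  exists M, ((2%:R * a)^-1 *: (n *m invmx w^T)); split=> //.
  + rewrite scaler_eq0 negb_or invr_eq0 mulf_neq0 ?pnatr_eq0 //=.
    by apply: contraNneq n0 => E; rewrite -[n](mulmxKV wtu) E mul0mx.
  + apply: V2_inj => //; first by rewrite pure2E; exact: vol_expand_V2.
    rewrite pure2E vol_expandK Ha -[LHS](mulmxK wtu) -form2E Ft.
    rewrite [(a *: n)^T]linearZ /= -scalemxAl -scalemxAr scalerA -scaler_nat scalerA mulmxA.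
    rewrite [X in X *: _](_ : _ = 1) ?scale1r //; field; exact: a0.
  + rewrite [(_ *: _)^T]linearZ /= -scalemxAr trmx_mul trmx_inv trmxK -mulmxA.
    by rewrite (mulmxA w) mulmxV // mul1mx Mn scaler0.
Qed.

Lemma form2_act g t c : c != 0 -> SL2case g -> J2_act g w = c *: w -> V2 t ->
  form2 w (V2_act g t) = c^-1 *: (invmx g.1 *m form2 w t *m (invmx g.1)^T).
Proof.
move=> c0 [d1 d2] Jg Vt.
have u1 : g.1 \in unitmx by rewrite unitmxE d1 unitr1.
have u2 : g.2 \in unitmx by rewrite unitmxE d2 unitr1.
rewrite !form2E vol_contract_act // d1 scale1r -!mulmxA !scalemxAr; congr (_ *m (_ *m _)).
have := congr1 trmx Jg; rewrite /J2_act !trmx_mul trmxK linearZ /= => E.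
rewrite -scalemxAr; apply: (scalerI c0); rewrite [RHS]scalerA mulfV // scale1r.
by rewrite scalemxAr -E mulKVmx.
Qed.

Section Transvection.
Variables (x : 'cV[K]_3) (phi : 'rV[K]_3).
Hypothesis phix : phi *m x = 0.

Definition transvection (s : K) : 'M[K]_3 := 1%:M + s *: (x *m phi).

Lemma transvectionM s r : transvection s *m transvection r = transvection (s + r).
Proof.
rewrite /transvection mulmxDl !mulmxDr !mul1mx mulmx1 -scalemxAl -scalemxAr.
by rewrite !mulmxA -[x *m phi *m x]mulmxA phix mulmx0 mul0mx !scaler0 addr0 scalerDl -addrA [r *: _ + _]addrC.
Qed.

Lemma transvection0 : transvection 0 = 1%:M. Proof. by rewrite /transvection scale0r addr0. Qed.

Lemma det_transvection s : \det (transvection s) = 1.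
Proof. by rewrite /transvection scalemxAl det_ImulmxC -scalemxAr phix scaler0 addr0 det1. Qed.

Lemma transvectionV s : invmx (transvection s) = transvection (- s).
Proof.
have u : transvection s \in unitmx by rewrite unitmxE det_transvection unitr1.
by rewrite -[LHS]mulmx1 -transvection0 -(subrr s) -transvectionM mulKmx.
Qed.

Definition transvection_pair (s : K) : 'M[K]_3 * 'M[K]_3 :=
  (transvection (- s), w^T *m (transvection s)^T *m invmx w^T).

Lemma transvection_pair_SL s : SL2case (transvection_pair s).
Proof.
split; rewrite /= ?det_transvection // !det_mulmx det_inv !det_tr det_transvection mulr1.
by rewrite divff.
Qed.

Lemma transvection_pair_J s : J2_act (transvection_pair s) w = w.
Proof.
rewrite /J2_act /= transvectionV opprK.
have -> : (invmx (w^T *m (transvection s)^T *m invmx w^T))^T = invmx w *m transvection (- s) *m w.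
  rewrite trmx_inv !trmx_mul !trmxK trmx_inv trmxK.
  have tu r : transvection r \in unitmx by rewrite unitmxE det_transvection unitr1.
  have E : invmx w *m (transvection s *m w) *m (invmx w *m transvection (- s) *m w) = 1%:M.
    rewrite !mulmxA mulmxK // -[_ *m transvection s *m _]mulmxA transvectionM subrr transvection0.
    by rewrite mulmx1 mulVmx.
  have [_ u] := mulmx1_unit E.
  have [u' _] := mulmx1_unit E.
  by rewrite -[LHS]mulmx1 -E mulKmx.
by rewrite !mulmxA mulmxK // transvectionM subrr transvection0 mul1mx.
Qed.

Lemma transvection_pair_SO s : SO2case w (transvection_pair s).
Proof.
have -> : SO2case w = component [set g | SL2case g /\ exists c, c != 0 /\ J2_act g w = c *: w]
   (transvection_pair 0).
  by rewrite /transvection_pair oppr0 transvection0 trmx1 mulmx1 mulmxV.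
apply: component_polycurve => [|r]; last first.
  split; first exact: transvection_pair_SL.
  by exists 1; rewrite oner_eq0 scale1r transvection_pair_J.
have -> : transvection_pair = fun r => (1%:M, 1%:M) + r *: (- (x *m phi), w^T *m (x *m phi)^T *m invmx w^T).
  apply/funext => r; rewrite /transvection_pair /transvection; congr pair.
    by rewrite scaleNr /= scalerN.
  by rewrite linearD /= trmx1 mulmxDr mulmxDl mulmx1 mulmxV // linearZ /= -scalemxAr -scalemxAl.
by apply: polycurve_add; [|apply: polycurve_scale]; exact: polycurve_cst.
Qed.

Lemma form2_transvection s t : V2 t ->
  form2 w (V2_act (transvection_pair s) t) = transvection s *m form2 w t *m (transvection s)^T.
Proof.
move=> Vt; have := @form2_act (transvection_pair s) t 1 (oner_neq0 _) (transvection_pair_SL s).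
by rewrite scale1r => /(_ (transvection_pair_J s) Vt) ->; rewrite invr1 scale1r /= transvectionV opprK.
Qed.

End Transvection.

Lemma form2Z c t : form2 w (c *: t) = c *: form2 w t.
Proof.
apply/matrixP => i j; rewrite !mxE mulr_sumr; apply: eq_bigr => f _.
by rewrite mulr_sumr; apply: eq_bigr => l _; rewrite ffunE /GRing.scale /= !mulrA.
Qed.

Lemma form2_0 : form2 w 0 = 0.
Proof. by have := form2Z 0 0; rewrite !scale0r. Qed.

Lemma V2Z c (t : T2 K) : V2 t -> V2 (c *: t).
Proof.
move=> Vt l s f; rewrite !ffunE; have := Vt l s f; rewrite !ffunE => ->.
by rewrite /GRing.scale /= mulrCA.
Qed.

Lemma form2_inj t u : V2 t -> V2 u -> form2 w t = form2 w u -> t = u.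
Proof.
move=> Vt Vu; rewrite !form2E => E; apply: V2_inj => //.
by rewrite -[LHS](mulmxK wtu) E mulmxK.
Qed.

Definition of_form (F : 'M[K]_3) : T2 K := 2%:R^-1 *: vol_expand (F *m invmx w^T).

Lemma of_form_V2 F : V2 (of_form F).
Proof. by apply: V2Z; exact: vol_expand_V2. Qed.

Lemma of_formK F : form2 w (of_form F) = F.
Proof.
rewrite form2Z form2E vol_expandK -scaler_nat -scalemxAl scalerA mulVf ?pnatr_eq0 //.
by rewrite scale1r mulmxKV.
Qed.

Lemma of_form_linear : linear of_form.
Proof.
move=> a F G; apply: form2_inj; first exact: of_form_V2.
  by move=> l s f; have := V2Z a (of_form_V2 F) l s f; have := of_form_V2 G l s f; rewrite !ffunE => -> ->; rewrite mulrDr.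
apply/matrixP => i j; rewrite of_formK -{1}[F]of_formK -{1}[G]of_formK -form2Z !mxE.
rewrite -big_split; apply: eq_bigr => f _; rewrite -big_split; apply: eq_bigr => l _ /=.
by rewrite [in RHS]ffunE !mulrDl.
Qed.

Lemma rank_one_form0 : ~ rank_one_form 0.
Proof.
move=> [_ [n [n0]]]; rewrite form2_0 => E.
case/eqP: n0; apply/rowP => i; move/matrixP: E => /(_ i i); rewrite !mxE big_ord1 !mxE => /esym/eqP.
by rewrite mulf_eq0 orbb => /eqP.
Qed.

Lemma rank_one_formZ c t : c != 0 -> rank_one_form t -> rank_one_form (c *: t).
Proof.
move=> c0 [Vt [n [n0 Ft]]]; split; first exact: V2Z.
by rewrite form2Z Ft; have [m [m0 ->]] := sqrt_scale c0 n0; exists m.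
Qed.

Lemma polyfun_form2 i j : polyfun (fun t => form2 w t i j).
Proof.
apply: polyfun_scalar => a t u; rewrite !mxE mulr_sumr -big_split; apply: eq_bigr => f _.
rewrite /= mulr_sumr -big_split; apply: eq_bigr => l _; rewrite /= !ffunE /GRing.scale /=; ring.
Qed.

Lemma rank_one_form_closed : zariski_closed (rank_one_form `|` [set 0]).
Proof.
have -> : rank_one_form `|` [set 0] =
    [set t : T2 K | forall p : 'I_3 * 'S_2 * {ffun 'I_2 -> 'I_3},
       t ([ffun i => p.2 (p.1.2 i)], p.1.1) - (-1) ^+ p.1.2 * t (p.2, p.1.1) = 0]
    `&` ([set t | forall p : 'I_3 * 'I_3, form2 w t p.1 p.2 - form2 w t p.2 p.1 = 0]
    `&` [set t | forall p : ('I_3 * 'I_3) * ('I_3 * 'I_3),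
       form2 w t p.1.1 p.1.2 * form2 w t p.2.1 p.2.2 - form2 w t p.1.1 p.2.2 * form2 w t p.2.1 p.1.2 = 0]).
  apply/seteqP; split=> t /=.
    move=> H; have [Vt Ht] : V2 t /\ exists n : 'rV[K]_3, form2 w t = n^T *m n.
      case: H => [[Vt [n [_ Ft]]]|->]; first by split=> //; exists n.
      split; first by move=> l s f; rewrite !ffunE mulr0.
      by exists 0; rewrite mulmx0 form2_0.
    have [n Fn] := Ht; have Fij i j : form2 w t i j = n 0 i * n 0 j by rewrite Fn mxE big_ord1 mxE.
    split; [|split].
    - by move=> [[l s] f] /=; have := Vt l s f; rewrite !ffunE => ->; rewrite subrr.
    - by move=> p; rewrite !Fij mulrC subrr.
    - by move=> p; rewrite !Fij; ring.
  move=> [Hext [Hsym Hmin]]; have Vt : V2 t.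
    by move=> l s f; rewrite !ffunE; apply/eqP; rewrite -subr_eq0; apply/eqP; exact: (Hext (l, s, f)).
  have sym i j : form2 w t i j = form2 w t j i.
    by apply/eqP; rewrite -subr_eq0; apply/eqP; exact: (Hsym (i, j)).
  have min i j k l : form2 w t i j * form2 w t k l = form2 w t i l * form2 w t k j.
    by apply/eqP; rewrite -subr_eq0; apply/eqP; exact: (Hmin ((i, j), (k, l))).
  have [F0|[i Fi]] : form2 w t = 0 \/ exists i, form2 w t i i != 0.
    have [?|nz] := pselect (exists i, form2 w t i i != 0); first by right.
    left; apply/matrixP => i j.
    have Fd k : form2 w t k k = 0 by apply/eqP; apply: contraT => ?; case: nz; exists k.
    have := min i i j j; rewrite !Fd mul0r [in RHS](sym j i) => /esym/eqP.
    by rewrite mulf_eq0 orbb => /eqP ->; rewrite mxE.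
  - right; apply: form2_inj => //; first by move=> l s f; rewrite !ffunE mulr0.
    by rewrite F0 form2_0.
  - left; split=> //; pose r := row i (form2 w t).
    have r0 : r != 0 by apply: contraNneq Fi => r0; have := congr1 (fun u : 'rV_3 => u 0 i) r0; rewrite !mxE => ->.
    have Fi' : (form2 w t i i)^-1 != 0 by rewrite invr_eq0.
    have [m [m0 Hm]] := sqrt_scale Fi' r0; exists m; split=> //; rewrite -Hm.
    apply/matrixP => k l; rewrite {}/r in r0 Hm *.
    have -> : ((form2 w t i i)^-1 *: ((row i (form2 w t))^T *m row i (form2 w t))) k l =
        (form2 w t i i)^-1 * (form2 w t i k * form2 w t i l).
      by move: (form2 w t) => F; rewrite !mxE big_ord1 !mxE.
    by apply: (mulfI Fi); rewrite mulrA mulfV // mul1r (min i i k l) mulrC (sym k i).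
apply: zariski_closedI; [|apply: zariski_closedI]; apply: zariski_closed_zeros.
- move=> p; apply: polyfun_sub; first exact: polyfun_ffun.
  by apply: polyfun_mul; [exact: polyfun_cst|exact: polyfun_ffun].
- by move=> p; apply: polyfun_sub; exact: polyfun_form2.
- by move=> p; apply: polyfun_sub; apply: polyfun_mul; exact: polyfun_form2.
Qed.

Lemma exists_dual (n m : 'rV[K]_3) : \rank (col_mx n m) = 2%N ->
  exists phi : 'rV[K]_3, phi *m n^T = 1 /\ phi *m m^T = 1.
Proof.
move=> rk; have /row_freeP [P HP] : row_free (col_mx n m) by rewrite /row_free rk.
exists (P *m const_mx 1)^T; move: HP; rewrite mul_col_mx => HP.
have E : col_mx n m *m (P *m const_mx 1 : 'cV_3) = const_mx 1 by rewrite mulmxA mul_col_mx HP mul1mx.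
move: E; rewrite mul_col_mx -[const_mx 1 in RHS]vsubmxK => /eq_col_mx [En Em].
split; rewrite -trmx_mul ?En ?Em; apply/matrixP => i j; rewrite !mxE !ord1 //.
Qed.

Lemma isotropic2E : isotropic2 w = rank_one_form.
Proof.
have stab g : SO2case w g -> exists c, [/\ c != 0, SL2case g & J2_act g w = c *: w].
  by move=> /component_sub [H1 [c [c0 H2]]]; exists c.
apply: closed_orbitE.
- exact: rank_one_form_closed.
- pose n : 'rV[K]_3 := const_mx 1; exists (of_form (n^T *m n)).
  have V := of_form_V2 (n^T *m n); have F := of_formK (n^T *m n).
  split; first by split=> //; rewrite F trmx_mul trmxK.
  split=> //; exists n; split=> //.
  by apply/eqP => /matrixP /(_ 0 0); rewrite !mxE => /eqP; rewrite oner_eq0.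
- exact: rank_one_form0.
- by move=> c t; exact: rank_one_formZ.
- move=> g t Gg [Vt [n [n0 Ft]]]; have [c [c0 Sg Jg]] := stab _ Gg.
  split; first exact: V2_act_V2.
  rewrite (form2_act c0 Sg Jg Vt) Ft.
  have u1 : g.1 \in unitmx by rewrite unitmxE Sg.1 unitr1.
  have c0' : c^-1 != 0 by rewrite invr_eq0.
  have n0' : n *m (invmx g.1)^T != 0.
    apply: contraNneq n0 => E; have := congr1 (mulmx^~ (g.1^T)) E.
    by rewrite -mulmxA -trmx_mul mulmxV // trmx1 mulmx1 mul0mx => ->.
  have [m [m0 Hm]] := sqrt_scale c0' n0'; exists m; split=> //.
  by rewrite -Hm trmx_mul trmxK !mulmxA.
- move=> g t Gg [Vt _] [_ [n [n0 Ft]]]; have [c [c0 Sg Jg]] := stab _ Gg.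
  split=> //; have u1 : g.1 \in unitmx by rewrite unitmxE Sg.1 unitr1.
  have n0' : n *m g.1^T != 0.
    apply: contraNneq n0 => E; have := congr1 (mulmx^~ (invmx g.1)^T) E.
    by rewrite -mulmxA -trmx_mul mulVmx // trmx1 mulmx1 mul0mx => ->.
  have [m [m0 Hm]] := sqrt_scale c0 n0'; exists m; split=> //; rewrite -Hm.
  rewrite trmx_mul trmxK mulmxA -[g.1 *m n^T *m n]mulmxA -Ft (form2_act c0 Sg Jg Vt).
  rewrite -scalemxAr -scalemxAl scalerA mulfV // scale1r !mulmxA mulmxV // mul1mx -mulmxA.
  by rewrite -trmx_mul mulmxV // trmx1 mulmx1.
- move=> t u [Vt [n [n0 Ft]]] [Vu [m [m0 Fu]]].
  have [rk|rk] := eqVneq (\rank (col_mx n m)) 2%N.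
    have [phi [pn pm]] := exists_dual rk.
    have px : phi *m (m - n)^T = 0 by rewrite linearB /= mulmxBr pn pm subrr.
    exists (transvection_pair (m - n)^T phi 1), 1; split; first exact: transvection_pair_SO.
      by rewrite oner_eq0.
    rewrite scale1r; apply: form2_inj => //; first exact: V2_act_V2.
    have Tn : transvection (m - n)^T phi 1 *m n^T = m^T.
      rewrite /transvection scale1r mulmxDl mul1mx -mulmxA pn mulmx1 -linearD /=.
      by rewrite addrC subrK.
    have nT : n *m (transvection (m - n)^T phi 1)^T = m by apply: trmx_inj; rewrite -Tn trmx_mul trmxK.
    by rewrite form2_transvection // Ft Fu mulmxA Tn -mulmxA nT.
  have [c Hc] : exists c, m = c *: n.
    apply/sub_rVP; have := mxrank_leqif_sup (addsmxSl n m).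
    have rn : \rank n = 1%N by rewrite rank_rV n0.
    have r1 : \rank (n + m)%MS = 1%N.
      have := rank_leq_row (col_mx n m); have := mxrankS (addsmxSl n m); rewrite rn.
      rewrite -addsmxE in rk *; case: (\rank _) rk => [|[|[|]]] //.
    by move=> [_]; rewrite rn r1 eqxx => /esym; rewrite addsmx_sub => /andP [].
  have c0 : c != 0 by apply: contraNneq m0 => c0; rewrite Hc c0 scale0r.
  have px : (0 : 'rV[K]_3) *m (0 : 'cV[K]_3) = 0 by rewrite mul0mx.
  exists (transvection_pair 0 0 0), (c ^+ 2); split; first exact: transvection_pair_SO.
    by rewrite expf_neq0.
  apply: form2_inj => //; first by apply: V2Z; exact: V2_act_V2.
  rewrite form2Z form2_transvection // transvection0 trmx1 mul1mx mulmx1 Ft Fu Hc.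
  by rewrite [(c *: n)^T]linearZ /= -scalemxAl -scalemxAr scalerA -expr2.
- move=> t [Vt sym] t0.
  have [phi phiF] : exists phi : 'rV[K]_3, (phi *m form2 w t *m phi^T) 0 0 != 0.
    apply: contra_notP (negP t0) => nphi; apply/eqP; apply: form2_inj => //.
      by move=> l s f; rewrite !ffunE mulr0.
    have Q (phi : 'rV[K]_3) : (phi *m form2 w t *m phi^T) 0 0 = 0.
      by apply/eqP; apply: contraT => ?; case: nphi; exists phi.
    have qE (A : 'M[K]_3) (i j : 'I_3) : ((delta_mx 0 i : 'rV_3) *m A *m (delta_mx 0 j : 'rV_3)^T) 0 0 = A i j.
      by rewrite -rowE trmx_delta -colE !mxE.
    rewrite form2_0; apply/matrixP => i j; rewrite [RHS]mxE.
    have := Q (delta_mx 0 i + delta_mx 0 j); rewrite [(_ + _)^T]linearD /= mulmxDl mulmxDl !mulmxDr.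
    have addE (A B : 'M[K]_1) : (A + B) 0 0 = A 0 0 + B 0 0 by rewrite mxE.
    rewrite !addE !qE -(qE _ i i) Q -(qE _ j j) Q add0r addr0.
    have -> : form2 w t j i = form2 w t i j by rewrite -{1}sym mxE.
    by rewrite -mulr2n => /eqP; rewrite mulrn_eq0 => /eqP.
  have phi0 : phi != 0 by apply: contraNneq phiF => ->; rewrite !mul0mx mxE.
  have [M [Mf Mphi]] := exists_orth phi0; pose x := (row 0 M)^T.
  have x0 : row 0 M != 0.
    apply: contraTneq Mf => r0; apply/negP => /row_freeP [P HP].
    have := congr1 (row 0) HP; rewrite row_mul r0 mul0mx row1 => /matrixP /(_ 0 0).
    by rewrite !mxE => /eqP; rewrite eq_sym oner_eq0.
  have px : phi *m x = 0 by rewrite -[phi]trmxK -trmx_mul -row_mul Mphi; apply/matrixP => i j; rewrite !mxE.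
  pose of_form_l : {linear 'M[K]_3 -> T2 K} := HB.pack of_form (GRing.isLinear.Build _ _ _ _ _ of_form_linear).
  pose A (s : K) := s *: 1%:M + x *m phi.
  exists (fun s => of_form (A s *m form2 w t *m (A s)^T)); split.
  + apply: (polycurve_lin of_form_l).
    have HA : polycurve A by apply: polycurve_add; [apply: polycurve_scale|]; exact: polycurve_cst.
    apply: (polycurve_bilin (f := fun B C : 'M[K]_3 => B *m form2 w t *m C^T)) => //.
    * by move=> B a C D; rewrite linearP /= mulmxDr -scalemxAr.
    * by move=> B a C D; rewrite !mulmxDl -!scalemxAl.
  + split; first exact: of_form_V2.
    rewrite of_formK /A scale0r add0r trmx_mul.
    have -> : x *m phi *m form2 w t *m (phi^T *m x^T) = ((phi *m form2 w t *m phi^T) 0 0) *: (x *m x^T).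
      rewrite -!mulmxA [phi *m (_ *m (_ *m _))]mulmxA [phi *m form2 w t *m _]mulmxA.
      by rewrite {1}[phi *m form2 w t *m phi^T]mx11_scalar mul_scalar_mx -scalemxAr mulmxA.
    have [m [m0 Hm]] := sqrt_scale phiF x0; exists m; split=> //.
    by rewrite -Hm /x trmxK.
  + move=> s s0; exists (transvection_pair x phi s^-1), (s ^+ 2); split.
    * exact: transvection_pair_SO.
    * by rewrite expf_neq0.
    apply: form2_inj; [exact: of_form_V2|by apply: V2Z; exact: V2_act_V2|].
    rewrite of_formK form2Z form2_transvection //.
    have -> : A s = s *: transvection x phi s^-1 by rewrite /A /transvection scalerDr scalerA mulfV // scale1r.
    by rewrite [(s *: _)^T]linearZ /= -!scalemxAl -scalemxAr scalerA.
Qed.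

End Case2Theorem.

(** * The case a = 4 *)

Lemma prod_ord6 (R : comNzRingType) (F : 'I_6 -> R) :
  \prod_j F j = \prod_(i < 3) (F (inord i.*2) * F (inord i.*2.+1)).
Proof.
rewrite !big_ord_recl !big_ord0 !mulr1 /= !mulrA.
by congr (F _ * F _ * F _ * F _ * F _ * F _); apply/val_inj; rewrite /= inordK.
Qed.

Section SymplecticBasis.
Variable K : numClosedFieldType.

Lemma pfaffian6_unit (w : 'M[K]_6) : w^T = - w -> pfaffian6 w != 0 -> w \in unitmx.
Proof.
move=> wT; apply: contraNT => nu; rewrite /pfaffian6 mulf_eq0; apply/orP; left; apply/eqP.
have [v [v0 vw]] : exists v : 'rV[K]_6, v != 0 /\ v *m w = 0.
  have : kermx w != 0 by rewrite kermx_eq0 row_free_unit.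
  by case/rowV0Pn => v /sub_kermxP vw v0; exists v.
have wv : w *m v^T = 0 by rewrite -[w]opprK -wT mulNmx -trmx_mul vw trmx0 oppr0.
have [u uv] : exists u : 'rV[K]_6, u *m v^T = 1.
  have /row_freeP [P HP] : row_free v by rewrite /row_free rank_rV v0.
  by exists P^T; rewrite -trmx_mul HP trmx1.
pose P : 'M[K]_6 := 1%:M - v^T *m u.
have wP : w *m P = w by rewrite mulmxBr mulmx1 mulmxA wv mul0mx subr0.
have PwP : P^T *m w *m P = w.
  by rewrite -mulmxA wP -[w in X in X = _]opprK -wT mulmxN -trmx_mul wP wT opprK.
have dP : \det P = 0.
  apply/eqP; apply: contraT; rewrite -unitfE -unitmxE => uP.
  have Pv : P *m v^T = 0 by rewrite mulmxBl mul1mx -mulmxA uv mulmx1 subrr.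
  have := v0; rewrite -[v]trmxK -[v^T](mulKmx uP) Pv mulmx0 trmx0 eqxx //.
pose ij : finType := ('I_6 * 'I_6)%type.
have prodE (s : 'S_6) : \prod_(i < 3) w (s (inord i.*2)) (s (inord i.*2.+1)) =
    \sum_(g : {ffun 'I_3 -> ij}) (\prod_i w (g i).1 (g i).2) *
      \prod_i (P (g i).1 (s (inord i.*2)) * P (g i).2 (s (inord i.*2.+1))).
  transitivity (\prod_(i < 3) \sum_(p : ij) w p.1 p.2 * (P p.1 (s (inord i.*2)) * P p.2 (s (inord i.*2.+1)))).
    apply: eq_bigr => i _; rewrite -{1}PwP mxE.
    under eq_bigr => b _ do rewrite mxE mulr_suml.
    rewrite exchange_big pair_big /=; apply: eq_bigr => -[a b] _ /=.
    by rewrite mxE; ring.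
  by rewrite bigA_distr_bigA; apply: eq_bigr => g _; rewrite big_split.
under eq_bigr => s _ do rewrite prodE mulr_sumr.
rewrite exchange_big big1 // => g _.
pose f (j : 'I_6) : 'I_6 := if odd j then (g (inord j./2)).2 else (g (inord j./2)).1.
have D0 : \det (rowsub f P) = 0 by rewrite -[P]mul1mx -mul_rowsub_mx det_mulmx dP mulr0.
transitivity ((\prod_i w (g i).1 (g i).2) * \det (rowsub f P)); last by rewrite D0 mulr0.
rewrite /determinant mulr_sumr; apply: eq_bigr => s _.
rewrite mulrCA; congr (_ * (_ * _)); rewrite prod_ord6; apply: eq_bigr => i _.
rewrite !mxE /f !inordK; last 2 first.
- by case: i => [[|[|[|]]]].
- by case: i => [[|[|[|]]]].
by rewrite /= odd_double /= uphalf_double doubleK inord_val.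
Qed.

Variable w : 'M[K]_6.
Hypotheses (wT : w^T = - w) (wu : w \in unitmx).

Lemma form_tr m n (A : 'M[K]_(6, m)) (B : 'M[K]_(6, n)) :
  (A^T *m w *m B)^T = - (B^T *m w *m A).
Proof. by rewrite !trmx_mul trmxK wT mulNmx mulmxN mulmxA. Qed.

Lemma form_self (x : 'cV[K]_6) : x^T *m w *m x = 0.
Proof.
have := form_tr x x; rewrite [x^T *m w *m x]mx11_scalar tr_scalar_mx.
set a := (X in X%:M); move=> /matrixP /(_ 0 0); rewrite !mxE => /eqP.
by rewrite eqxx mulr1n -subr_eq0 opprK -mulr2n mulrn_eq0 /= => /eqP ->; apply/matrixP => i j; rewrite !mxE mul0rn.
Qed.

Lemma exists_isotropic k : (k <= 3)%N ->
  exists A : 'M[K]_(k, 6), row_free A /\ A *m w *m A^T = 0.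
Proof.
elim: k => [|k IH] k3; first by exists 0; rewrite /row_free mxrank0 mul0mx mul0mx.
have [A [Af A0]] := IH (ltnW k3).
pose N := kermx (w *m A^T).
have [x xN xA] : exists2 x : 'rV_6, (x <= N)%MS & ~~ (x <= A)%MS.
  have : ~~ (N <= A)%MS.
    apply/negP => NA; have := mxrankS NA.
    rewrite mxrank_ker (eqP Af) -mxrank_tr trmx_mul trmxK.
    rewrite mxrankMfree ?row_free_unit ?unitmx_tr // (eqP Af).
    by rewrite leq_subLR; case: k k3 {IH A Af A0 N NA} => [|[|[|]]].
  by case/row_subPn => i ni; exists (row i N); rewrite ?row_sub.
have xwA : x *m w *m A^T = 0 by rewrite -mulmxA; apply/sub_kermxP.
have Awx : A *m w *m x^T = 0.
  by have := form_tr x^T A^T; rewrite !trmxK xwA trmx0 => /esym/eqP; rewrite oppr_eq0 => /eqP.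
have xwx : x *m w *m x^T = 0 by have := form_self x^T; rewrite trmxK.
have xA0 : col_mx x A *m w *m (col_mx x A)^T = 0.
  rewrite tr_col_mx -mulmxA mul_mx_row mul_col_mx !mul_mx_row !mulmxA xwx xwA Awx A0.
  by rewrite !row_mx0 col_mx0.
exists (col_mx x A); split; last exact: xA0.
  have := mxrank_leqif_sup (addsmxSr x A); rewrite (eqP Af) => -[le iff].
  have nle : ~~ (x + A <= A)%MS by rewrite addsmx_sub (negPf xA).
  rewrite -iff addsmxE in nle; rewrite addsmxE in le.
  by rewrite /row_free eqn_leq rank_leq_row /= ltn_neqAle nle le.
Qed.

Lemma symplectic_basis : exists E F : 'M[K]_(6, 3),
  [/\ E^T *m w *m E = 0, F^T *m w *m F = 0, E^T *m w *m F = 1%:M & F^T *m w *m E = - 1%:M].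
Proof.
have [A [Af A0]] := exists_isotropic (leqnn 3); pose E := A^T.
have [D HD] : exists D : 'M[K]_(6, 3), A *m w *m D = 1%:M.
  by apply/row_freeP; rewrite /row_free mxrankMfree ?row_free_unit.
have DE : D^T *m w *m E = - 1%:M.
  by rewrite /E -[LHS]opprK -(form_tr A^T D) trmxK HD trmx1.
pose Q := D^T *m w *m D; pose X := 2%:R^-1 *: Q.
have QT : Q^T = - Q by exact: form_tr.
have XT : X^T = - X by rewrite /X linearZ /= QT scalerN.
have EE : E^T *m w *m E = 0 by rewrite trmxK.
have ED : E^T *m w *m D = 1%:M by rewrite trmxK.
have EF : E^T *m w *m (D + E *m X) = 1%:M by rewrite mulmxDr ED mulmxA EE mul0mx addr0.
exists E, (D + E *m X); split=> //.
- rewrite [(D + _)^T]linearD /= trmx_mul XT !mulmxDl mulmxDr -/Q [D^T *m w *m (E *m X)]mulmxA DE.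
  rewrite -!(mulmxA (- X)) EF mulmx1 mulNmx mul1mx.
  by rewrite -addrA -opprD -mulr2n -scaler_nat /X scalerA mulfV ?pnatr_eq0 // scale1r subrr.
- by rewrite -[LHS]opprK -form_tr EF trmx1.
Qed.

End SymplecticBasis.

Section TensorEvaluation.
Variables (K : numClosedFieldType) (k n : nat).
Implicit Types (t u : tensor K k n).
Local Notation idx := {ffun 'I_k -> 'I_n}.

Definition tensor_eval t (U : 'M[K]_(n, k)) : K := \sum_(h : idx) t h * \prod_i U (h i) i.

Lemma tensor_eval_wedge (A : 'M[K]_(k, n)) U : tensor_eval (wedge A) U = \det (A *m U).
Proof. by rewrite det_mulmx_expand. Qed.

Lemma tensor_eval_linear a t u U :
  tensor_eval (a *: t + u) U = a * tensor_eval t U + tensor_eval u U.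
Proof.
rewrite /tensor_eval mulr_sumr -big_split; apply: eq_bigr => h _ /=.
by rewrite !ffunE /GRing.scale /= mulrDl mulrA.
Qed.

Lemma ext_sum_wedge t (M : 'M[K]_(k, n)) : ext_power t ->
  \sum_(h : idx) t h * wedge M h = k`!%:R * tensor_eval t M^T.
Proof.
move=> Ht; transitivity (\sum_(s : 'S_k) tensor_eval t M^T); last first.
  by rewrite sumr_const card_Sn mulr_natl.
under eq_bigr => h _ do rewrite ffunE /determinant mulr_sumr.
rewrite exchange_big; apply: eq_bigr => s _ /=.
rewrite [RHS](reindex_ffun_perm s); apply: eq_bigr => h _.
rewrite Ht mulrCA mulrA; congr (_ * _); apply: eq_bigr => i _.
by rewrite !mxE ffunE.
Qed.

Lemma ext_expand t : ext_power t ->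
  k`!%:R *: t = \sum_(h : idx) t h *: wedge (rowsub h (1%:M : 'M[K]_n)).
Proof.
move=> Ht; apply/ffunP => f; rewrite sum_ffunE ffunE /GRing.scale /=.
transitivity (\sum_(h : idx) t h * wedge (rowsub f (1%:M : 'M[K]_n)) h); last first.
  apply: eq_bigr => h _; rewrite !ffunE /GRing.scale /= -det_tr; congr (_ * \det _).
  by apply/matrixP => i j; rewrite !mxE eq_sym.
rewrite (ext_sum_wedge _ Ht); congr (_ * _); rewrite /tensor_eval (bigD1 f) //= big1 => [|i _]; last first.
  by rewrite !mxE eqxx.
rewrite mulr1 big1 ?addr0 // => h hf.
have [i hi] : exists i, h i != f i.
  by apply/existsP; apply: contraR hf; rewrite negb_exists => /forallP H; apply/eqP/ffunP => i; have := H i; rewrite negbK => /eqP.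
by rewrite (bigD1 i) //= !mxE [f i == _]eq_sym (negPf hi) mul0r mulr0.
Qed.

Lemma tensor_act_linear (g : 'M[K]_n) : linear (@tensor_act K k n g).
Proof.
move=> a t u; apply/ffunP => f; rewrite !ffunE /GRing.scale /= mulr_sumr -big_split.
by apply: eq_bigr => h _; rewrite /= !ffunE /GRing.scale /= mulrDl mulrA.
Qed.

Lemma tensor_act_sum (g : 'M[K]_n) (I : finType) (c : I -> K) (T : I -> tensor K k n) :
  tensor_act g (\sum_i c i *: T i) = \sum_i c i *: tensor_act g (T i).
Proof.
pose l : {linear tensor K k n -> tensor K k n} :=
  HB.pack (@tensor_act K k n g) (GRing.isLinear.Build _ _ _ _ _ (@tensor_act_linear g)).
transitivity (l (\sum_i c i *: T i)) => //; rewrite linear_sum; apply: eq_bigr => i _.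
by rewrite linearZ.
Qed.

Lemma tensor_actZ (g : 'M[K]_n) a t : tensor_act g (a *: t) = a *: tensor_act g t.
Proof.
apply/ffunP => f; rewrite !ffunE /GRing.scale /= mulr_sumr.
by apply: eq_bigr => h _; rewrite /= !ffunE /GRing.scale /= mulrA.
Qed.

Lemma fact_neq0 : (k`!%:R : K) != 0.
Proof. by rewrite pnatr_eq0 -lt0n fact_gt0. Qed.

Lemma tensor_act_factor t (U : 'M[K]_(n, k)) (A : 'M[K]_(k, n)) : ext_power t ->
  tensor_act (U *m A) t = tensor_eval t U *: wedge A.
Proof.
move=> Ht; apply: (scalerI fact_neq0); rewrite -tensor_actZ (ext_expand Ht) tensor_act_sum.
transitivity (\sum_(h : idx) (t h * wedge U^T h) *: wedge A).
  apply: eq_bigr => h _; rewrite tensor_act_wedge -scalerA; congr (_ *: _).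
  rewrite mulmxA mul_rowsub_mx mul1mx wedge_mul; congr (_ *: _).
  rewrite ffunE -det_tr; congr (\det _).
  by apply/matrixP => i j; rewrite !mxE.
by rewrite -scaler_suml (ext_sum_wedge _ Ht) trmxK scalerA.
Qed.

Lemma tensor_act_comp (g h : 'M[K]_n) t : tensor_act g (tensor_act h t) = tensor_act (h *m g) t.
Proof.
apply/ffunP => f; rewrite !ffunE.
under eq_bigr => l _ do rewrite ffunE mulr_suml.
rewrite exchange_big; apply: eq_bigr => m _ /=.
under eq_bigr => l _ do rewrite -mulrA -big_split.
rewrite -mulr_sumr; congr (_ * _).
rewrite -(bigA_distr_bigA (fun i j => h (m i) j * g j (f i))).
by apply: eq_bigr => i _; rewrite mxE.
Qed.

Lemma tensor_act1 t : tensor_act (1%:M : 'M[K]_n) t = t.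
Proof.
apply/ffunP => f; rewrite ffunE (bigD1 f) //= big1 => [|i _]; last by rewrite mxE eqxx.
rewrite mulr1 big1 ?addr0 // => h hf.
have [i hi] : exists i, h i != f i.
  by apply/existsP; apply: contraR hf; rewrite negb_exists => /forallP H; apply/eqP/ffunP => i; have := H i; rewrite negbK => /eqP.
by rewrite (bigD1 i) //= !mxE (negPf hi) mul0r mulr0.
Qed.

Lemma tensor_act_scale a (g : 'M[K]_n) t : tensor_act (a *: g) t = a ^+ k *: tensor_act g t.
Proof.
apply/ffunP => f; rewrite !ffunE /GRing.scale /= mulr_sumr; apply: eq_bigr => h _.
under eq_bigr => i _ do rewrite mxE.
by rewrite big_split prodr_const card_ord /=; ring.
Qed.

End TensorEvaluation.

Section TensorCurves.
Variable K : numClosedFieldType.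

Lemma polycurve_sum (V : lmodType K) (I : Type) (r : seq I) (p : I -> K -> V) :
  (forall i, polycurve (p i)) -> polycurve (fun s => \sum_(i <- r) p i s).
Proof.
move=> Hp; elim: r => [|i r IH].
  by under eq_fun do rewrite big_nil; exact: polycurve_cst.
under eq_fun do rewrite big_cons; exact: polycurve_add.
Qed.

Lemma polycurve_prod (I : Type) (r : seq I) (p : I -> K -> K^o) :
  (forall i, polycurve (p i)) -> polycurve (fun s => \prod_(i <- r) (p i s : K) : K^o).
Proof.
move=> Hp; elim: r => [|i r IH].
  by under eq_fun do rewrite big_nil; exact: polycurve_cst.
under eq_fun do rewrite big_cons.
apply: (polycurve_bilin (f := fun x y : K^o => (x : K) * y : K^o)) => // u a x y.
- by rewrite mulrDr /GRing.scale /= mulrCA.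
- by rewrite mulrDl /GRing.scale /= mulrA.
Qed.

Lemma polycurve_ffun (D : finType) (p : K -> {ffun D -> K^o}) :
  (forall d, polycurve (fun s => p s d)) -> polycurve p.
Proof.
move=> Hp; have -> : p = fun s => \sum_d (p s d : K) *: ([ffun d' => (d' == d)%:R] : {ffun D -> K^o}).
  apply/funext => s; apply/ffunP => d; rewrite sum_ffunE (bigD1 d) //= !ffunE eqxx.
  rewrite big1 ?addr0 /GRing.scale /= ?mulr1 // => d' nd.
  by rewrite !ffunE eq_sym (negPf nd) /GRing.scale /= mulr0.
apply: polycurve_sum => d; apply: (polycurve_bilin (f := fun (x : K^o) y => (x : K) *: y)) => //.
- by move=> u a x y; rewrite scalerDr !scalerA mulrC.
- by move=> u a x y; exact: (etrans (scalerDl _ _ _) (congr1 (+%R^~ _) (esym (scalerA _ _ _)))).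
- exact: polycurve_cst.
Qed.

Lemma polycurve_tensor_act k n (A : K -> 'M[K]_n) (t : tensor K k n) :
  polycurve A -> polycurve (fun s => tensor_act (A s) t).
Proof.
move=> HA; apply: polycurve_ffun => f; under eq_fun do rewrite ffunE.
apply: polycurve_sum => h.
apply: (polycurve_bilin (f := fun x y : K^o => (x : K) * y : K^o)).
- by move=> u a x y; rewrite mulrDr /GRing.scale /= mulrCA.
- by move=> u a x y; rewrite mulrDl /GRing.scale /= mulrA.
- exact: polycurve_cst.
apply: polycurve_prod => i.
pose c (M : 'M[K]_n) : K^o := M (h i) (f i).
have cl : linear c by move=> a x y; rewrite /c !mxE.
pose l : {linear 'M[K]_n -> K^o} := HB.pack c (GRing.isLinear.Build _ _ _ _ _ cl).
exact: (polycurve_lin l HA).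
Qed.

End TensorCurves.

Section Trilinear3.
Variables (K : numClosedFieldType) (n : nat) (t : tensor K 3 n).
Local Notation cV := 'cV[K]_n.

Definition eval3 (x y z : cV) : K :=
  \sum_(h : {ffun 'I_3 -> 'I_n}) t h * (x (h 0) 0 * y (h 1) 0 * z (h 2) 0).

Lemma prod_ord3 (F : 'I_3 -> K) : \prod_i F i = F 0 * F 1 * F 2.
Proof.
rewrite !big_ord_recl big_ord0 mulr1 mulrA; congr (F _ * F _ * F _); exact/val_inj.
Qed.

Lemma eval3_cols (U : 'M[K]_(n, 3)) : eval3 (col 0 U) (col 1 U) (col 2 U) = tensor_eval t U.
Proof. by apply: eq_bigr => h _; rewrite prod_ord3 !mxE. Qed.

Lemma eval3D1 x x' y z : eval3 (x + x') y z = eval3 x y z + eval3 x' y z.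
Proof. by rewrite -big_split; apply: eq_bigr => h _ /=; rewrite !mxE; ring. Qed.
Lemma eval3D2 x y y' z : eval3 x (y + y') z = eval3 x y z + eval3 x y' z.
Proof. by rewrite -big_split; apply: eq_bigr => h _ /=; rewrite !mxE; ring. Qed.
Lemma eval3D3 x y z z' : eval3 x y (z + z') = eval3 x y z + eval3 x y z'.
Proof. by rewrite -big_split; apply: eq_bigr => h _ /=; rewrite !mxE; ring. Qed.
Lemma eval3Z1 a x y z : eval3 (a *: x) y z = a * eval3 x y z.
Proof. by rewrite /eval3 mulr_sumr; apply: eq_bigr => h _ /=; rewrite !mxE; ring. Qed.
Lemma eval3Z2 a x y z : eval3 x (a *: y) z = a * eval3 x y z.
Proof. by rewrite /eval3 mulr_sumr; apply: eq_bigr => h _ /=; rewrite !mxE; ring. Qed.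
Lemma eval3Z3 a x y z : eval3 x y (a *: z) = a * eval3 x y z.
Proof. by rewrite /eval3 mulr_sumr; apply: eq_bigr => h _ /=; rewrite !mxE; ring. Qed.

Hypothesis ext : ext_power t.

Lemma eval3C12 x y z : eval3 y x z = - eval3 x y z.
Proof.
rewrite /eval3 (reindex_ffun_perm (tperm 0 1)) -sumrN; apply: eq_bigr => h _.
rewrite ext odd_tperm /= expr1 !ffunE tpermL tpermR tpermD //; ring.
Qed.

Lemma eval3C23 x y z : eval3 x z y = - eval3 x y z.
Proof.
rewrite /eval3 (reindex_ffun_perm (tperm 1 2)) -sumrN; apply: eq_bigr => h _.
rewrite ext odd_tperm /= expr1 !ffunE tpermL tpermR tpermD //; ring.
Qed.

Lemma eval3_12 x z : eval3 x x z = 0.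
Proof.
have := eval3C12 x x z => /eqP; rewrite -subr_eq0 opprK -mulr2n mulrn_eq0 /=.
by move/eqP.
Qed.

Lemma eval3_eq0 : (forall x y z, eval3 x y z = 0) -> t = 0.
Proof.
move=> H; apply/ffunP => f; rewrite ffunE -[RHS](H (delta_mx (f 0) 0) (delta_mx (f 1) 0) (delta_mx (f 2) 0)).
rewrite /eval3 (bigD1 f) //= !mxE !eqxx !mulr1 big1 ?addr0 // => h hf; rewrite !mxE !eqxx !andbT.
have [i hi] : exists i, h i != f i.
  by apply/existsP; apply: contraR hf; rewrite negb_exists => /forallP H'; apply/eqP/ffunP => i; have := H' i; rewrite negbK => /eqP.
by elim/ord3P: i hi => /negPf ->; rewrite ?(mulr0, mul0r).
Qed.

End Trilinear3.

Section SymplecticTests.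
Variables (K : numClosedFieldType) (w : 'M[K]_6) (E F : 'M[K]_(6, 3)).
Hypotheses (wu : w \in unitmx) (EE : E^T *m w *m E = 0) (FF : F^T *m w *m F = 0).
Hypotheses (EF : E^T *m w *m F = 1%:M) (FE : F^T *m w *m E = - 1%:M).

Lemma symplectic_inv : invmx w = F *m E^T - E *m F^T.
Proof.
pose P : 'M[K]_(3 + 3) := row_mx E F.
pose P' : 'M[K]_(3 + 3) := col_mx (- F^T *m w) (E^T *m w).
have PP : P' *m P = 1%:M.
  rewrite mul_col_mx !mul_mx_row !mulNmx FE FF EE EF opprK oppr0.
  by rewrite [RHS](@scalar_mx_block _ 3 3 1) [RHS]block_mxEv.
have := mulmx1C PP; rewrite mul_row_col !mulmxA mulmxN addrC -mulmxDl => Q.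
by rewrite -[RHS]mulmx1 -(mulmxV wu) mulmxA Q mul1mx.
Qed.

Lemma symplectic_span (L : 'cV[K]_6 -> K) :
  (forall x y, L (x + y) = L x + L y) -> (forall a x, L (a *: x) = a * L x) ->
  (forall i, L (col i E) = 0) -> (forall i, L (col i F) = 0) -> forall x, L x = 0.
Proof.
move=> LD LZ LE LF x.
have L0 : L 0 = 0 by rewrite -(scale0r 0) LZ mul0r.
have Lmul (A : 'M[K]_(6, 3)) (a : 'cV[K]_3) : (forall i, L (col i A) = 0) -> L (A *m a) = 0.
  move=> LA; have -> : A *m a = \sum_i a i 0 *: col i A.
    apply/matrixP => p q; rewrite mxE summxE; apply: eq_bigr => i _; rewrite !mxE mulrC.
    by rewrite (ord1 q).
  by rewrite (big_morph L LD L0) big1 // => i _; rewrite LZ LA mulr0.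
rewrite -[x](mulKmx wu) symplectic_inv mulmxBl -!mulmxA LD -scaleN1r LZ !Lmul // mulr0 addr0 //.
Qed.

Definition contraction (t : tensor K 3 6) (z : 'cV[K]_6) : K :=
  \sum_(h : {ffun 'I_3 -> 'I_6}) t h * (invmx w (h 0) (h 1) * z (h 2) 0).

Lemma contraction_symplectic t z : ext_power t ->
  contraction t z = - 2%:R * \sum_i eval3 t (col i E) (col i F) z.
Proof.
move=> ext.
transitivity (\sum_i (eval3 t (col i F) (col i E) z - eval3 t (col i E) (col i F) z)).
  rewrite /contraction symplectic_inv.
  under eq_bigr => h _ do rewrite !mxE.
  rewrite /eval3; under [RHS]eq_bigr => i _ do rewrite -sumrB.
  rewrite exchange_big; apply: eq_bigr => h _ /=.
  rewrite -sumrB mulr_suml mulr_sumr; apply: eq_bigr => i _.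
  by rewrite !mxE; ring.
rewrite mulr_sumr; apply: eq_bigr => i _; rewrite eval3C12 //; ring.
Qed.

(* With x_i = E e_i and y_i = F e_i, the 14 test Lagrangians are the 8 spanned by an x_i
   or y_i for each i, and the 6 spanned by x_i + y_j, x_j + y_i and x_k or y_k. *)
Definition test_pair : Type := ({ffun 'I_3 -> bool} + bool * 'I_3)%type.

Definition testX (tau : test_pair) : 'M[K]_3 :=
  match tau with
  | inl b => \matrix_(i, j) ((i == j) && ~~ b j)%:R
  | inr (b, k) => \matrix_(i, j) ((i == j) && ~~ ((j == k) && b))%:R
  end.

Definition testY (tau : test_pair) : 'M[K]_3 :=
  match tau with
  | inl b => \matrix_(i, j) ((i == j) && b j)%:R
  | inr (b, k) => \matrix_(i, j) (if (i == k) || (j == k) then (i == j) && b else i != j)%:R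
  end.

Definition test (tau : test_pair) : 'M[K]_(6, 3) := E *m testX tau + F *m testY tau.

Lemma test_ext_eq0 t : ext_power t -> (forall z, contraction t z = 0) ->
  (forall tau, tensor_eval t (test tau) = 0) -> t = 0.
Proof.
move=> ext ctr0 H.
pose p (b : bool) i := if b then col i F else col i E.
pose D i z := eval3 t (p false i) (p true i) z.
have colT tau j : col j (test tau) = \sum_i (testX tau i j *: col i E + testY tau i j *: col i F).
  rewrite big_split; apply/matrixP => a c; rewrite !mxE !summxE; congr (_ + _).
    by apply: eq_bigr => i _; rewrite !mxE mulrC.
  by apply: eq_bigr => i _; rewrite !mxE mulrC.
have N1 b0 b1 b2 : eval3 t (p b0 0) (p b1 1) (p b2 2) = 0.
  pose b : {ffun 'I_3 -> bool} := [ffun i => if i == 0 then b0 else if i == 1 then b1 else b2].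
  rewrite -(H (inl b)) -eval3_cols; congr eval3; rewrite colT sum_ord3 !mxE /b !ffunE /=.
  - by case: (b0); rewrite /= ?scale0r ?scale1r ?addr0 ?add0r.
  - by case: (b1); rewrite /= ?scale0r ?scale1r ?addr0 ?add0r.
  - by case: (b2); rewrite /= ?scale0r ?scale1r ?addr0 ?add0r.
have N1' b0 b1 b2 : [/\ eval3 t (p b0 0) (p b1 1) (p b2 2) = 0, eval3 t (p b1 1) (p b0 0) (p b2 2) = 0,
    eval3 t (p b0 0) (p b2 2) (p b1 1) = 0, eval3 t (p b1 1) (p b2 2) (p b0 0) = 0 &
    eval3 t (p b2 2) (p b0 0) (p b1 1) = 0 /\ eval3 t (p b2 2) (p b1 1) (p b0 0) = 0].
  have := N1 b0 b1 b2 => N.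
  have N' : eval3 t (p b1 1) (p b0 0) (p b2 2) = 0 by rewrite eval3C12 // N oppr0.
  have N'' : eval3 t (p b0 0) (p b2 2) (p b1 1) = 0 by rewrite eval3C23 // N oppr0.
  have N3 : eval3 t (p b2 2) (p b0 0) (p b1 1) = 0 by rewrite eval3C12 // N'' oppr0.
  split=> //; first by rewrite eval3C23 // N' oppr0.
  by split=> //; rewrite eval3C23 // N3 oppr0.
have sumD z : D 0 z + D 1 z + D 2 z = 0.
  have := ctr0 z; rewrite contraction_symplectic // sum_ord3 => /eqP.
  by rewrite mulf_eq0 oppr_eq0 pnatr_eq0 /= => /eqP.
have Dk b i : D i (p b i) = 0.
  rewrite /D /p; case: b; last by rewrite eval3C12 // eval3C23 // eval3C12 // eval3C23 // eval3_12 // !oppr0.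
  by rewrite eval3C12 // eval3C23 // eval3_12 // !oppr0.
have colE b k : [/\ col 0 (test (inr (b, k))) = (if k == 0 then p b 0 else p false 0 + p true (if k == 1 then 2 else 1)),
    col 1 (test (inr (b, k))) = (if k == 1 then p b 1 else p false 1 + p true (if k == 0 then 2 else 0)) &
    col 2 (test (inr (b, k))) = (if k == 2 then p b 2 else p false 2 + p true (if k == 0 then 1 else 0))].
  by split; rewrite colT sum_ord3 !mxE; elim/ord3P: k; case: b; rewrite /= ?scale0r ?scale1r ?addr0 ?add0r // addrC.
have Tst b k : eval3 t (col 0 (test (inr (b, k)))) (col 1 (test (inr (b, k)))) (col 2 (test (inr (b, k)))) = 0.
  by rewrite eval3_cols.
have pE i : col i E = p false i by [].
have pF i : col i F = p true i by [].
clearbody p.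
have M2 b : D 0 (p b 2) = D 1 (p b 2).
  have [_ N _ _ _] := N1' true true b; have := Tst b 2; have [-> -> ->] := colE b 2.
  rewrite /= !eval3D1 !eval3D2. rewrite (N1 false false) N (eval3C12 ext (p false 1) (p true 1)) add0r addr0 => /eqP.
  by rewrite subr_eq0 => /eqP.
have M1 b : D 0 (p b 1) = D 2 (p b 1).
  have [_ _ _ _ [_ N]] := N1' true b true; have := Tst b 1; have [-> -> ->] := colE b 1.
  rewrite /= !eval3D1 !eval3D3 N1 N (eval3C23 ext (p false 0) (p true 0)) add0r addr0.
  rewrite (eval3C23 ext (p true 2)) (eval3C12 ext (p false 2)) opprK => /eqP.
  by rewrite addrC subr_eq0 => /eqP.
have M0 b : D 1 (p b 0) = D 2 (p b 0).
  have [_ _ N _ _] := N1' b true true; have := Tst b 0; have [-> -> ->] := colE b 0.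
  rewrite /= !eval3D2 !eval3D3 N1 N add0r addr0.
  rewrite (eval3C12 ext (p false 1)) (eval3C23 ext (p false 1)) opprK.
  rewrite (eval3C12 ext (p true 2)) (eval3C23 ext (p true 2)) opprK (eval3C12 ext (p false 2)) => /eqP.
  by rewrite subr_eq0 => /eqP.
have D0 i b k : D i (p b k) = 0.
  have dbl (a c d : K) : a + c + d = 0 -> d = 0 -> a = c -> a = 0.
    by move=> + d0 ac; rewrite d0 addr0 -ac -mulr2n => /eqP; rewrite mulrn_eq0 => /eqP.
  have := sumD (p b k); elim/ord3P: k => S.
  - have D1 : D 1 (p b 0) = 0 by apply: (dbl _ _ _ _ (Dk b 0) (M0 b)); rewrite -S; ring.
    by elim/ord3P: i => //; rewrite -M0.
  - have D1 : D 0 (p b 1) = 0 by apply: (dbl _ _ _ _ (Dk b 1) (M1 b)); rewrite -S; ring.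
    by elim/ord3P: i => //; rewrite -M1.
  - have D1 : D 0 (p b 2) = 0 by exact: (dbl _ _ _ S (Dk b 2) (M2 b)).
    by elim/ord3P: i => //; rewrite -M2.
have pz i b1 b2 b k : eval3 t (p b1 i) (p b2 i) (p b k) = 0.
  case: b1 b2 => [] []; rewrite ?eval3_12 //; last exact: D0.
  by rewrite eval3C12 // -[eval3 _ _ _ _]/(D i (p b k)) D0 oppr0.
have allz b0 b1 b2 i j k : eval3 t (p b0 i) (p b1 j) (p b2 k) = 0.
  have [->|ij] := eqVneq i j; first exact: pz.
  have [->|jk] := eqVneq j k; first by rewrite eval3C12 // eval3C23 // pz !oppr0.
  have [->|ik] := eqVneq i k; first by rewrite eval3C23 // pz oppr0.
  move: ij jk ik; elim/ord3P: i; elim/ord3P: j; elim/ord3P: k => // _ _ _.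
  - by have [_ _ ? _ _] := N1' b0 b2 b1.
  - by have [_ ? _ _ _] := N1' b1 b0 b2.
  - by have [_ _ _ ? _] := N1' b2 b0 b1.
  - by have [_ _ _ _ [? _]] := N1' b1 b2 b0.
  - by have [_ _ _ _ [_ ?]] := N1' b2 b1 b0.
apply: (eval3_eq0 (t := t)) => x y z.
apply: (symplectic_span (L := fun x => eval3 t x y z)) => [u v|a u|i|i]; rewrite ?eval3D1 ?eval3Z1 //.
- apply: (symplectic_span (L := fun y => eval3 t (col i E) y z)) => [u v|a u|j|j]; rewrite ?eval3D2 ?eval3Z2 //.
  + by apply: (symplectic_span (L := fun z => eval3 t (col i E) (col j E) z)) => [u v|a u|k|k]; rewrite ?eval3D3 ?eval3Z3 ?pE ?pF.
  + by apply: (symplectic_span (L := fun z => eval3 t (col i E) (col j F) z)) => [u v|a u|k|k]; rewrite ?eval3D3 ?eval3Z3 ?pE ?pF.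
- apply: (symplectic_span (L := fun y => eval3 t (col i F) y z)) => [u v|a u|j|j]; rewrite ?eval3D2 ?eval3Z2 //.
  + by apply: (symplectic_span (L := fun z => eval3 t (col i F) (col j E) z)) => [u v|a u|k|k]; rewrite ?eval3D3 ?eval3Z3 ?pE ?pF.
  + by apply: (symplectic_span (L := fun z => eval3 t (col i F) (col j F) z)) => [u v|a u|k|k]; rewrite ?eval3D3 ?eval3Z3 ?pE ?pF.
Qed.

Lemma form_EF (X Y X' Y' : 'M[K]_3) :
  (E *m X + F *m Y)^T *m w *m (E *m X' + F *m Y') = X^T *m Y' - Y^T *m X'.
Proof.
have H (P Q : 'M[K]_(6, 3)) (A B : 'M[K]_3) :
  (P *m A)^T *m w *m (Q *m B) = A^T *m (P^T *m w *m Q) *m B by rewrite trmx_mul !mulmxA.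
rewrite [(_ + _)^T]linearD /= !mulmxDl !mulmxDr !H EE EF FE FF.
by rewrite !mulmx0 !mul0mx !mulmx1 add0r addr0 mulmxN mulmx1 mulNmx addrC.
Qed.

Definition hub_frame : 'M[K]_(6, 3) := E *m 1%:M + F *m 2%:R%:M.

Lemma test_isotropic tau : (test tau)^T *m w *m test tau = 0.
Proof.
rewrite form_EF; apply/matrixP => i j; rewrite !mxE !sum_ord3.
case: tau => [b|[b k]]; rewrite !mxE.
  by elim/ord3P: i; elim/ord3P: j; case: (b 0); case: (b 1); case: (b 2); rewrite /=; ring.
by elim/ord3P: i; elim/ord3P: j; elim/ord3P: k; case: b; rewrite /=; ring.
Qed.

Lemma hub_isotropic : hub_frame^T *m w *m hub_frame = 0.
Proof. by rewrite form_EF trmx1 tr_scalar_mx mul1mx mulmx1 subrr. Qed.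

Lemma test_hub tau : \det ((test tau)^T *m w *m hub_frame) != 0.
Proof.
rewrite form_EF mulmx1 mul_mx_scalar det_mx3.
have nz x k : x = k.+1%:R -> x != 0 :> K by move=> ->; rewrite pnatr_eq0.
have nz' x k : x = - k.+1%:R -> x != 0 :> K by move=> ->; rewrite oppr_eq0 pnatr_eq0.
case: tau => [b|[b k]]; rewrite !mxE.
  by case: (b 0); case: (b 1); case: (b 2); rewrite /=;
  first [apply: (nz _ 7%N); ring | apply: (nz _ 1%N); ring | apply: (nz' _ 3%N); ring | apply: (nz' _ 0%N); ring].
by elim/ord3P: k; case: b; rewrite /=; first [apply: (nz _ 5%N); ring | apply: (nz' _ 2%N); ring].
Qed.

End SymplecticTests.

Section WedgeRank.
Variables (K : numClosedFieldType) (k n : nat).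
Implicit Types (M : 'M[K]_(k, n)) (h f : {ffun 'I_k -> 'I_n}).

Lemma wedge_neq0_row_free M h : wedge M h != 0 -> row_free M.
Proof.
rewrite ffunE -unitfE -unitmxE => hu; apply/row_freeP.
exists (colsub h 1%:M *m invmx (colsub h M)).
by rewrite mulmxA mulmx_colsub mulmx1 mulmxV.
Qed.

Lemma row_free_wedge_neq0 M : row_free M -> wedge M != 0.
Proof.
move=> /row_freeP [U MU]; apply: contraTneq isT => M0.
have := tensor_eval_wedge M U; rewrite MU det1 M0 /tensor_eval big1.
  by move/esym/eqP; rewrite oner_eq0.
by move=> h _; rewrite ffunE mul0r.
Qed.

Lemma row_free_mul_unit M (g : 'M[K]_n) : g \in unitmx -> row_free (M *m g) = row_free M.
Proof. by move=> gu; rewrite /row_free mxrankMfree // row_free_unit. Qed.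

Definition substitute h p j : {ffun 'I_k -> 'I_n} := [ffun q => if q == p then j else h q].

Definition frame_at (t : tensor K k n) h : 'M[K]_(k, n) :=
  \matrix_(p, j) t (substitute h p j).

Lemma frame_at_wedge M h : frame_at (wedge M) h = \adj (colsub h M) *m M.
Proof.
apply/matrixP => p j; rewrite !mxE ffunE (expand_det_col _ p); apply: eq_bigr => q _.
rewrite !mxE ffunE eqxx mulrC; congr (_ * _); rewrite /cofactor; congr (_ * \det _).
by apply/matrixP => a b; rewrite !mxE ffunE eq_sym (negPf (neq_lift _ _)).
Qed.

Lemma wedge_scale c M : (0 < k)%N -> c != 0 ->
  exists2 P : 'M[K]_k, P \in unitmx & c *: wedge M = wedge (P *m M).
Proof.
move=> k0 c0; pose i0 := Ordinal k0; pose d := \row_(i < k) if i == i0 then c else 1.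
have dE : \det (diag_mx d) = c.
  rewrite det_diag (bigD1 i0) //= mxE eqxx big1 ?mulr1 // => i ni.
  by rewrite mxE (negPf ni).
by exists (diag_mx d); rewrite ?unitmxE ?unitfE ?wedge_mul dE.
Qed.

Lemma wedge_frame_at (t : tensor K k n) h : (0 < k)%N -> t h != 0 ->
  wedge (frame_at t h) = t h ^+ k.-1 *: t ->
  exists2 P : 'M[K]_k, P \in unitmx & t = wedge (P *m frame_at t h).
Proof.
move=> k0 th E; have c0 : t h ^+ k.-1 != 0 by rewrite expf_neq0.
have [|P Pu PE] := wedge_scale (frame_at t h) k0 (c := (t h ^+ k.-1)^-1); first by rewrite invr_eq0.
by exists P; rewrite // -PE E scalerA mulVf // scale1r.
Qed.

End WedgeRank.

Lemma form_mull0 (R : comNzRingType) m k n (D : 'M[R]_(m, k)) (X : 'M[R]_(k, n)) (B : 'M[R]_n) :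
  X *m B *m X^T = 0 -> (D *m X) *m B *m (D *m X)^T = 0.
Proof.
by move=> H; rewrite trmx_mul mulmxA -(mulmxA D X) -(mulmxA D (X *m B)) H mulmx0 mul0mx.
Qed.

Section LagrangianCone.
Variables (K : numClosedFieldType) (w : 'M[K]_6).
Hypotheses (wT : w^T = - w) (wu : w \in unitmx).

Definition lagrangian (M : 'M[K]_(3, 6)) : Prop := row_free M /\ M *m invmx w *m M^T = 0.

Definition lagrangian_cone : set (tensor K 3 6) :=
  [set t | exists2 M, lagrangian M & t = wedge M].

Let wTu : w^T \in unitmx. Proof. by rewrite unitmx_tr. Qed.

Lemma zero_locus4E : zero_locus4 w = lagrangian_cone.
Proof.
apply/seteqP; split=> t.
  move=> [M [Mf -> C0]]; exists M => //; split=> //; set C := cokermx M in C0.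
  have rC : \rank (C^T *m w) = 3.
    by rewrite mxrankMfree ?row_free_unit // mxrank_tr mxrank_coker (eqP Mf).
  have CM : (C^T *m w <= M)%MS by rewrite submxE C0.
  have /submxP [D ->] : (M <= C^T *m w)%MS.
    by have := mxrank_leqif_sup CM; rewrite rC (eqP Mf) => -[_ <-].
  by apply: form_mull0; rewrite mulmxK // (trmx_mul C^T w) trmxK wT mulNmx mulmxN mulmxA C0 oppr0.
move=> [M [Mf M0] ->]; exists M; split=> //; set C := cokermx M.
have MC : M *m C = 0 by exact: mulmx_coker.
have CK : (C^T <= kermx M^T)%MS by apply/sub_kermxP; rewrite -trmx_mul MC trmx0.
have MK : (M *m invmx w <= kermx M^T)%MS by apply/sub_kermxP.
have rM : \rank (M *m invmx w) = \rank (kermx M^T).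
  by rewrite mxrankMfree ?row_free_unit ?unitmx_inv // mxrank_ker mxrank_tr (eqP Mf).
have /submxP [D ->] : (C^T <= M *m invmx w)%MS.
  by apply: submx_trans CK _; have [_ <-] := mxrank_leqif_sup MK; rewrite rM.
by rewrite (mulmxA D) mulmxKV // -mulmxA MC mulmx0.
Qed.

Lemma lagrangian_mull P M : P \in unitmx -> lagrangian M -> lagrangian (P *m M).
Proof.
move=> Pu [Mf M0]; split.
  by rewrite /row_free eqmxMfull ?row_full_unit.
exact: form_mull0.
Qed.

Lemma lagrangian_coneZ c t : c != 0 -> lagrangian_cone t -> lagrangian_cone (c *: t).
Proof.
move=> c0 [M LM ->]; have [P Pu ->] := wedge_scale M (isT : (0 < 3)%N) c0.
by exists (P *m M) => //; exact: lagrangian_mull.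
Qed.

Lemma lagrangian_cone_neq0 t : lagrangian_cone t -> t != 0.
Proof. by move=> [M [Mf _] ->]; exact: row_free_wedge_neq0. Qed.

Lemma frame_at0 h : frame_at (0 : tensor K 3 6) h = 0.
Proof. by apply/matrixP => p j; rewrite !mxE ffunE. Qed.

Lemma lagrangian_cone_closed : zariski_closed (lagrangian_cone `|` [set 0]).
Proof.
have -> : lagrangian_cone `|` [set 0] =
    [set t | forall d : {ffun 'I_3 -> 'I_6} * {ffun 'I_3 -> 'I_6},
       wedge (frame_at t d.1) d.2 - t d.1 ^+ 2 * t d.2 = 0] `&`
    [set t | forall d : {ffun 'I_3 -> 'I_6} * ('I_3 * 'I_3),
       (frame_at t d.1 *m invmx w *m (frame_at t d.1)^T) d.2.1 d.2.2 = 0].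
  apply/seteqP; split=> t.
  - case=> [[M [Mf M0] ->]|/= ->].
    + split=> -[h d] /=; rewrite frame_at_wedge; last first.
        by rewrite form_mull0 // mxE.
      rewrite wedge_mul ffunE /GRing.scale /=; apply/eqP; rewrite subr_eq0; apply/eqP.
      congr (_ * _); rewrite [wedge M h]ffunE; set A := colsub h M.
      have [d0|d0] := eqVneq (\det A) 0.
        rewrite d0 expr0n /=; apply/eqP; apply: contraT => adj0.
        have uA : \adj A \in unitmx by rewrite unitmxE unitfE.
        have A0 : A = 0 by rewrite -[A](mulmxK uA) mul_mx_adj d0 raddf0 mul0mx.
        move: adj0; rewrite det_mx3 A0 !mxE /cofactor.
        by rewrite !det_mx2 !mxE !(mulr0, mul0r, subr0, addr0) eqxx.
      by apply: (mulfI d0); rewrite -det_mulmx mul_mx_adj det_scalar exprS.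
    + split=> -[h d] /=; rewrite frame_at0 ?mul0mx ?mxE //.
      rewrite !ffunE mulr0 subr0 (_ : colsub d 0 = 0) ?det0 //.
      by apply/matrixP => i j; rewrite !mxE.
  - move=> [H1 H2]; have [->|t0] := eqVneq t 0; first by right.
    left; have [h th] : exists h, t h != 0.
      apply/existsP; apply: contraR t0; rewrite negb_exists => /forallP t0.
      by apply/eqP/ffunP => h; rewrite ffunE; apply/eqP; have := t0 h; rewrite negbK.
    have E : wedge (frame_at t h) = t h ^+ 2 *: t.
      by apply/ffunP => f; have := H1 (h, f) => /eqP; rewrite subr_eq0 => /eqP -> ; rewrite ffunE.
    have [P Pu tE] := wedge_frame_at (isT : (0 < 3)%N) th E.
    exists (P *m frame_at t h) => //; apply: lagrangian_mull => //; split.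
      by apply: (wedge_neq0_row_free (h := h)); rewrite E ffunE mulf_neq0 // expf_neq0.
    by apply/matrixP => i j; have := H2 (h, (i, j)) => /= ->; rewrite mxE.
apply: zariski_closedI; apply: zariski_closed_zeros => -[h d] /=.
- apply: polyfun_sub; last first.
    by apply: polyfun_mul; [apply: polyfun_mul|]; exact: polyfun_ffun.
  under eq_fun do rewrite ffunE /determinant.
  apply: polyfun_sum => s; apply: polyfun_mul; first exact: polyfun_cst.
  by apply: polyfun_prod => i; under eq_fun do rewrite !mxE; exact: polyfun_ffun.
- under eq_fun do rewrite mxE.
  apply: polyfun_sum => j; under eq_fun do rewrite !mxE.
  apply: polyfun_mul; last exact: polyfun_ffun.
  by apply: polyfun_sum => i; under eq_fun do rewrite mxE;
     apply: polyfun_mul; [exact: polyfun_ffun|exact: polyfun_cst].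
Qed.

Definition similitude (g : 'M[K]_6) : Prop :=
  g \in unitmx /\ exists c, c != 0 /\ g *m invmx w *m g^T = c *: invmx w.

Lemma similitudeP g c : c != 0 -> g^T *m w *m g = c *: w -> similitude g.
Proof.
move=> c0 H.
have E : g^T *m (c^-1 *: (w *m g *m invmx w)) = 1%:M.
  by rewrite -scalemxAr !mulmxA H -scalemxAl scalerA mulVf // scale1r mulmxV.
have gTu : g^T \in unitmx by have [] := mulmx1_unit E.
split; first by rewrite -unitmx_tr.
exists c; split=> //; have := mulmx1C E.
rewrite -scalemxAl => /(congr1 (fun A => c *: (invmx w *m A))).
by rewrite -scalemxAr scalerA mulfV // scale1r mulmx1 !mulmxA mulVmx // mul1mx.
Qed.

Lemma similitude_inv g : similitude g -> similitude (invmx g).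
Proof.
move=> [gu [c [c0 H]]]; split; first by rewrite unitmx_inv.
exists c^-1; rewrite invr_eq0; split=> //.
apply: (scalerI c0); rewrite scalerA mulfV // scale1r.
rewrite scalemxAl scalemxAr -H trmx_inv !mulmxA mulVmx // mul1mx mulmxK // unitmx_tr //.
Qed.

Lemma lagrangian_mulr g M : similitude g -> lagrangian M -> lagrangian (M *m g).
Proof.
move=> [gu [c [c0 H]]] [Mf M0]; split; first by rewrite row_free_mul_unit.
rewrite trmx_mul mulmxA -(mulmxA M g) -(mulmxA M (g *m _)) H.
by rewrite -scalemxAr -scalemxAl M0 scaler0.
Qed.

Lemma lagrangian_cone_act g t : similitude g -> lagrangian_cone t -> lagrangian_cone (tensor_act g t).
Proof.
by move=> Sg [M LM ->]; rewrite tensor_act_wedge; exists (M *m g) => //; exact: lagrangian_mulr.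
Qed.

Lemma lagrangian_cone_actV g t : similitude g -> lagrangian_cone (tensor_act g t) -> lagrangian_cone t.
Proof.
move=> Sg /(lagrangian_cone_act (similitude_inv Sg)).
by rewrite tensor_act_comp mulmxV ?tensor_act1 //; case: Sg.
Qed.

Lemma SO4case_similitude g : SO4case w g -> similitude g.
Proof. by move=> /component_sub [_ [c [c0 H]]]; exact: (similitudeP c0). Qed.

End LagrangianCone.

Section Contraction.
Variables (K : numClosedFieldType) (w : 'M[K]_6).
Implicit Types (t : tensor K 3 6) (z : 'cV[K]_6).

Lemma tensor_eval_act k n (g : 'M[K]_n) (t : tensor K k n) (U : 'M[K]_(n, k)) :
  tensor_eval (tensor_act g t) U = tensor_eval t (g *m U).
Proof.
rewrite /tensor_eval; under eq_bigr => f _ do rewrite ffunE mulr_suml.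
rewrite exchange_big; apply: eq_bigr => h _ /=.
under eq_bigr => f _ do rewrite -mulrA -big_split.
rewrite -mulr_sumr -(bigA_distr_bigA (fun i j => g (h i) j * U j i)).
by congr (_ * _); apply: eq_bigr => i _; rewrite mxE.
Qed.

Definition cols3 n (x y z : 'cV[K]_n) : 'M[K]_(n, 3) :=
  \matrix_(i, j) (if j == 0 then x i 0 else if j == 1 then y i 0 else z i 0).

Lemma eval3E t x y z : eval3 t x y z = tensor_eval t (cols3 x y z).
Proof.
rewrite -eval3_cols.
by congr eval3; apply/matrixP => i j; rewrite !mxE (ord1 j).
Qed.

Lemma mulmx_cols3 m n (g : 'M[K]_(m, n)) (x y z : 'cV[K]_n) :
  g *m cols3 x y z = cols3 (g *m x) (g *m y) (g *m z).
Proof.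
apply/matrixP => i j; rewrite !mxE; case: ifP => [/eqP ->|j0]; last case: ifP => [/eqP ->|j1];
by apply: eq_bigr => l _; rewrite !mxE ?j0 ?j1 ?eqxx.
Qed.

Lemma eval3_act (g : 'M[K]_6) t x y z :
  eval3 (tensor_act g t) x y z = eval3 t (g *m x) (g *m y) (g *m z).
Proof. by rewrite !eval3E tensor_eval_act mulmx_cols3. Qed.

Lemma eval3_sum t m (P Q : 'M[K]_(6, m)) z :
  \sum_k eval3 t (col k P) (col k Q) z =
  \sum_(h : {ffun 'I_3 -> 'I_6}) t h * ((P *m Q^T) (h 0) (h 1) * z (h 2) 0).
Proof.
rewrite exchange_big; apply: eq_bigr => h _ /=.
rewrite mxE mulr_suml mulr_sumr; apply: eq_bigr => k _.
by rewrite !mxE.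
Qed.

Lemma contractionE t z :
  contraction w t z = \sum_k eval3 t (col k (invmx w)) (col k (1%:M : 'M[K]_6)) z.
Proof. by rewrite eval3_sum trmx1 mulmx1. Qed.

Lemma contraction_act c g t z : g *m invmx w *m g^T = c *: invmx w ->
  contraction w (tensor_act g t) z = c * contraction w t (g *m z).
Proof.
move=> H; rewrite contractionE; under eq_bigr => k _ do rewrite eval3_act !colEsub !mulmx_colsub -!colEsub.
rewrite eval3_sum mulmx1 H /contraction mulr_sumr; apply: eq_bigr => h _.
by rewrite mxE; ring.
Qed.

Lemma contraction_linear a t u z :
  contraction w (a *: t + u) z = a * contraction w t z + contraction w u z.
Proof.
rewrite /contraction mulr_sumr -big_split; apply: eq_bigr => h _ /=.
by rewrite !ffunE /GRing.scale /=; ring.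
Qed.

Lemma contraction_wedge (M : 'M[K]_(3, 6)) z : M *m invmx w *m M^T = 0 -> contraction w (wedge M) z = 0.
Proof.
move=> M0; pose N := M *m invmx w *m M^T; pose v := M *m z.
have NE i j : \sum_k (M *m invmx w) i k * M j k = 0.
  transitivity (N i j); last by rewrite /N M0 mxE.
  by rewrite /N [RHS]mxE; apply: eq_bigr => k _; rewrite [M^T _ _]mxE.
transitivity (\sum_k (v 2 0 * ((M *m invmx w) 0 k * M 1 k) - v 2 0 * ((M *m invmx w) 1 k * M 0 k)
  + (v 1 0 * ((M *m invmx w) 2 k * M 0 k) - v 1 0 * ((M *m invmx w) 0 k * M 2 k))
  + (v 0 0 * ((M *m invmx w) 1 k * M 2 k) - v 0 0 * ((M *m invmx w) 2 k * M 1 k)))).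
  rewrite contractionE; apply: eq_bigr => k _.
  rewrite eval3E tensor_eval_wedge mulmx_cols3 !colEsub !mulmx_colsub -!colEsub mulmx1 -/v det_mx3.
  move: (M *m invmx w) => P; rewrite !mxE /=; ring.
by rewrite !big_split /= !sumrN -!mulr_sumr !NE !mulr0 subrr !addr0.
Qed.

End Contraction.

Section SymplecticPaths.
Variables (K : numClosedFieldType) (w : 'M[K]_6).
Hypotheses (wT : w^T = - w) (wu : w \in unitmx).

Definition symplectic_path (g : 'M[K]_6) : Prop :=
  exists p : K -> 'M[K]_6,
    [/\ polycurve p, p 0 = 1%:M, p 1 = g & forall s, \det (p s) = 1 /\ (p s)^T *m w *m p s = w].

Lemma symplectic_path_SO4case g : symplectic_path g -> SO4case w g.
Proof.
move=> [p [Hp p0 <- Sp]]; rewrite /SO4case -p0; apply: component_polycurve => // s.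
have [d E] := Sp s; split=> //; exists 1; rewrite oner_eq0; split=> //.
by rewrite scale1r.
Qed.

Lemma symplectic_pathM g h : symplectic_path g -> symplectic_path h -> symplectic_path (g *m h).
Proof.
move=> [p [Hp p0 <- Sp]] [q [Hq q0 <- Sq]]; exists (fun s => p s *m q s); split=> //.
- apply: (polycurve_bilin (f := fun A B : 'M[K]_6 => A *m B)) => // A a x y.
  + by rewrite mulmxDr scalemxAr.
  + by rewrite mulmxDl scalemxAl.
- by rewrite p0 q0 mulmx1.
- move=> s; have [dp Ep] := Sp s; have [dq Eq] := Sq s; split.
    by rewrite det_mulmx dp dq mulr1.
  by rewrite trmx_mul -(mulmxA _ _ w) mulmxA -(mulmxA (q s)^T) Ep Eq.
Qed.

Definition isotropic_frame (U : 'M[K]_(6, 3)) := U^T *m w *m U = 0.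

Lemma transvection_path U : isotropic_frame U ->
  symplectic_path (1%:M + U *m (U^T *m w)).
Proof.
move=> HU; exists (fun s => 1%:M + s *: (U *m (U^T *m w))); split.
- apply: polycurve_add; first exact: polycurve_cst.
  by apply: polycurve_scale; exact: polycurve_cst.
- by rewrite scale0r addr0.
- by rewrite scale1r.
move=> s; split.
  by rewrite scalemxAl det_ImulmxC -scalemxAr HU scaler0 addr0 det1.
set T := U *m (U^T *m w).
have TT : T *m T = 0 by rewrite -mulmxA (mulmxA _ U) HU mul0mx mulmx0.
have Tw : T^T *m w = - (w *m T).
  by rewrite !trmx_mul trmxK wT !mulNmx !mulmxA.
rewrite [(_ + _)^T]linearD /= trmx1 [(s *: T)^T]linearZ /= mulmxDl mul1mx -scalemxAl Tw scalerN.
rewrite mulmxDr mulmx1 mulmxDl mulNmx -scalemxAl -!scalemxAr -mulmxA TT mulmx0 !scaler0 subr0.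
by rewrite subrK.
Qed.

Definition linked (t u : tensor K 3 6) : Prop :=
  exists g c, [/\ symplectic_path g, c != 0 & u = c *: tensor_act g t].

Lemma linked_trans t u v : linked t u -> linked u v -> linked t v.
Proof.
move=> [g [c [Pg c0 ->]]] [h [d [Ph d0 ->]]]; exists (g *m h), (d * c); split.
- exact: symplectic_pathM.
- by rewrite mulf_neq0.
- by rewrite tensor_actZ tensor_act_comp scalerA.
Qed.

Lemma linked_transverse (U V : 'M[K]_(6, 3)) : isotropic_frame U -> isotropic_frame V ->
  \det (V^T *m w *m U) != 0 -> linked (wedge (U^T *m w)) (wedge (V^T *m w)).
Proof.
move=> HU HV dD; set D := V^T *m w *m U in dD.
have Du : D \in unitmx by rewrite unitmxE unitfE.
pose V' := V *m (invmx D)^T.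
have V'T : V'^T = invmx D *m V^T by rewrite trmx_mul trmxK.
have HV' : isotropic_frame V'.
  rewrite /isotropic_frame V'T -!mulmxA (mulmxA V^T) (mulmxA _ V) -/V' HV mul0mx mulmx0 //.
have VU : V'^T *m w *m U = 1%:M by rewrite V'T -!mulmxA (mulmxA V^T) mulVmx.
have UV : U^T *m w *m V' = - 1%:M by rewrite -[LHS]opprK -(form_tr wT) VU trmx1.
pose g := (1%:M + V' *m (V'^T *m w)) *m (1%:M + U *m (U^T *m w)).
have gE : U^T *m w *m g = - invmx D *m (V^T *m w).
  rewrite /g (mulmxA (U^T *m w)) (mulmxDr (U^T *m w)) mulmx1 (mulmxA (U^T *m w) V') UV mulNmx mul1mx.
  rewrite mulmxDr mulmx1 (mulmxA _ U) mulmxBl HU VU sub0r mulNmx mul1mx addrAC subrr sub0r.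
  by rewrite V'T mulNmx mulmxA.
exists g, (\det (- invmx D))^-1.
have d0 : \det (- invmx D) != 0.
  by rewrite -scaleN1r detZ mulf_neq0 ?expf_neq0 ?oppr_eq0 ?oner_eq0 // det_inv invr_eq0.
split; last by rewrite tensor_act_wedge gE wedge_mul scalerA mulVf // scale1r.
- by apply: symplectic_pathM; exact: transvection_path.
- by rewrite invr_eq0.
Qed.

Lemma det_mul_row_free (M : 'M[K]_(3, 6)) (A : 'M[K]_(6, 3)) : \det (M *m A) != 0 -> row_free M.
Proof.
rewrite -unitfE -unitmxE => u; apply/row_freeP; exists (A *m invmx (M *m A)).
by rewrite mulmxA mulmxV.
Qed.

Lemma trmx_invmx_skew : (invmx w)^T = - invmx w.
Proof.
have E : - w *m - invmx w = 1%:M by rewrite mulNmx mulmxN opprK mulmxV.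
rewrite trmx_inv wT -[LHS]mulmx1 -E mulKmx //.
by have [] := mulmx1_unit E.
Qed.

Lemma lagrangian_frame (M : 'M[K]_(3, 6)) : lagrangian w M ->
  exists2 U, isotropic_frame U & M = U^T *m w.
Proof.
move=> [Mf M0]; exists (M *m invmx w)^T; last by rewrite trmxK mulmxKV.
by rewrite /isotropic_frame trmxK mulmxKV // trmx_mul trmx_invmx_skew mulNmx mulmxN mulmxA M0 oppr0.
Qed.

Lemma isotropic_lagrangian U : isotropic_frame U -> row_free (U^T *m w) -> lagrangian w (U^T *m w).
Proof.
move=> HU Uf; split=> //.
by rewrite mulmxK // trmx_mul trmxK wT mulNmx mulmxN mulmxA HU oppr0.
Qed.

Variables E F : 'M[K]_(6, 3).
Hypotheses (EE : E^T *m w *m E = 0) (FF : F^T *m w *m F = 0).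
Hypotheses (EF : E^T *m w *m F = 1%:M) (FE : F^T *m w *m E = - 1%:M).

Definition primitive (t : tensor K 3 6) := ext_power t /\ forall z, contraction w t z = 0.

Lemma lagrangian_primitive M : lagrangian w M -> primitive (wedge M).
Proof. by move=> [_ M0]; split; [exact: wedge_ext|move=> z; exact: contraction_wedge]. Qed.

Lemma primitive_test t : primitive t -> t != 0 -> exists tau, tensor_eval t (test E F tau) != 0.
Proof.
move=> [Ht Ct]; apply: contra_neqP => no; apply: (test_ext_eq0 wu EE FF EF FE) => // tau.
by apply/eqP; apply: contra_notT no => ?; exists tau.
Qed.

Lemma det_isotropicC (U V : 'M[K]_(6, 3)) : \det (U^T *m w *m V) != 0 -> \det (V^T *m w *m U) != 0.
Proof.
by rewrite -det_tr (form_tr wT) -scaleN1r detZ mulf_eq0 negb_or => /andP [].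
Qed.

Local Notation hub := (wedge ((hub_frame E F)^T *m w)).

Lemma test_lagrangian tau : lagrangian w ((test E F tau)^T *m w).
Proof.
apply: isotropic_lagrangian; first exact: (test_isotropic EE FF EF FE).
exact: det_mul_row_free (test_hub EE FF EF FE tau).
Qed.

Lemma linked_test_hub tau : linked (wedge ((test E F tau)^T *m w)) hub /\ linked hub (wedge ((test E F tau)^T *m w)).
Proof.
have HT := test_isotropic EE FF EF FE tau; have HH := hub_isotropic EE FF EF FE.
have dT := test_hub EE FF EF FE tau.
by split; apply: linked_transverse => //; exact: det_isotropicC.
Qed.

Lemma linked_lagrangian t u : lagrangian_cone w t -> lagrangian_cone w u -> linked t u.
Proof.
have H v : lagrangian_cone w v -> linked v hub /\ linked hub v.
  move=> [M LM ->]; have [U HU EM] := lagrangian_frame LM.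
  have [tau] := primitive_test (lagrangian_primitive LM) (row_free_wedge_neq0 (proj1 LM)).
  rewrite tensor_eval_wedge EM => d.
  have HT := test_isotropic EE FF EF FE tau; have [th ht] := linked_test_hub tau.
  split.
    by apply: linked_trans th; apply: linked_transverse => //; exact: det_isotropicC.
  by apply: (linked_trans ht); exact: linked_transverse.
by move=> /H [th _] /H [_ hu]; exact: linked_trans hu.
Qed.

(* The limit at infinity of the transvections [1 + s U U^T w] sends [t] to the
   line of [wedge (U^T w)], as soon as [t] does not vanish on [U]. *)
Lemma primitive_degeneration t : primitive t -> t != 0 -> exists p : K -> tensor K 3 6,
  [/\ polycurve p, lagrangian_cone w (p 0) & forall s, s != 0 -> linked t (p s)].
Proof.
move=> Pt t0; have [tau] := primitive_test Pt t0; set U := test E F tau => eU.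
have HU : isotropic_frame U := test_isotropic EE FF EF FE tau.
pose T := U *m (U^T *m w).
exists (fun s => tensor_act (s *: 1%:M + T) t); split.
- apply: polycurve_tensor_act; apply: polycurve_add; last exact: polycurve_cst.
  by apply: polycurve_scale; exact: polycurve_cst.
- rewrite scale0r add0r tensor_act_factor; last by case: Pt.
  apply: lagrangian_coneZ => //; exists (U^T *m w) => //; exact: test_lagrangian.
- move=> s s0; exists (1%:M + (s^-1 *: T)), (s ^+ 3); split.
  + have sq : sqrtC s^-1 * sqrtC s^-1 = s^-1 by rewrite -expr2 sqrtCK.
    have -> : s^-1 *: T = (sqrtC s^-1 *: U) *m ((sqrtC s^-1 *: U)^T *m w).
      by rewrite [(_ *: U)^T]linearZ /= -!scalemxAl -scalemxAr scalerA sq.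
    apply: transvection_path.
    by rewrite /isotropic_frame [(_ *: U)^T]linearZ /= -!scalemxAl -scalemxAr HU !scaler0.
  + by rewrite expf_neq0.
  + by rewrite -tensor_act_scale scalerDr scalerA mulfV // scale1r.
Qed.

End SymplecticPaths.

Section Subspaces.
Variables (K : numClosedFieldType) (V : vectType K).

Lemma exists_vspace (P : V -> Prop) :
  P 0 -> (forall a u v, P u -> P v -> P (a *: u + v)) ->
  exists U : {vspace V}, forall v, v \in U <-> P v.
Proof.
move=> P0 PD; apply: contrapT => no.
suff H n : exists U : {vspace V}, (forall v, v \in U -> P v) /\ (n <= \dim U)%N.
  have [U [_ le]] := H (\dim (fullv : {vspace V})).+1.
  by have := leq_trans le (dimvS (subvf U)); rewrite ltnn.
elim: n => [|n [U [UP le]]].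
  by exists 0%VS; split=> // v; rewrite memv0 => /eqP ->.
have [v [Pv vU]] : exists v, P v /\ v \notin U.
  apply: contrapT => full; apply: no; exists U => v; split; first exact: UP.
  by move=> Pv; apply: contrapT => /negP vU; apply: full; exists v.
exists (U + <[v]>)%VS; split.
  move=> _ /memv_addP [u uU [_ /vlineP [a ->] ->]].
  by rewrite addrC; apply: PD => //; exact: UP.
apply: leq_ltn_trans le _; rewrite (ltn_leqif (dimv_leqif_sup (addvSl _ _))).
by rewrite subv_add negb_and [X in _ || X]vU orbT.
Qed.

Lemma dim_le_functionals (I : finType) (L : I -> V -> K) (U U' : {vspace V}) :
  (forall i a u v, L i (a *: u + v) = a * L i u + L i v) ->
  (forall v, v \in U -> (forall i, L i v = 0) -> v \in U') ->
  (\dim U <= \dim U' + #|I|)%N.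
Proof.
move=> Llin H.
pose f (v : V) : 'rV[K]_#|I| := \row_i L (enum_val i) v.
have fl : linear f by move=> a u v; apply/rowP => i; rewrite !mxE Llin.
pose g : {linear V -> 'rV[K]_#|I|} := HB.pack f (GRing.isLinear.Build _ _ _ _ _ fl).
rewrite -(limg_ker_dim (linfun g) U) leq_add //.
  apply: dimvS; apply/subvP => v /memv_capP [vU]; rewrite memv_ker lfunE => /eqP fv.
  apply: H => // i; have /rowP /(_ (enum_rank i)) := fv.
  by rewrite !mxE enum_rankK.
apply: leq_trans (dimvS (subvf _)) _; rewrite dimvf dim_matrix; exact: eq_leq (mul1n _).
Qed.

Lemma dual_family_dim (I : finType) (L : I -> V -> K) (v : I -> V) (U : {vspace V}) :
  (forall i a u v, L i (a *: u + v) = a * L i u + L i v) ->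
  (forall i, v i \in U) -> (forall i j, L i (v j) = (i == j)%:R) -> (#|I| <= \dim U)%N.
Proof.
move=> Llin vU Lv; pose X := [tuple v (enum_val i) | i < #|I|].
have L0 i : L i 0 = 0 by have := Llin i (-1) 0 0; rewrite scaler0 addr0 mulN1r addNr.
have Lsum i (J : finType) (c : J -> K) (u : J -> V) : L i (\sum_j c j *: u j) = \sum_j c j * L i (u j).
  rewrite -!big_enum /=; elim: (enum J) => [|j r IH]; rewrite ?big_nil ?big_cons ?L0 //.
  by rewrite Llin IH.
have fX : free X.
  apply/freeP => k E i.
  have : L (enum_val i) (\sum_(i < #|I|) k i *: v (enum_val i)) = 0.
    rewrite -[RHS](L0 (enum_val i)) -[in RHS]E; congr L; apply: eq_bigr => j _.
    by rewrite -tnth_nth tnth_mktuple.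
  rewrite Lsum (bigD1 i) //= Lv eqxx mulr1 big1 ?addr0 // => j ji.
  by rewrite Lv (inj_eq enum_val_inj) eq_sym (negPf ji) mulr0.
have XU : (<<X>> <= U)%VS by apply/span_subvP => u /mapP [i _ ->].
by have := dimvS XU; rewrite (eqP fX) size_tuple.
Qed.

Lemma vspace_closed (U : {vspace V}) : zariski_closed [set v | v \in U].
Proof.
pose e := vbasis (fullv : {vspace V}).
have -> : [set v | v \in U] = [set v | forall i, coord e i (v - projv U v) = 0].
  apply/seteqP; split=> v /=.
    by move=> vU i; rewrite projv_id // subrr linear0.
  move=> H; suff <- : projv U v = v by exact: memv_proj.
  apply/eqP; rewrite eq_sym -subr_eq0 (coord_vbasis (memvf (v - _))).
  by rewrite big1 // => i _; rewrite H scale0r.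
apply: zariski_closed_zeros => i; apply: polyfun_scalar => a u v.
rewrite linearP opprD addrACA -scalerN -scalerDr linearP //.
Qed.

End Subspaces.

Section PrimitivePart.
Variables (K : numClosedFieldType) (w : 'M[K]_6).
Hypotheses (wT : w^T = - w) (wu : w \in unitmx).

Lemma ext_power_linear k n a (t u : tensor K k n) : ext_power t -> ext_power u -> ext_power (a *: t + u).
Proof.
move=> Ht Hu s f; rewrite !ffunE Ht Hu; move: ((-1) ^+ s) => e.
by rewrite /GRing.scale /= mulrDr mulrCA.
Qed.

Lemma ext_power0 k n : ext_power (0 : tensor K k n).
Proof. by move=> s f; rewrite !ffunE mulr0. Qed.

Lemma contraction0 z : contraction w 0 z = 0.
Proof. by rewrite /contraction big1 // => h _; rewrite ffunE mul0r. Qed.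

Lemma contraction_basis t : (forall i : 'I_6, contraction w t (delta_mx i 0) = 0) ->
  forall z, contraction w t z = 0.
Proof.
move=> H z; transitivity (\sum_i z i 0 * contraction w t (delta_mx i 0)); last first.
  by rewrite big1 // => i _; rewrite H mulr0.
rewrite /contraction; under [RHS]eq_bigr => i _ do rewrite mulr_sumr.
rewrite exchange_big; apply: eq_bigr => h _ /=.
rewrite (bigD1 (h 2)) //= !mxE !eqxx big1 ?addr0; first by rewrite mulr1; ring.
by move=> i hi; rewrite mxE eq_sym (negPf hi) !mulr0.
Qed.

Lemma dim_ext_power (X : {vspace tensor K 3 6}) :
  (forall t, ext_power t -> t \in X) -> (20 <= \dim X)%N.
Proof.
move=> HX; pose I := {A : {set 'I_6} | #|A| == 3%N}.
have cI : #|{: I}| = 20%N.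
  rewrite card_sig; apply: etrans (etrans (card_draws 'I_6 3) _); last by rewrite card_ord.
  by apply: eq_card => A; rewrite !inE.
rewrite -cI.
pose h (A : I) : {ffun 'I_3 -> 'I_6} := [ffun i : 'I_3 => nth ord0 (enum (val A)) i].
have cA (A : I) : #|val A| = 3%N by exact/eqP/(valP A).
have sz (A : I) : size (enum (val A)) = 3%N by rewrite -cardE cA.
apply: (dual_family_dim (L := fun A (t : tensor K 3 6) => t (h A))
  (v := fun A => wedge (rowsub (h A) (1%:M : 'M[K]_6)))) => [A a t u|A|A B].
- by rewrite !ffunE.
- exact/HX/wedge_ext.
rewrite ffunE; have [->|AB] := eqVneq A B.
  rewrite (_ : colsub _ _ = 1%:M) ?det1 //; apply/matrixP => i j; rewrite !mxE !ffunE.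
  by rewrite nth_uniq ?enum_uniq ?sz.
have [x xB xA] : exists2 x, x \in val B & x \notin val A.
  apply/subsetPn; apply: contra AB => BA; rewrite -val_eqE eq_sym eqEcard BA.
  by rewrite !cA.
have xi : (index x (enum (val B)) < size (enum (val B)))%N by rewrite index_mem mem_enum.
rewrite sz in xi.
rewrite (expand_det_row _ (Ordinal xi)) big1 // => j _; rewrite !mxE !ffunE /= nth_index ?mem_enum //.
case: eqP => [E|_]; last by rewrite mul0r.
by case/negP: xA; rewrite E -mem_enum mem_nth // sz.
Qed.

Variable W0 : {vspace tensor K 3 6}.
Hypothesis W0P : forall t, t \in W0 <-> primitive w t.

Lemma primitive_act g t : similitude w g -> primitive w t -> primitive w (tensor_act g t).
Proof.
move=> [gu [c [c0 H]]] [Ht Ct]; split; first exact: tensor_act_ext.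
by move=> z; rewrite (contraction_act _ _ H) Ct mulr0.
Qed.

Lemma primitive_submodule : submodule (SO4case w) (@V4_act K) W0.
Proof.
move=> g t /(SO4case_similitude wu) Sg /W0P Pt; apply/W0P; exact: primitive_act.
Qed.

Variables E F : 'M[K]_(6, 3).
Hypotheses (EE : E^T *m w *m E = 0) (FF : F^T *m w *m F = 0).
Hypotheses (EF : E^T *m w *m F = 1%:M) (FE : F^T *m w *m E = - 1%:M).

Lemma dim_primitive : \dim W0 = 14%N.
Proof.
apply/eqP; rewrite eqn_leq; apply/andP; split.
  pose I : finType := ({ffun 'I_3 -> bool} + bool * 'I_3)%type.
  have : (\dim W0 <= \dim (0%VS : {vspace tensor K 3 6}) + #|I|)%N.
    apply: (dim_le_functionals (L := fun (tau : I) t => tensor_eval t (test E F tau))) => [tau a t u|t /W0P [Ht Ct] H].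
      exact: tensor_eval_linear.
    by rewrite (test_ext_eq0 wu EE FF EF FE Ht Ct H) mem0v.
  by rewrite dimv0 card_sum card_ffun card_prod !card_ord card_bool.
have [||X HX] := exists_vspace (P := @ext_power K 3 6).
- exact: ext_power0.
- by move=> a t u; exact: ext_power_linear.
have := dim_ext_power (fun t => proj2 (HX t)).
have : (\dim X <= \dim W0 + #|'I_6|)%N.
  apply: (dim_le_functionals (L := fun i t => contraction w t (delta_mx i 0))) => [i a t u|t /HX Ht Ct].
    exact: contraction_linear.
  by apply/W0P; split=> //; exact: contraction_basis.
rewrite card_ord => le1 le2; have := leq_trans le2 le1; by rewrite -[20%N]/(14 + 6)%N leq_add2r.
Qed.

Definition pairing (t u : tensor K 3 6) : K :=
  \sum_h t h * tensor_act (invmx w) u h.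

Lemma pairing_linear_l u a t t' : pairing (a *: t + t') u = a * pairing t u + pairing t' u.
Proof.
rewrite /pairing mulr_sumr -big_split; apply: eq_bigr => h _ /=.
by rewrite !ffunE /GRing.scale /=; ring.
Qed.

Lemma pairing_linear_r t a u u' : pairing t (a *: u + u') = a * pairing t u + pairing t u'.
Proof.
rewrite /pairing tensor_act_linear mulr_sumr -big_split; apply: eq_bigr => h _ /=.
by rewrite !ffunE /GRing.scale /=; ring.
Qed.

Lemma pairing_wedge t U : ext_power t -> pairing t (wedge (U^T *m w)) = 6%:R * tensor_eval t U.
Proof.
move=> Ht; rewrite /pairing tensor_act_wedge mulmxK //.
by rewrite (ext_sum_wedge U^T Ht) trmxK.
Qed.

Lemma primitive_irreducible : irreducible_submodule (SO4case w) (@V4_act K) W0.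
Proof.
split; last 2 first.
- exact: primitive_submodule.
- move=> U UW Us; have [->|U0] := eqVneq U 0%VS; [by left|right].
  have [t tU t0] : exists2 t, t \in U & t != 0.
    by exists (vpick U); rewrite ?memv_pick ?vpick0.
  have UP u : u \in U -> primitive w u by move=> uU; apply/W0P; exact: (subvP UW).
  have linkU u v : u \in U -> linked w u v -> v \in U.
    move=> uU [g [c [Pg c0 ->]]]; rewrite memvZ //; apply: Us => //.
    exact: symplectic_path_SO4case.
  have [p [Hp Lp0 linkp]] := primitive_degeneration wT wu EE FF EF FE (UP _ tU) t0.
  have p0U : p 0 \in U.
    by apply: (polycurve_closed Hp (vspace_closed U)) => s s0; apply: (linkU t) => //; exact: linkp.
  have LU u : lagrangian_cone w u -> u \in U.
    by move=> Lu; apply: (linkU (p 0)) => //; exact: (linked_lagrangian wT wu EE FF EF FE).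
  apply/eqP; rewrite eqEdim UW.
  suff : (\dim W0 <= \dim (0%VS : {vspace tensor K 3 6}) + #|'I_(\dim U)|)%N.
    by rewrite dimv0 card_ord.
  apply: (dim_le_functionals (L := fun (i : 'I_(\dim U)) t => pairing t (vbasis U)`_i)) => [i a u v|u /W0P Pu H].
    exact: pairing_linear_l.
  have Hu v : v \in U -> pairing u v = 0.
    move=> vU; rewrite (coord_vbasis vU).
    have u0 : pairing u 0 = 0 by have := pairing_linear_r u (-1) 0 0; rewrite scaler0 addr0 mulN1r addNr.
    rewrite -big_enum /=; elim: (enum _) => [|j r IH]; rewrite ?big_nil ?big_cons //.
    by rewrite pairing_linear_r H IH mulr0 addr0.
  rewrite memv0; apply/eqP; apply: (test_ext_eq0 wu EE FF EF FE); [by case: Pu|by case: Pu|move=> tau].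
  have : pairing u (wedge ((test E F tau)^T *m w)) = 0.
    by apply/Hu/LU; exists ((test E F tau)^T *m w) => //; exact: (test_lagrangian wT wu EE FF EF FE).
  rewrite pairing_wedge; last by case: Pu.
  by move/eqP; rewrite mulf_eq0 pnatr_eq0 => /eqP.
- by rewrite -dimv_eq0 dim_primitive.
Qed.

Lemma V4_wE : V4_w w = W0.
Proof.
apply: xget_unique => [|W [Wext [W0' Wsub Wirr] dW]].
  split; [by move=> t /W0P []|exact: primitive_irreducible|exact: dim_primitive].
have sub : submodule (SO4case w) (@V4_act K) (W :&: W0)%VS.
  move=> g t Gg /memv_capP [tW t0]; apply/memv_capP; split; first exact: Wsub.
  exact: primitive_submodule.
have [I0|IW] := Wirr _ (capvSl W W0) sub.
  have : (\dim W <= \dim (0%VS : {vspace tensor K 3 6}) + #|'I_6|)%N.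
    apply: (dim_le_functionals (L := fun i t => contraction w t (delta_mx i 0))) => [i a t u|t tW Ct].
      exact: contraction_linear.
    rewrite -I0; apply/memv_capP; split=> //; apply/W0P; split; first exact: Wext.
    exact: contraction_basis.
  by rewrite dW dimv0 card_ord.
apply/eqP; rewrite eqEdim dW dim_primitive leqnn andbT -IW capvSr //.
Qed.

End PrimitivePart.

Section Case4Theorem.
Variables (K : numClosedFieldType) (w : 'M[K]_6).
Hypotheses (wT : w^T = - w) (wu : w \in unitmx).

Lemma isotropic4E : isotropic4 w = lagrangian_cone w.
Proof.
have [E [F [EE FF EF FE]]] := symplectic_basis wT wu.
have [||W0 W0P] := exists_vspace (P := primitive w).
- by split; [exact: ext_power0|exact: contraction0].
- move=> a t u [Ht Ct] [Hu Cu]; split; first exact: ext_power_linear.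
  by move=> z; rewrite contraction_linear Ct Cu mulr0 addr0.
have conePrim t : lagrangian_cone w t -> primitive w t.
  by move=> [M LM ->]; exact: lagrangian_primitive.
have link_orbit t u : linked w t u -> proj_orbit (SO4case w) (@V4_act K) t u.
  move=> [g [c [Pg c0 ->]]]; exists g, c; split=> //; exact: symplectic_path_SO4case.
rewrite /isotropic4 (V4_wE wT wu W0P EE FF EF FE); apply: closed_orbitE.
- exact: lagrangian_cone_closed.
- have L := test_lagrangian wT wu EE FF EF FE (inr (true, 0)).
  exists (wedge ((test E F (inr (true, 0)))^T *m w)); split; last by exists ((test E F (inr (true, 0)))^T *m w).
  by apply/W0P; exact: lagrangian_primitive.
- by move=> /lagrangian_cone_neq0 /eqP.
- by move=> c t; exact: lagrangian_coneZ.
- by move=> g t /(SO4case_similitude wu); exact: lagrangian_cone_act.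
- by move=> g t /(SO4case_similitude wu) Sg _; exact: lagrangian_cone_actV.
- by move=> t u Lt Lu; apply: link_orbit; exact: (linked_lagrangian wT wu EE FF EF FE).
- move=> t /W0P Pt t0.
  have [p [Hp Lp0 linkp]] := primitive_degeneration wT wu EE FF EF FE Pt t0.
  by exists p; split=> // s s0; apply: link_orbit; exact: linkp.
Qed.

End Case4Theorem.

Theorem proposition2p9 (R : realType) :
  [/\ (* a = 2 *)
      forall w : 'M[complex R]_3, \det w != 0 ->
        zero_locus2 w = isotropic2 w,
      (* a = 4 *)
      forall w : 'M[complex R]_6, w^T = - w -> pfaffian6 w != 0 ->
        zero_locus4 w = isotropic4 w
    & (* a = 8 *)
      forall w : J8 (complex R), det8 w != 0 ->
        zero_locus8 w = isotropic8 w].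
Proof.
split=> w.
- by move=> dw; rewrite (zero_locus2E dw) (isotropic2E dw).
- move=> wT pw; have wu := pfaffian6_unit wT pw.
  by rewrite (zero_locus4E wT wu) (isotropic4E wT wu).
- exact: zero_locus8E.
Qed.
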